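(* Let $\mu,\nu\in\mathcal P$ with $\mu\leq_{cd}\nu$. Let $G$ be the right-continuous quantile function of $\mu$, let $R,S$ be the functions defined in the context, and define the measure $\hat\pi^{R,S}$ on $[0,1]\times\mathbb R\times\mathbb R$ by $$\hat\pi^{R,S}(du,dx,dy)=du\,\delta_{G(1-u)}(dx)\,\chi_{R(u),G(1-u),S(u)}(dy).$$ Then $\hat\pi^{R,S}=\hat\pi^D$, where $\hat\pi^D$ is the lifted shadow coupling of the decreasing quantile lift $\hat\mu^D$ of $\mu$ and $\nu$; consequently $\int_0^1\hat\pi^{R,S}\,du$ (the marginal of $\hat\pi^{R,S}$ on the last two coordinates) is the decreasing supermartingale coupling $\pi^D$ of $\mu$ and $\nu$.
   Context: $\mathcal M$ (resp. $\mathcal P$) is the set of finite positive (resp. probability) Borel measures on $\mathbb R$ with finite first moment. $\lambda$ is Lebesgue measure on $[0,1]$. $\Pi(\eta,\chi)$ is the set of couplings; $\Pi_S(\mu,\nu)$ is the set of $\pi\in\Pi(\mu,\nu)$ with $\int y\,\pi_x(dy)\leq x$ for $\mu$-a.e. $x$, where $\pi(dx,dy)=\mu(dx)\pi_x(dy)$. For $\eta,\chi\in\mathcal M$: $\eta\leq\chi$ is setwise; $\eta\leq_{cd}\chi$ means $\int f\,d\eta\leq\int f\,d\chi$ for all convex non-increasing $f$; $\eta\leq_{pcd}\chi$ means the same for all non-negative convex non-increasing $f$. If $\eta\leq_{pcd}\nu$, there is a unique $S^\nu(\eta)\in\mathcal M$ (the shadow) with $\eta\leq_{cd}S^\nu(\eta)\leq\nu$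 and $S^\nu(\eta)\leq_{cd}\theta$ for all $\theta\in\mathcal M$ with $\eta\leq_{cd}\theta\leq\nu$. Decreasing coupling: $\pi^D$ is the (existing and unique) element of $\Pi_S(\mu,\nu)$ such that, for each $x\in\mathbb R$, the restriction $\pi^D|_{[x,\infty)\times\mathbb R}$ has second marginal $S^\nu(\mu|_{[x,\infty)})$. Lifted coupling: $G(u)=\inf\{k:\mu((-\infty,k])>u\}$. The decreasing quantile lift is $\hat\mu^D(du,dx)=du\,\delta_{G(1-u)}(dx)\in\Pi(\lambda,\mu)$, and $\mu_u:=\int_0^u\delta_{G(1-v)}\,dv$ for $u\in[0,1]$ (so $\mu_u$ is the right-most part of $\mu$ of mass $u$). $\hat\Pi_S(\hat\mu^D,\nu)$ is the set of probability measures $\hat\pi$ on $[0,1]\times\mathbb R\times\mathbb R$ with marginal $\hat\mu^D$ on the first two coordinates and $\nu$ on the last, whose disintegration $\hat\pi_{(u,x),\cdot}(dy)$ with respect to $\hat\mu^D$ satisfies $\int y\,\hat\pi_{(u,x),\cdot}(dy)\leq x$ for $\hat\mu^D$-a.e. $(u,x)$. $\hat\pi^D$ is the (existing and unique) element of $\hat\Pi_S(\hat\mu^D,\nu)$ such that for each $u\in[0,1]$ the measure $A\times B\mapsto\hat\pi^D([0,u]\times A\times B)$ has marginals $\mu_u$ and $S^\nu(\mu_u)$. Functions $R,S$: for $\eta\in\mathcal M$ let $P_\eta(k)=\int(k-x)^+\eta(dx)$ and $C_\eta(k)=\int(x-k)^+\eta(dx)$. For $u\in(0,1)$ let $\mathcal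 E_u=P_\nu-P_\mu+C_\mu-C_{\mu_u}\geq0$, let $\mathcal E_u^c$ be its convex hull (the largest convex function below $\mathcal E_u$), let $\phi(u)$ be the right derivative of $\mathcal E_u^c$ at $G(1-u)$, and let $L_u(k)=\mathcal E_u^c(G(1-u))+\phi(u)(k-G(1-u))$. Then $$R(u)=\inf\{k\leq G(1-u):\mathcal E_u^c(k)=L_u(k)\},\qquad S(u)=\sup\{k\geq G(1-u):\mathcal E_u^c(k)=L_u(k)\},$$ with values in $[-\infty,\infty]$ (values at $u\in\{0,1\}$ are irrelevant). Kernel $\chi$: for real $c\leq x\leq d$, $\chi_{c,x,d}=\frac{d-x}{d-c}\delta_c+\frac{x-c}{d-c}\delta_d$ if $c<d$, and $\chi_{c,x,d}=\delta_x$ if $c=d$. If $-\infty=c<x\leq d<\infty$, $\chi_{c,x,d}=\delta_d$; if $-\infty<c\leq x<d=\infty$, $\chi_{c,x,d}=\delta_c$. *)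

(* Defs.v *)
From HB Require Import structures.
From mathcomp Require Import all_boot all_order all_algebra.
From mathcomp Require Import all_classical all_reals all_analysis.
From mathcomp Require Import measurable_realfun.

Set Implicit Arguments.
Unset Strict Implicit.
Unset Printing Implicit Defensive.

Import Order.TTheory GRing.Theory Num.Theory.
Import numFieldNormedType.Exports.

Local Open Scope classical_set_scope.
Local Open Scope ring_scope.

(* A Borel measure on the real line is a measure on [measurableTypeR R].
   Measures are total set functions in the library, so equality of measures is
   equality on measurable sets. *)

Definition first_moment (R : realType)
    (eta : {measure set (measurableTypeR R) -> \bar R}) : Prop :=
  eta.-integrable setT (fun x : measurableTypeR R => (x : R)%:E).

Definition measM (R : realType)
    (eta : {measure set (measurableTypeR R) -> \bar R}) : Prop :=
  (eta setT < +oo)%E /\ first_moment eta.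

Definition measure_le (R : realType)
    (eta chi : {measure set (measurableTypeR R) -> \bar R}) : Prop :=
  forall A, measurable A -> (eta A <= chi A)%E.

(* For [eta] with finite mass and first moment, the negative part of a convex
   function is integrable, so the integrals below are well defined in
   ]-oo, +oo]. *)
Definition cd_le (R : realType)
    (eta chi : {measure set (measurableTypeR R) -> \bar R}) : Prop :=
  forall f : R -> R, @convex_function R R^o setT f -> nonincreasing_fun f ->
    (\int[eta]_x (f x)%:E <= \int[chi]_x (f x)%:E)%E.

(* [theta] is the shadow S^nu(eta). *)
Definition is_shadow (R : realType)
    (nu eta theta : {measure set (measurableTypeR R) -> \bar R}) : Prop :=
  [/\ measM theta, cd_le eta theta, measure_le theta nu &
      forall theta' : {measure set (measurableTypeR R) -> \bar R},
        measM theta' -> cd_le eta theta' -> measure_le theta' nu ->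
        cd_le theta theta'].

Definition is_coupling d d' (X : measurableType d) (Y : measurableType d')
    (R : realType) (m : {measure set X -> \bar R})
    (n : {measure set Y -> \bar R})
    (pi : {measure set (X * Y) -> \bar R}) : Prop :=
  (forall A, measurable A -> pi (A `*` setT) = m A) /\
  (forall B, measurable B -> pi (setT `*` B) = n B).

Definition is_disintegration d d' (X : measurableType d)
    (Y : measurableType d') (R : realType) (m : {measure set X -> \bar R})
    (pi : {measure set (X * Y) -> \bar R}) (k : R.-pker X ~> Y) : Prop :=
  forall A B, measurable A -> measurable B ->
    pi (A `*` B) = (\int[m]_(x in A) k x B)%E.

(* [b z] is the starting position attached to [z]: the identity for couplings
   of two measures on the line, the second projection for lifted couplings.
   When [nu] has a first moment, [k z] has one for almost every [z]. When [m]
   and [nu] are probability measures, so is [pi]. *)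
Definition is_supermartingale_coupling d (X : measurableType d)
    (R : realType) (b : X -> R) (m : {measure set X -> \bar R})
    (nu : {measure set (measurableTypeR R) -> \bar R})
    (pi : {measure set (X * measurableTypeR R) -> \bar R}) : Prop :=
  is_coupling m nu pi /\
  exists k : R.-pker X ~> measurableTypeR R,
    is_disintegration m pi k /\
    {ae m, forall z, (\int[k z]_y (y : R)%:E <= (b z)%:E)%E}.

Definition is_decreasing_coupling (R : realType)
    (mu nu : probability (measurableTypeR R) R)
    (pi : {measure set (measurableTypeR R * measurableTypeR R) -> \bar R}) :
    Prop :=
  is_supermartingale_coupling (fun x : measurableTypeR R => x : R) mu nu pi /\
  forall x : R, exists theta : {measure set (measurableTypeR R) -> \bar R},
    is_shadow nu (mrestr mu (measurable_itv `[x, +oo[)) theta /\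
    forall B, measurable B -> pi (`[x, +oo[%classic `*` B) = theta B.

Definition image_measure d d' (X : measurableType d) (Y : measurableType d')
    (R : realType) (m : {measure set X -> \bar R}) (f : X -> Y)
    (mf : measurable_fun setT f) : {measure set Y -> \bar R} :=
  @measure_function_pushforward__canonical__measure_function_Measure _ _ _ _ _ m _ mf.

(* The right-continuous quantile function G. The values outside ]0, 1[, where
   the infimum may be meaningless, concern a null set of levels in [0, 1]. *)
Definition quantile (R : realType) (mu : probability (measurableTypeR R) R)
    (u : R) : R :=
  inf [set k : R | (u%:E < mu `]-oo, k]%classic)%E].

Section quantile_measurable.
Context (R : realType) (mu : probability (measurableTypeR R) R).

Lemma measurable_quantile : measurable_fun [set: R] (quantile mu).
Proof.
pose S (u : R) := [set k : R | (u%:E < mu `]-oo, k]%classic)%E].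
have Sle u v : u <= v -> S v `<=` S u.
  by move=> uv k /=; apply: le_lt_trans; rewrite lee_fin.
pose D := [set u | has_inf (S u)].
have DI : is_interval D.
  move=> x y [_ [l lx]] [[k ky] _] z /andP[xz zy]; split.
    by exists k; exact: Sle ky.
  by exists l => t /(Sle _ _ xz); exact: lx.
apply: (measurability (@RGenCInfty.G R)) => [|/= _ [_] [r] -> <-].
  exact: RGenCInfty.measurableE.
rewrite setTI.
have -> : quantile mu @^-1` `[r, +oo[ =
    (D `&` quantile mu @^-1` `[r, +oo[) `|`
    (~` D `&` [set _ | r <= 0]).
  rewrite [LHS](_ : _ = (D `|` ~` D) `&` quantile mu @^-1` `[r, +oo[).
    rewrite setIUl; congr (_ `|` _); apply/seteqP; split=> u [Du] /=;
    by rewrite in_itv /= andbT /quantile inf_out.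
  by rewrite setUv setTI.
have mD : measurable D by exact: is_interval_measurable.
apply: measurableU; last first.
  apply: measurableI; first exact: measurableC.
  have [r0|r0] := leP r 0.
    by rewrite (_ : [set _ | _] = setT)//; apply/seteqP; split.
  by rewrite (_ : [set _ | _] = set0)//; apply/seteqP; split.
apply: is_interval_measurable => x y [Dx rx] [Dy ry] z /andP[xz zy].
have Dz : D z by apply: (DI x y) => //; rewrite xz zy.
split => //; move: rx; rewrite /= !in_itv /= !andbT => /le_trans; apply.
apply: lb_le_inf; first by case: Dz.
move=> k Szk; apply: ge_inf; first by case: Dx.
exact: Sle Szk.
Qed.

Lemma measurable_dquantile :
  measurable_fun [set: measurableTypeR R]
    (fun u : measurableTypeR R => quantile mu (1 - u) : measurableTypeR R).
Proof.
apply: (measurableT_comp measurable_quantile).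
by apply: nonincreasing_measurable => // x y xy; rewrite lerB.
Qed.

Lemma measurable_dlift :
  measurable_fun [set: measurableTypeR R] (fun u : measurableTypeR R =>
    (u, quantile mu (1 - u)) : measurableTypeR R * measurableTypeR R).
Proof.
apply: measurable_fun_pair; [exact: measurable_id|exact: measurable_dquantile].
Qed.

End quantile_measurable.

(* mu_u = \int_0^u delta_{G(1-v)} dv: the right-most part of mu of mass u. *)
Definition right_part (R : realType) (mu : probability (measurableTypeR R) R)
    (u : R) : {measure set (measurableTypeR R) -> \bar R} :=
  image_measure (mrestr lebesgue_measure (measurable_itv `[0, u]))
    (measurable_dquantile mu).

(* The space [0, 1] * R is encoded as R * R, with measures carried by the strip
   [0, 1] * R. *)
Definition decreasing_lift (R : realType)
    (mu : probability (measurableTypeR R) R) :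
    {measure set (measurableTypeR R * measurableTypeR R) -> \bar R} :=
  image_measure (mrestr lebesgue_measure (measurable_itv `[0, 1]))
    (measurable_dlift mu).

Definition is_lifted_shadow_coupling (R : realType)
    (mu nu : probability (measurableTypeR R) R)
    (pihat : {measure set (measurableTypeR R * measurableTypeR R *
                           measurableTypeR R) -> \bar R}) : Prop :=
  is_supermartingale_coupling
    (fun z : measurableTypeR R * measurableTypeR R => z.2 : R)
    (decreasing_lift mu) nu pihat /\
  forall u : R, 0 <= u <= 1 ->
    exists theta : {measure set (measurableTypeR R) -> \bar R},
      [/\ is_shadow nu (right_part mu u) theta,
          forall A, measurable A ->
            pihat (`[0, u]%classic `*` A `*` setT) = right_part mu u A &
          forall B, measurable B ->
            pihat (`[0, u]%classic `*` setT `*` B) = theta B].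

Definition put_fun (R : realType)
    (eta : {measure set (measurableTypeR R) -> \bar R}) (k : R) : R :=
  \int[eta]_x Num.max (k - (x : R)) 0.

Definition call_fun (R : realType)
    (eta : {measure set (measurableTypeR R) -> \bar R}) (k : R) : R :=
  \int[eta]_x Num.max ((x : R) - k) 0.

(* The pointwise supremum of the convex minorants is itself the largest one. *)
Definition convex_hull (R : realType) (f : R -> R) (k : R) : R :=
  sup [set g k | g in [set g : R -> R |
    @convex_function R R^o setT g /\ forall x, g x <= f x]].

Definition right_derivative (R : realType) (f : R -> R) (x : R) : R :=
  lim ((h^-1 * (f (x + h) - f x)) @[h --> 0^'+]).

Section RS.
Context (R : realType) (mu nu : probability (measurableTypeR R) R) (u : R).

Definition E_fun (k : R) : R :=
  put_fun nu k - put_fun mu k + call_fun mu k - call_fun (right_part mu u) k.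

Definition L_fun (k : R) : R :=
  let g := quantile mu (1 - u) in
  convex_hull E_fun g + right_derivative (convex_hull E_fun) g * (k - g).

Definition R_fun : \bar R :=
  ereal_inf [set k%:E | k in [set k : R |
    k <= quantile mu (1 - u) /\ convex_hull E_fun k = L_fun k]].

Definition S_fun : \bar R :=
  ereal_sup [set k%:E | k in [set k : R |
    quantile mu (1 - u) <= k /\ convex_hull E_fun k = L_fun k]].

End RS.

(* Meaningful for c <= x <= d not both infinite; the last case is a dummy. *)
Definition chi (R : realType) (c : \bar R) (x : R) (d : \bar R)
    (B : set (measurableTypeR R)) : \bar R :=
  match c, d with
  | c%:E, d%:E =>
      if c == d then \d_(x : measurableTypeR R) B
      else (((d - x) / (d - c))%:E * \d_(c : measurableTypeR R) B +
            ((x - c) / (d - c))%:E * \d_(d : measurableTypeR R) B)%E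
  | -oo%E, d%:E => \d_(d : measurableTypeR R) B
  | c%:E, +oo%E => \d_(c : measurableTypeR R) B
  | _, _ => \d_(x : measurableTypeR R) B
  end.

(* [pihat] is du delta_{G(1-u)}(dx) chi_{R(u),G(1-u),S(u)}(dy): the measures
   chi_{R(u),G(1-u),S(u)}, 0 < u < 1, are the values of a probability kernel
   and [pihat] is obtained by integrating this kernel along the graph of
   u |-> G(1-u). *)
Definition is_RS_lift (R : realType)
    (mu nu : probability (measurableTypeR R) R)
    (pihat : {measure set (measurableTypeR R * measurableTypeR R *
                           measurableTypeR R) -> \bar R}) : Prop :=
  exists K : R.-pker (measurableTypeR R) ~> (measurableTypeR R),
    (forall u : R, 0 < u < 1 -> forall B, measurable B ->
       K u B = chi (R_fun mu nu u) (quantile mu (1 - u)) (S_fun mu nu u) B) /\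
    (forall A, measurable A ->
       pihat A = (\int[lebesgue_measure]_(u in `[0%R, 1%R])
                    K u (xsection A (u, quantile mu (1 - u)%R)))%E).

Lemma measurable_proj23 (R : realType) :
  measurable_fun setT
    (fun z : measurableTypeR R * measurableTypeR R * measurableTypeR R =>
      (z.1.2, z.2)).
Proof.
apply: measurable_fun_pair; last exact: measurable_snd.
exact: measurableT_comp measurable_snd measurable_fst.
Qed.

Definition marginal23 (R : realType)
    (pihat : {measure set (measurableTypeR R * measurableTypeR R *
                           measurableTypeR R) -> \bar R}) :
    {measure set (measurableTypeR R * measurableTypeR R) -> \bar R} :=
  image_measure pihat (@measurable_proj23 R).

(* Membership in Q and uniqueness, so that [is_the_measure Q m] reads
   "m is the measure satisfying Q". *)
Definition is_the_measure d (T : measurableType d) (R : realType)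
    (Q : {measure set T -> \bar R} -> Prop) (m : {measure set T -> \bar R}) :
    Prop :=
  Q m /\ forall m', Q m' -> forall A, measurable A -> m' A = m A.

(* Main.v *)
(* Measures on the line are encoded by their put functions P. Write H_u for the
   convex hull of P_nu - P_{mu_u}, theta_u for the integral of chi_v over
   v <= u, and G_u for G(1 - u).

   The endpoints R(u), S(u) are the contact points around G_u of E_u with its
   hull, so a convex g with g <= E_u - d (. - G_u)^+ satisfies
   g <= E_u^c - d P_{chi_u}: left of R(u) and right of S(u) one glues g to the
   hull, in between one compares it with the chord. Since E_u differs from
   P_nu - P_{mu_u} by an affine function and, up to such functions, u acts on it
   only through (. - G_u)^+, this says that P_{chi_u}(k) is, up to sign, a
   supergradient at u of the function u |-> H_u(k). Integrating,
   P_{theta_u} = P_nu - H_u. As u -> 1 the hull tends to a nonnegative convex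
   function below P_nu - P_mu, which is bounded and vanishes at -oo; such a
   function is constant, hence 0, and theta_1 = nu. Hence theta_u <= nu, and
   theta_u is the shadow of mu_u: if mu_u <=_cd theta' <= nu then P_nu - P_theta'
   is a convex minorant of P_nu - P_{mu_u}, thus lies below H_u, that is
   P_{theta_u} <= P_theta'.

   The lifted coupling is carried by the graph of u |-> G_u, so it is determined
   by its masses of the boxes [0, u] x R x B, and the decreasing coupling is
   determined by the half-planes [x, oo) x B. A disintegration of the latter
   with respect to mu averages the kernel over the levels u with G_u = x. *)
Require Import Defs.
From HB Require Import structures.
From mathcomp Require Import all_boot all_order all_algebra.
From mathcomp Require Import all_classical all_reals all_analysis.
From mathcomp Require Import measurable_realfun ring lra.

Set Implicit Arguments.
Unset Strict Implicit.
Unset Printing Implicit Defensive.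

Import Order.TTheory GRing.Theory Num.Theory.
Import numFieldNormedType.Exports.

Local Open Scope classical_set_scope.
Local Open Scope ring_scope.

(** * Convex functions and convex hulls *)

(** Measurability of u |-> chi_u does not go through R and S, which are extrema of contact sets.
    Supergradients of a concave function are monotone, so u |-> P_{chi_u}(k) is nondecreasing for
    every k, and distribution functions are limits of difference quotients of puts. The same
    inequalities, used in both directions between two levels, replace differentiability of u |->
    H_u(k) when they are integrated. Puts determine the convex decreasing order once the masses
    agree, but a test function may have an infinite integral: it is approximated from below by
    maxima of finitely many tangents, after an integrable tangent has been split off. A first moment
    of theta_1 is needed before its put function can be handled as a real number; it comes from the
    supermartingale inequality and from the bound on the put of theta_1 at 0. The hull is studied
    for 0 < u < 1 only, because the quantile may be a default value at the two ends. Level 0 enters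
    as the start of the integration, level 1 as a limit. *)

Section convex_functions.
Context (R : realType).
Implicit Types (f g : R -> R) (a b c k m x y : R).

(** Denominators are cleared, so that convexity is linear in the values of f, fit for [lra], and the
    degenerate case a = b is harmless. *)
Definition cvx f := forall a m b, a <= m <= b ->
  (b - a) * f m <= (b - m) * f a + (m - a) * f b.

Lemma cvxP f : @convex_function R R^o setT f <-> cvx f.
Proof.
split=> [cf a m b /andP[am mb]|cf t x y _ _].
  have [ab|ab] := eqVneq a b.
    have -> : m = a by lra.
    by rewrite ab; lra.
  have ba : 0 < b - a by lra.
  have t01 : Itv.spec (@Itv.num_sem R) (Itv.Real `[0%Z, 1%Z]) ((b - m) / (b -
    a)).
    rewrite /=; apply/andP; split; first by rewrite num_real.
    by rewrite in_itv/= divr_ge0 ?subr_ge0//= ?ler_pdivrMr// ?mul1r; lra.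
  have mE : (b - m) / (b - a) * a + (1 - (b - m) / (b - a)) * b = m.
    by field; lra.
  move: (cf (Itv.mk t01) a b); rewrite !inE => /(_ I I) {}cf.
  have {}cf : f ((b - m) / (b - a) * a + (1 - (b - m) / (b - a)) * b) <=
     (b - m) / (b - a) * f a + (1 - (b - m) / (b - a)) * f b by exact: cf.
  move: cf; rewrite mE.
  have -> : (b - m) / (b - a) * f a + (1 - (b - m) / (b - a)) * f b
     = ((b - m) * f a + (m - a) * f b) / (b - a) by field; lra.
  by rewrite ler_pdivlMr// mulrC.
set s := t%:num.
suff H u v : f (s * u + (1 - s) * v) <= s * f u + (1 - s) * f v by exact: H.
move: u v => {}x {}y.
have s0 : 0 <= s by rewrite /s ge0.
have s1 : s <= 1 by rewrite /s le1.
have [xy|xy|->] := ltgtP x y.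
- have := cf x (s * x + (1 - s) * y) y.
  set z := s * x + _.
  have xz : x <= z <= y by rewrite /z; nra.
  move=> /(_ xz) cz.
  rewrite -(ler_pM2l (_ : 0 < y - x)); last lra.
  by apply: (le_trans cz); rewrite /z le_eqVlt; apply/orP; left; apply/eqP;
    ring.
- have := cf y (s * x + (1 - s) * y) x.
  set z := s * x + _.
  have xz : y <= z <= x by rewrite /z; nra.
  move=> /(_ xz) cz.
  rewrite -(ler_pM2l (_ : 0 < x - y)); last lra.
  by apply: (le_trans cz); rewrite /z le_eqVlt; apply/orP; left; apply/eqP;
    ring.
- by rewrite -!mulrDl addrC subrK !mul1r.
Qed.

Lemma cvx_affine c m : cvx (fun k => c + m * k).
Proof.
by move=> a k b akb; rewrite le_eqVlt; apply/orP; left; apply/eqP; ring.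
Qed.

Lemma cvxD f g : cvx f -> cvx g -> cvx (fun k => f k + g k).
Proof.
by move=> cf cg a m b amb; have := cf _ _ _ amb; have := cg _ _ _ amb; lra.
Qed.

Lemma cvx_max f g : cvx f -> cvx g -> cvx (fun k => Num.max (f k) (g k)).
Proof.
move=> cf cg a m b amb; rewrite maxr_pMr; last by lra.
rewrite ge_max; apply/andP; split.
  apply: (le_trans (cf _ _ _ amb)); rewrite lerD// ler_wpM2l//; try lra;
  by rewrite le_max lexx.
apply: (le_trans (cg _ _ _ amb)); rewrite lerD// ler_wpM2l//; try lra;
by rewrite le_max lexx orbT.
Qed.

Lemma cvx_bounded_above_nonincreasing f x C : cvx f ->
  (forall k, x <= k -> f k <= C) -> forall a b, a <= b -> f b <= f a.
Proof.
move=> cf fC a b ab; rewrite leNgt; apply/negP => fab.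
have {}ab : a < b by rewrite lt_neqAle ab andbT; apply: contraTneq fab => ->;
  rewrite ltxx.
pose D := f b - f a; have D0 : 0 < D by rewrite /D; lra.
(* The line through the points of the graph at a and b reaches C + 1 at distance (C - f a + 1) (b -
   a) / D from a, and f lies above this line to the right of b. *)
pose N := Num.max (b + 1) (Num.max x (a + (C - f a + 1) * (b - a) / D)).
have Nb : b + 1 <= N by rewrite /N le_max lexx.
have Nx : x <= N by rewrite /N !le_max lexx orbT.
have ND : (C - f a + 1) * (b - a) / D <= N - a.
  by rewrite lerBrDl /N !le_max lexx !orbT.
have := cf a b N; have -> : a <= b <= N by lra.
move=> /(_ isT); have := fC _ Nx => fN.
move: ND; rewrite ler_pdivrMr// /D => ND; nra.
Qed.

(* The glued function is convex because its left piece dominates the convex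
   function it is glued to. *)
Lemma cvx_glue_left f g r : cvx f -> cvx g -> f r = g r ->
  (forall k, k <= r -> g k <= f k) ->
  cvx (fun k => if k <= r then f k else g k).
Proof.
move=> cf cg fgr gf a m b /andP[am mb].
have F1 := cf a m b; have F2 := cg a m b.
move: F1 F2; have -> : a <= m <= b by rewrite am mb.
move=> /(_ isT) F1 /(_ isT) F2.
have [ar|ar] := leP a r; have [mr|mr] := leP m r; have [br|br] := leP b r => //;
  try lra.
(* Here f m is bounded by the chord of f over [a, r], then f r = g r by the chord of g over [a, b],
   and the resulting g a by f a. *)
- have := cf a m r; have -> : a <= m <= r by lra.
  move=> /(_ isT) G1.
  have := cg a r b; have -> : a <= r <= b by lra.
  move=> /(_ isT) G2; have := gf _ ar => G3.
  rewrite fgr in G1.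
  have [ar0|ar0] := eqVneq a r.
    have -> : m = r by lra. by subst a; rewrite fgr; lra.
  have ra : 0 < r - a by rewrite subr_gt0 lt_neqAle ar0 ar.
  rewrite -(ler_pM2l ra).
  have : (b - a) * ((r - a) * f m) <= (b - a) * ((r - m) * f a + (m - a) * g r).
    by rewrite ler_wpM2l//; lra.
  have : (m - a) * ((b - a) * g r) <= (m - a) * ((b - r) * g a + (r - a) * g b).
    by rewrite ler_wpM2l//; lra.
  have : (m - a) * (b - r) * g a <= (m - a) * (b - r) * f a.
    by rewrite ler_wpM2l// mulr_ge0//; lra.
  lra.
- have := gf _ ar => G3.
  have : (b - m) * g a <= (b - m) * f a by rewrite ler_wpM2l//; lra.
  lra.
Qed.

Lemma cvx_opp f : cvx f -> cvx (fun k => f (- k)).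
Proof.
move=> cf u m v umv; have := cf (- v) (- m) (- u).
have -> : - v <= - m <= - u by lra.
  by move=> /(_ isT); lra.
Qed.

Lemma cvx_glue_right f g r : cvx f -> cvx g -> f r = g r ->
  (forall k, r <= k -> g k <= f k) ->
  cvx (fun k => if r <= k then f k else g k).
Proof.
move=> /cvx_opp cf /cvx_opp cg fgr gf.
have := @cvx_glue_left _ _ (- r) cf cg; rewrite opprK => /(_ fgr) H.
have {}H : cvx (fun k => if k <= - r then f (- k) else g (- k)).
  by apply: H => k kr; apply: gf; lra.
by move/cvx_opp: H => H a m b amb; have := H a m b amb; rewrite !lerN2 !opprK.
Qed.

(** On an unbounded set [sup] is a default value, hence the pointwise bound on all convex
    minorants. *)
Lemma le_convex_hull E g k : (forall x, exists C, forall f, cvx f ->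
  (forall y, f y <= E y) -> f x <= C) ->
  cvx g -> (forall x, g x <= E x) -> g k <= convex_hull E k.
Proof.
move=> EC cg gE; apply: sup_upper_bound; last by exists g => //; split => //;
  exact/cvxP.
split; first by exists (g k), g => //; split => //; exact/cvxP.
by have [C HC] := EC k; exists C => _ [f [/cvxP cf fE] <-]; exact: HC.
Qed.

End convex_functions.

Section convex_hull.
Context (R : realType) (E : R -> R).
Implicit Types (f g : R -> R) (a b c k m x y : R).

Lemma convex_hull_max g : cvx g -> (forall x, g x <= E x) ->
  forall k, g k <= convex_hull E k.
Proof.
by move=> cg gE k; apply: le_convex_hull => // x; exists (E x) => f _; exact.
Qed.

(** One convex minorant makes the family in [convex_hull] nonempty; the [sup] of the empty set would
    be a default value. *)
Hypothesis Emin : exists2 g0, cvx g0 & forall x, g0 x <= E x.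

Lemma convex_hull_le k : convex_hull E k <= E k.
Proof.
case: Emin => g0 cg0 g0E; apply: ge_sup.
  by exists (g0 k), g0 => //; split => //; exact/cvxP.
by move=> _ [g [_ gE] <-].
Qed.

Lemma cvx_convex_hull : cvx (convex_hull E).
Proof.
case: Emin => g0 cg0 g0E a m b amb.
have [/eqP ab|ab] := boolP (a == b).
  have -> : m = a by lra.
  by rewrite ab; lra.
have ba : 0 < b - a by lra.
rewrite mulrC -ler_pdivlMr//; apply: ge_sup.
  by exists (g0 m), g0 => //; split => //; exact/cvxP.
move=> _ [g [/cvxP cg gE] <-]; rewrite ler_pdivlMr// mulrC.
apply: (le_trans (cg _ _ _ amb)); rewrite lerD// ler_wpM2l//; try lra;
exact: convex_hull_max.
Qed.

(* Where the hull lies strictly below E it can be lifted to a chord, so by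
   maximality it is affine there. *)
Lemma convex_hull_affine_near K p : (forall a b, `|E a - E b| <= K * `|a -
  b|) ->
  convex_hull E p < E p ->
  exists r m, 0 < r /\ forall z, p - r <= z <= p + r ->
    convex_hull E z = convex_hull E p + m * (z - p).
Proof.
move=> EK; set h := convex_hull E => hE.
have ch : cvx h := cvx_convex_hull.
pose ga := E p - h p; have ga0 : 0 < ga by rewrite /ga; lra.
(* Over the radius r the hull rises by at most half the gap [ga] and E drops by at most half of it,
   so the chord of the hull over [p - r, p + r] stays below E. *)
pose D := `|h (p + 1) - h p| + `|h (p - 1) - h p| + `|K| + 1.
have D0 : 0 < D by rewrite /D; have := normr_ge0 (h (p+1) - h p);
  have := normr_ge0 (h (p-1) - h p); have := normr_ge0 K; lra.
pose r := Num.min 1 (ga / (2 * D)).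
have r0 : 0 < r by rewrite /r lt_min ltr01 divr_gt0//; lra.
have r1 : r <= 1 by rewrite /r ge_min lexx.
have rD : r * D <= ga / 2.
  have : r <= ga / (2 * D) by rewrite /r ge_min lexx orbT.
  rewrite ler_pdivlMr; last by lra.
  lra.
have n1 := ler_norm (h (p+1) - h p); have n2 := ler_norm (h (p-1) - h p).
have n1' := normr_ge0 (h (p+1) - h p); have n2' := normr_ge0 (h (p-1) - h p).
have nK' := normr_ge0 K.
have hr : h (p + r) <= h p + ga / 2.
  have := ch p (p + r) (p + 1); have -> : p <= p + r <= p + 1 by lra.
  move=> /(_ isT); rewrite /D in rD; nra.
have hl : h (p - r) <= h p + ga / 2.
  have := ch (p - 1) (p - r) p; have -> : p - 1 <= p - r <= p by lra.
  move=> /(_ isT); rewrite /D in rD; nra.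
have El z : p - r <= z <= p + r -> h p + ga / 2 <= E z.
  move=> zr; have := EK p z; have : `|p - z| <= r by rewrite ler_norml; lra.
  have nK := ler_norm K; have := ler_norm (E p - E z).
  have := normr_ge0 (p - z); rewrite /D in rD; rewrite /ga in rD *; nra.
pose m := (h (p + r) - h (p - r)) / (2 * r).
pose l z := h (p - r) + m * (z - (p - r)).
have mE : m * (2 * r) = h (p + r) - h (p - r) by rewrite /m; field; lra.
have lout z : ~~ (p - r <= z <= p + r) -> l z <= h z.
  rewrite negb_and -!ltNge => /orP[zr|zr].
    have := ch z (p - r) (p + r); have -> : z <= p - r <= p + r by lra.
    move=> /(_ isT); rewrite /l => Hc.
    rewrite -(ler_pM2l (_ : 0 < 2 * r)); last lra.
    rewrite mulrDr mulrA (mulrC (2 * r) m) mE; lra.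
  have := ch (p - r) (p + r) z; have -> : p - r <= p + r <= z by lra.
  move=> /(_ isT); rewrite /l => Hc.
  rewrite -(ler_pM2l (_ : 0 < 2 * r)); last lra.
  rewrite mulrDr mulrA (mulrC (2 * r) m) mE; lra.
have lin z : p - r <= z <= p + r -> h z <= l z.
  move=> zr; have := ch (p - r) z (p + r) zr; rewrite /l => Hc.
  rewrite -(ler_pM2l (_ : 0 < 2 * r)); last lra.
  rewrite mulrDr mulrA (mulrC (2 * r) m) mE; lra.
have lh z : l z <= h z.
  have cl : cvx l.
    have := cvx_affine (h (p - r) - m * (p - r)) m.
    by move=> H a u b aub; have := H a u b aub; rewrite /l; lra.
  have := @convex_hull_max (fun k => Num.max (l k) (h k)) (cvx_max cl ch) _ z.
  have H x : Num.max (l x) (h x) <= E x.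
    rewrite ge_max convex_hull_le andbT.
    have [xr|/lout lx] := boolP (p - r <= x <= p + r); last first.
      exact: le_trans lx (convex_hull_le _).
    apply: le_trans (El _ xr); rewrite /l.
    rewrite -(ler_pM2l (_ : 0 < 2 * r)); last lra.
    rewrite mulrDr mulrA (mulrC (2 * r) m) mE; nra.
  by move=> /(_ H); rewrite -/h ge_max => /andP[].
exists r, m; split => // z zr.
have pr : p - r <= p <= p + r by lra.
have hz : h z = l z by apply/eqP; rewrite eq_le lh lin.
have hp : h p = l p by apply/eqP; rewrite eq_le lh lin.
by rewrite -/h hz hp /l; lra.
Qed.

End convex_hull.

Section right_derivative.
Context (R : realType) (h : R -> R) (x : R).
Hypothesis ch : cvx h.

Lemma right_derivative_near_affine r m : 0 < r ->
  (forall z, x <= z <= x + r -> h z = h x + m * (z - x)) ->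
  right_derivative h x = m.
Proof.
move=> r0 hr; rewrite /right_derivative; apply: lim_near_cst => //.
near=> t.
have t0 : 0 < t by near: t; exact: nbhs_right_gt.
have tr : t < r by near: t; exact: nbhs_right_lt.
rewrite hr; last by lra.
by field; lra.
Unshelve. all: by end_near. Qed.

(** The right difference quotients are monotone and bounded below by the left slopes, so their limit
    at 0 exists and is their infimum; it separates the left slopes from the right ones. *)
Lemma right_derivative_tangent k : h x + right_derivative h x * (k - x) <= h k.
Proof.
pose s t := t^-1 * (h (x + t) - h x).
have snd a b : 0 < a -> a <= b -> s a <= s b.
  move=> a0 ab; have b0 : 0 < b by lra.
  rewrite /s mulrC ler_pdivrMr// (mulrC b^-1) mulrAC ler_pdivlMr//.
  have := ch (a := x) (m := x + a) (b := x + b).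
  have -> : x <= x + a <= x + b by lra.
  by move=> /(_ isT); lra.
have slb y t : y < x -> 0 < t -> (h x - h y) / (x - y) <= s t.
  move=> yx t0; rewrite /s ler_pdivrMr; last lra.
  rewrite (mulrC t^-1) mulrAC ler_pdivlMr//.
  have := ch (a := y) (m := x) (b := x + t).
  have -> : y <= x <= x + t by lra.
  by move=> /(_ isT); lra.
have scv : s t @[t --> 0^'+] -->
  inf (s @` [set` Interval (BRight 0) (BInfty R false)]).
  apply: nondecreasing_at_right_cvgr => //.
  - move=> a b; rewrite !in_itv/= !andbT => a0 b0 ab; exact: snd.
  - exists ((h x - h (x - 1)) / (x - (x - 1))) => _ [t /= + <-].
    by rewrite in_itv/= andbT => t0; apply: slb => //; lra.
have rE : right_derivative h x =
  inf (s @` [set` Interval (BRight 0) (BInfty R false)]).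
  by apply/cvg_lim.
have rs t : 0 < t -> right_derivative h x <= s t.
  move=> t0; rewrite rE; apply: ge_inf.
    exists ((h x - h (x - 1)) / (x - (x - 1))) => _ [u /= + <-].
    by rewrite in_itv/= andbT => u0; apply: slb => //; lra.
  by exists t => //=; rewrite in_itv/= andbT.
have [kx|kx|->] := ltgtP k x; last by rewrite subrr mulr0 addr0.
- have : (h x - h k) / (x - k) <= right_derivative h x.
    rewrite rE; apply: lb_le_inf.
      by exists (s 1), 1 => //=; rewrite in_itv/= andbT ltr01.
    move=> _ [t /= + <-]; rewrite in_itv/= andbT => t0; exact: slb.
  rewrite ler_pdivrMr; last lra.
  lra.
- have := rs (k - x); rewrite subr_gt0 => /(_ kx).
  rewrite /s [x + _]addrC subrK mulrC ler_pdivlMr; last lra.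
  lra.
Qed.

End right_derivative.

(** * Contact points of the hull with its tangent *)

Section endpoints.
Context (R : realType) (E : R -> R) (x K M w c0 : R).
(** E stands for E_u, x for G_u and w for 1 - u; the line c0 - w k is the asymptote of E at -oo.
    [EM] serves the case S = +oo; [AE], [Ax] and [EA] control the case R = -oo. *)
Hypothesis EK : forall a b, `|E a - E b| <= K * `|a - b|.
Hypothesis E0 : forall k, 0 <= E k.
Hypothesis EM : forall k, x <= k -> E k <= M.
Hypothesis w0 : 0 < w.
Hypothesis AE : forall k, c0 - w * k <= E k.
Hypothesis Ax : c0 - w * x <= 0.
Hypothesis EA : forall e : R, 0 < e -> exists k0, forall k, k <= k0 ->
  E k - (c0 - w * k) < e.

Let h := convex_hull E.
Let L k := h x + right_derivative h x * (k - x).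
Let Rf := ereal_inf [set k%:E | k in [set k : R | k <= x /\ h k = L k]].
Let Sf := ereal_sup [set k%:E | k in [set k : R | x <= k /\ h k = L k]].

Let Emin : exists2 g0, cvx g0 & forall k, g0 k <= E k.
Proof.
by exists (fun k => 0 + 0 * k); [exact: cvx_affine|move=> k;
  rewrite mul0r addr0].
Qed.

Let ch : cvx h. Proof. exact: cvx_convex_hull. Qed.

Let hE k : h k <= E k. Proof. exact: convex_hull_le. Qed.

Let h0 k : 0 <= h k.
Proof.
have := @convex_hull_max _ E (fun k => 0 + 0 * k) (cvx_affine _ _) _ k.
by rewrite mul0r addr0; apply => y; rewrite mul0r addr0.
Qed.

Let hA k : c0 - w * k <= h k.
Proof.
have := @convex_hull_max _ E (fun k => c0 + (- w) * k) (cvx_affine _ _) _ k.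
by rewrite mulNr; apply => y; rewrite mulNr.
Qed.

Let Lh k : L k <= h k. Proof. exact: right_derivative_tangent. Qed.

Let Lx : h x = L x. Proof. by rewrite /L subrr mulr0 addr0. Qed.

Let phi := right_derivative h x.

Let LD a b : L b = L a + phi * (b - a). Proof. by rewrite /L -/phi; ring. Qed.

Let contact_between a b k : h a = L a -> h b = L b -> a <= k <= b -> h k = L k.
Proof.
move=> ha hb akb; apply/eqP; rewrite eq_le Lh andbT.
have [ab|ab] := eqVneq a b.
  have -> : k = a by lra.
  by rewrite ha.
have ba : 0 < b - a by lra.
rewrite -(ler_pM2l ba); apply: le_trans (ch akb) _.
by rewrite ha hb (LD k a) (LD k b); lra.
Qed.

(** A convex function is Lipschitz around a, so a gap between h and L at a would persist on a radius
    r computed from neighbouring values of h and from [phi]. *)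
Let closed_contact a : (forall e : R, 0 < e -> exists2 k, `|k - a| < e & h k =
  L k) ->
  h a = L a.
Proof.
move=> H; apply/eqP; rewrite eq_le Lh andbT leNgt; apply/negP => La.
pose g := h a - L a; have g0 : 0 < g by rewrite /g; lra.
pose D := `|h (a + 1) - h a| + `|h (a - 1) - h a| + `|phi| + 1.
have n1' := normr_ge0 (h (a+1) - h a); have n2' := normr_ge0 (h (a-1) - h a).
have nK' := normr_ge0 phi.
have n1 := ler_norm (h (a+1) - h a); have n2 := ler_norm (h (a - 1) - h a).
have n3 := ler_norm phi; have n4 := ler_norm (- phi); rewrite normrN in n4.
have D0 : 0 < D by rewrite /D; lra.
pose r := Num.min 1 (g / (2 * D)).
have r0 : 0 < r by rewrite /r lt_min ltr01 divr_gt0//; lra.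
have r1 : r <= 1 by rewrite /r ge_min lexx.
have rD : r * D <= g / 2.
  have : r <= g / (2 * D) by rewrite /r ge_min lexx orbT.
  rewrite ler_pdivlMr; last by lra.
  lra.
have [k ka hk] := H _ r0.
have [ak|ak|ka0] := ltgtP a k; last by rewrite ka0 hk ltxx in La.
- rewrite ger0_norm in ka; last lra.
  have := ch (a := a - 1) (m := a) (b := k); have -> : a - 1 <= a <= k by lra.
  move=> /(_ isT); rewrite hk (LD a k).
  rewrite /D in rD; rewrite /g in rD.
  set t := k - a in ka *; have t0 : 0 < t by rewrite /t; lra.
  have tD : t * (`|h (a + 1) - h a| + `|h (a - 1) - h a| + `|phi| + 1) <=
    (h a - L a) / 2.
    by apply: le_trans rD; rewrite ler_wpM2r//; lra.
  have -> : k - (a - 1) = t + 1 by rewrite /t; ring.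
  have -> : a - (a - 1) = 1 by ring.
  have := @ler_wpM2l _ t (ltW t0) _ _ n2;
    have := @ler_wpM2l _ t (ltW t0) _ _ n3.
  have := mulr_ge0 (ltW t0) n1'.
  lra.
- rewrite distrC ger0_norm in ka; last lra.
  have := ch (a := k) (m := a) (b := a + 1); have -> : k <= a <= a + 1 by lra.
  move=> /(_ isT); rewrite hk (LD a k).
  rewrite /D in rD; rewrite /g in rD.
  set t := a - k in ka *; have t0 : 0 < t by rewrite /t; lra.
  have tD : t * (`|h (a + 1) - h a| + `|h (a - 1) - h a| + `|phi| + 1) <=
    (h a - L a) / 2.
    by apply: le_trans rD; rewrite ler_wpM2r//; lra.
  have -> : a + 1 - k = t + 1 by rewrite /t; ring.
  have -> : k - a = - t by rewrite /t; ring.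
  have -> : a + 1 - a = 1 by ring.
  have := @ler_wpM2l _ t (ltW t0) _ _ n1;
    have := @ler_wpM2l _ t (ltW t0) _ _ n4.
  have := mulr_ge0 (ltW t0) n2'.
  lra.
Qed.

(** Between x and p the hull already coincides with its tangent at x, so an affine piece of the hull
    around p must have slope [phi]; for p = x this is the right derivative itself. *)
Let affine_contact (p r m : R) : x <= p -> h p = L p -> 0 < r ->
  (forall z : R, p - r <= z <= p + r -> h z = h p + m * (z - p)) ->
  forall z : R, p - r <= z <= p + r -> h z = L z.
Proof.
move=> xp hp r0 hm z zr.
suff mphi : m = phi by rewrite hm// hp (LD p z) mphi.
have [xp0|xp0] := eqVneq x p.
  rewrite /phi; apply/esym;
    apply: (@right_derivative_near_affine _ _ _ r) => //.
  by move=> y yr; rewrite xp0 in yr *; rewrite hm//; lra.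
have {}xp : x < p by rewrite lt_neqAle xp0.
pose y := Num.max x (p - r).
have yp : y < p by rewrite /y gt_max xp; lra.
have xy : x <= y by rewrite /y le_max lexx.
have yr : p - r <= y by rewrite /y le_max lexx orbT.
have hy : h y = L y by apply: (@contact_between x p) => //; lra.
have : h y = h p + m * (y - p) by apply: hm; lra.
rewrite hy hp (LD p y) => /addrI /mulIf -> //; lra.
Qed.

Let affine_contactl (p r m : R) : p <= x -> h p = L p -> 0 < r ->
  (forall z : R, p - r <= z <= p + r -> h z = h p + m * (z - p)) ->
  forall z : R, p - r <= z <= p + r -> h z = L z.
Proof.
move=> xp hp r0 hm z zr.
have [xp0|xp0] := eqVneq p x.
  by apply: (@affine_contact p r m) => //; rewrite xp0.
suff mphi : m = phi by rewrite hm// hp (LD p z) mphi.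
have {}xp : p < x by rewrite lt_neqAle xp0.
pose y := Num.min x (p + r).
have yp : p < y by rewrite /y lt_min xp; lra.
have xy : y <= x by rewrite /y ge_min lexx.
have yr : y <= p + r by rewrite /y ge_min lexx orbT.
have hy : h y = L y by apply: (@contact_between p x) => //; lra.
have : h y = h p + m * (y - p) by apply: hm; lra.
rewrite hy hp (LD p y) => /addrI /mulIf -> //; lra.
Qed.

(** If the hull were strictly below E at a finite endpoint, it would be affine around that point and
    the contact would continue past the supremum. *)
Let S_spec : (Sf = +oo%E /\ forall k, x <= k -> h k = L k) \/
  exists s, [/\ Sf = s%:E, x <= s, h s = L s & h s = E s].
Proof.
have Sx : (x%:E <= Sf)%E by apply: ereal_sup_ubound; exists x.
have ubS k : x <= k -> h k = L k -> (k%:E <= Sf)%E.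
  by move=> xk hk; apply: ereal_sup_ubound; exists k.
have HS k : (k%:E < Sf)%E -> x <= k -> h k = L k.
  move=> /ereal_sup_gt[_ [z [xz hz] <-]]; rewrite lte_fin => kz xk.
  by apply: (@contact_between x z) => //; lra.
move: Sx ubS HS; case: Sf => [s| |] Sx ubS HS.
- right; exists s; rewrite lee_fin in Sx.
  have hs : h s = L s.
    apply: closed_contact => // e e0.
    have [xs|xs] := eqVneq x s; first by exists x => //;
      rewrite xs subrr normr0.
    have {}xs : x < s by rewrite lt_neqAle xs.
    exists (Num.max x (s - e / 2)).
      rewrite ltr0_norm ?subr_lt0 ?gt_max ?xs/=; last lra.
      have : s - e / 2 <= Num.max x (s - e / 2) by rewrite le_max lexx orbT.
      lra.
    apply: HS; last by rewrite le_max lexx.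
    by rewrite lte_fin gt_max xs; lra.
  split => //; apply/eqP; rewrite eq_le hE leNgt;
    apply/negP => /(convex_hull_affine_near Emin EK).
  move=> [r [m [r0 hm]]].
  have : h (s + r) = L (s + r) by apply: (@affine_contact s r m) => //; lra.
  move/ubS; rewrite lee_fin => H.
  have : s + r <= s by apply: H; lra.
  lra.
- by left; split => // k xk; apply: HS => //; rewrite ltry.
- by rewrite leeNy_eq in Sx.
Qed.

Let R_spec : (Rf = -oo%E /\ forall k, k <= x -> h k = L k) \/
  exists r, [/\ Rf = r%:E, r <= x, h r = L r & h r = E r].
Proof.
have Rx : (Rf <= x%:E)%E by apply: ereal_inf_lbound; exists x.
have lbR k : k <= x -> h k = L k -> (Rf <= k%:E)%E.
  by move=> xk hk; apply: ereal_inf_lbound; exists k.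
have HR k : (Rf < k%:E)%E -> k <= x -> h k = L k.
  move=> /ereal_inf_lt[_ [z [xz hz] <-]]; rewrite lte_fin => kz xk.
  by apply: (@contact_between z x) => //; lra.
move: Rx lbR HR; case: Rf => [s| |] Rx lbR HR.
- right; exists s; rewrite lee_fin in Rx.
  have hs : h s = L s.
    apply: closed_contact => // e e0.
    have [xs|xs] := eqVneq s x; first by exists x => //;
      rewrite xs subrr normr0.
    have {}xs : s < x by rewrite lt_neqAle xs.
    exists (Num.min x (s + e / 2)).
      rewrite gtr0_norm ?subr_gt0 ?lt_min ?xs/=; last lra.
      have : Num.min x (s + e / 2) <= s + e / 2 by rewrite ge_min lexx orbT.
      lra.
    apply: HR; last by rewrite ge_min lexx.
    by rewrite lte_fin lt_min xs; lra.
  split => //; apply/eqP; rewrite eq_le hE leNgt;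
    apply/negP => /(convex_hull_affine_near Emin EK).
  move=> [r [m [r0 hm]]].
  have : h (s - r) = L (s - r) by apply: (@affine_contactl s r m) => //; lra.
  move/lbR; rewrite lee_fin => H.
  have : s <= s - r by apply: H; lra.
  lra.
- by rewrite leye_eq in Rx.
- by left; split => // k xk; apply: HR => //; rewrite ltNyr.
Qed.

(* A contact line reaching -oo has slope at most -w, while E is asymptotic to
   c0 - w k there; as c0 - w x <= 0 <= h, no contact point lies beyond x. *)
Let left_unbounded k : (forall z, z <= x -> h z = L z) -> x < k -> h k = L k ->
  False.
Proof.
move=> hL xk hk.
have phiw : phi <= - w.
  rewrite leNgt; apply/negP => pw.
  (* So far to the left a line of slope above -w has fallen below the minorant c0 - w k. *)
  pose z := x - (`|h x| + `|c0 - w * x| + 1) / (phi + w).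
  have pw0 : 0 < phi + w by lra.
  have zE : (x - z) * (phi + w) = `|h x| + `|c0 - w * x| + 1.
    by rewrite /z opprB addrC subrK divfK// gt_eqF.
  have n1 := ler_norm (h x); have n2 := ler_norm (- (c0 - w * x));
    rewrite normrN in n2.
  have n1' := normr_ge0 (h x); have n2' := normr_ge0 (c0 - w * x).
  have zx : z <= x.
    rewrite /z gerBl divr_ge0//; lra.
  have := hA z; rewrite hL// (LD x z) -Lx; lra.
have Lk : 0 <= L k by rewrite -hk.
have kx0 : 0 < w * (k - x) by rewrite mulr_gt0// subr_gt0.
(* By [Ax], the contact line is at least w (k - x) above the asymptote at k; with slope at most -w
   this gap cannot shrink to the left, against [EA]. *)
have [k0 Hk0] := EA kx0.
pose z := Num.min k0 x.
have zk0 : z <= k0 by rewrite /z ge_min lexx.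
have zx : z <= x by rewrite /z ge_min lexx orbT.
have := Hk0 _ zk0; have := hE z; rewrite hL// (LD k z).
have := mulr_ge0 (_ : 0 <= - w - phi) (_ : 0 <= k - z).
rewrite !subr_ge0 => /(_ phiw) H;
  have {}H : 0 <= (- w - phi) * (k - z) by apply: H; lra.
have := Ax; lra.
Qed.

Let fin_bounds (r s : R) : r <= x -> x <= s -> h r = L r -> h s = L s ->
  forall k, r <= k <= s -> h k = L k.
Proof. by move=> rx xs hr hs k; exact: contact_between. Qed.

(* R = -oo forces S = x; otherwise the second case of [chi], the point mass at
   S, would not be a supermartingale step from x. *)
Lemma endpoints_spec :
  [\/ exists r s, [/\ Rf = r%:E, Sf = s%:E, r <= x <= s, h r = E r /\ h s = E s
        & forall k, r <= k <= s -> h k = L k],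
      [/\ Rf = -oo%E, Sf = x%:E & h x = E x]
    | exists r, [/\ Rf = r%:E, Sf = +oo%E, r <= x, h r = E r &
        forall k, r <= k -> h k = L k]].
Proof.
case: R_spec => [[Roo RL]|[r [Rr rx hr rE]]].
  apply: Or32; case: S_spec => [[Soo SL]|[s [Ss xs hs sE]]].
    by exfalso; apply: (@left_unbounded (x + 1)) => //; [lra|apply: SL; lra].
  have [xs0|xs0] := eqVneq x s; first by rewrite xs0 in Ss sE *.
  exfalso; apply: (@left_unbounded s) => //; by rewrite lt_neqAle xs0.
case: S_spec => [[Soo SL]|[s [Ss xs hs sE]]].
  apply: Or33; exists r; split => // k rk.
  have [kx|kx] := leP k x; last by apply: SL; lra.
  by apply: (@contact_between r x) => //; rewrite rk.
apply: Or31; exists r, s; split => //; first by rewrite rx.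
exact: fin_bounds.
Qed.

(** Follows the cases of [chi], so that the comparison with the hull involves no measure;
    [chi_two_point] and [put_fun_two_point] turn it into a put function. *)
Definition put_chi (c : \bar R) (d : \bar R) (k : R) : R :=
  match c, d with
  | c%:E, d%:E => if c == d then Num.max (k - x) 0 else
      (d - x) / (d - c) * Num.max (k - c) 0 + (x - c) / (d - c) *
        Num.max (k - d) 0
  | -oo%E, d%:E => Num.max (k - d) 0
  | c%:E, +oo%E => Num.max (k - c) 0
  | _, _ => Num.max (k - x) 0
  end.

Let pos0 (y : R) : y <= 0 -> Num.max y 0 = 0.
Proof. by move=> ?; apply/max_idPr. Qed.
Let posr (y : R) : 0 <= y -> Num.max y 0 = y.
Proof. by move=> ?; apply/max_idPl. Qed.

Section minorant.
Variables (g : R -> R) (de : R).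
Hypothesis cg : cvx g.
Hypothesis gE : forall k, g k <= E k - de * Num.max (k - x) 0.

Let gleft r k : r <= x -> h r = E r -> k <= r -> g k <= h k.
Proof.
move=> rx hr kr.
have gEl y : y <= x -> g y <= E y.
  by move=> yx; apply: le_trans (gE y) _; rewrite pos0 ?mulr0 ?subr0//; lra.
have gr : Num.max (g r) (h r) = h r by apply/max_idPr; rewrite hr gEl.
have := @convex_hull_max _ E _ (@cvx_glue_left _ _ _ r (cvx_max cg ch) ch
  gr _) _ k.
rewrite kr => H; have {}H : Num.max (g k) (h k) <= h k.
  apply: H => y; first by move=> _; rewrite le_max lexx orbT.
  case: ifPn => [yr|_]; last exact: hE.
  by rewrite ge_max hE andbT gEl//; lra.
by move: H; rewrite ge_max => /andP[].
Qed.

Let gright s k : x <= s -> h s = E s -> s <= k -> g k <= h k - de * (k - x).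
Proof.
move=> xs hs sk.
have gEr y : x <= y -> g y + de * (y - x) <= E y.
  by move=> xy; have := gE y; rewrite posr; lra.
(* Right of x the correction is affine: absorbed into g, it keeps convexity and turns the bound into
   g' <= E there. *)
pose g' y := g y + (- de * x + de * y).
have cg' : cvx g' := cvxD cg (cvx_affine _ _).
have gg' y : g' y = g y + de * (y - x) by rewrite /g'; ring.
have gr : Num.max (g' s) (h s) = h s by apply/max_idPr; rewrite hs gg' gEr.
have := @convex_hull_max _ E _ (@cvx_glue_right _ _ _ s (cvx_max cg' ch) ch
  gr _) _ k.
rewrite sk => H; have {}H : Num.max (g' k) (h k) <= h k.
  apply: H => y; first by move=> _; rewrite le_max lexx orbT.
  case: ifPn => [yr|_]; last exact: hE.
  by rewrite ge_max hE andbT gg' gEr//; lra.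
by move: H; rewrite ge_max gg' => /andP[]; lra.
Qed.

Lemma minorant_le_put_chi k : g k <= h k - de * put_chi Rf Sf k.
Proof.
case: endpoints_spec => [[r [s [-> -> /andP[rx xs] [hr hs] hL]]]|[-> ->
  hx]|[r [-> -> rx hr hL]]] /=.
- have [rs|rs] := eqVneq r s.
    have rx0 : r = x by lra. have sx0 : s = x by lra.
    have [kx|kx] := leP k x.
      by rewrite pos0 ?mulr0 ?subr0; [apply: (@gleft x) => //;
        rewrite -rx0|lra].
    by rewrite posr; [apply: (@gright x) => //; [rewrite -rx0|lra]|lra].
  have {}rs : r < s by rewrite lt_neqAle rs; lra.
  have [kr|rk] := leP k r.
    by rewrite !pos0 ?mulr0 ?addr0 ?mulr0 ?subr0; [apply: (@gleft r)|lra|lra].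
  have [sk|ks] := leP s k.
    rewrite !posr; [|lra|lra].
    have -> : (s - x) / (s - r) * (k - r) + (x - r) / (s - r) * (k - s) = k - x.
      by field; lra.
    exact: (@gright s).
  rewrite posr ?pos0; [|lra|lra].
  rewrite mulr0 addr0.
  have gr : g r <= h r by apply: (@gleft r).
  have gs : g s <= h s - de * (s - x) by apply: (@gright s).
  have sr0 : 0 < s - r by lra.
  rewrite -(ler_pM2l sr0); apply: le_trans (cg (m := k) (a := r) (b := s) _) _;
    first lra.
  have -> : (s - r) * (h k - de * ((s - x) / (s - r) * (k - r))) =
            (s - r) * h k - de * (s - x) * (k - r) by field; lra.
  have := @ler_wpM2l _ (s - k) _ _ _ gr; have := @ler_wpM2l _ (k - r) _ _ _ gs.
  rewrite !subr_ge0 !(ltW ks) !(ltW rk) => /(_ isT) h1 /(_ isT) h2.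
  rewrite hL; last lra. 
  move: h1 h2; rewrite (hL r) ?(hL s) ?lexx ?(ltW rs)// (LD k r) (LD k s).
  lra.
- have [kx|kx] := leP k x.
    by rewrite pos0 ?mulr0 ?subr0; [apply: (@gleft x)|lra].
  by rewrite posr; [apply: (@gright x) => //; lra|lra].
- have [kr|rk] := leP k r.
    by rewrite pos0 ?mulr0 ?subr0; [apply: (@gleft r)|lra].
  rewrite posr; last lra.
  (* As S = +oo, a contact line of negative slope would carry h below 0. Moreover g' is bounded
     above to the right, hence nonincreasing, so that g k + de (k - r) <= g r <= h r <= h k. *)
  have phi0 : 0 <= phi.
    rewrite leNgt; apply/negP => p0.
    pose z := x + (h x + 1) / (- phi).
    have zE : (z - x) * (- phi) = h x + 1 by rewrite /z addrAC subrr add0r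
      divfK// gt_eqF; lra.
    have xz : x <= z by rewrite /z lerDl divr_ge0//; [rewrite addr_ge0|lra].
    have := h0 z; rewrite hL ?(LD x z) -?Lx; lra.
  pose g' y := g y + (- de * r + de * y).
  have cg' : cvx g' := cvxD cg (cvx_affine _ _).
  have gg' y : g' y = g y + de * (y - r) by rewrite /g'; ring.
  have := @cvx_bounded_above_nonincreasing _ g' x (M + de * (x - r)) cg' _ r k
    (ltW rk).
  have gr : g r <= h r by apply: (@gleft r).
  rewrite !gg' subrr mulr0 addr0 hL ?(ltW rk)// (LD r k) -hL// => H.
  have {}H : g k + de * (k - r) <= g r.
    apply: H => y xy; rewrite gg'; have := gE y; have := EM xy; rewrite posr;
      last lra.
    lra.
  have := mulr_ge0 phi0 (_ : 0 <= k - r); rewrite subr_ge0 => /(_ (ltW rk)).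
  lra.
Qed.

End minorant.

End endpoints.

(** * Put functions of measures on the line *)

Section rays.
Context (R : realType).
Implicit Types (m : {measure set (measurableTypeR R) -> \bar R}).

Lemma measure_eq_gee m1 m2 : (m1 setT < +oo)%E ->
  (forall x : R, m1 `[x, +oo[%classic = m2 `[x, +oo[%classic) ->
  forall A, measurable A -> m1 A = m2 A.
Proof.
move=> m1y m12 A; apply: (@measure_unique _ R (measurableTypeR R)
  (@RGenCInfty.G R) (fun n => `[(- n%:R)%R, +oo[%classic)).
- exact: RGenCInfty.measurableE.
- move=> _ _ [x ->] [y ->]; exists (Num.max x y).
  apply/seteqP; split => z /=; rewrite !in_itv/= !andbT ge_max.
    by case=> -> ->.
  by move=> /andP[].
- by move=> n; exists (- n%:R).
- apply/seteqP; split => // x _; exists (Num.truncn `|x|).+1 => //=.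
  rewrite in_itv/= andbT lerNl; apply: le_trans (ltW (truncnS_gt _)).
  by rewrite -normrN ler_norm.
- by move=> _ [x ->]; exact: m12.
- by move=> n; apply: le_lt_trans m1y; apply: le_measure => //; rewrite inE.
Qed.

Lemma measure_eq_lee m1 m2 : (m1 setT < +oo)%E -> m1 setT = m2 setT ->
  (forall x : R, m1 `]-oo, x]%classic = m2 `]-oo, x]%classic) ->
  forall A, measurable A -> m1 A = m2 A.
Proof.
move=> m1y m12T m12 A;
  apply: (@measure_unique _ R (measurableTypeR R) (@RGenOInfty.G R) (fun n =>
  `](- n%:R)%R, +oo[%classic)).
- exact: RGenOInfty.measurableE.
- move=> _ _ [x ->] [y ->]; exists (Num.max x y).
  apply/seteqP; split => z /=; rewrite !in_itv/= !andbT gt_max.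
    by case=> -> ->.
  by move=> /andP[].
- by move=> n; exists (- n%:R).
- apply/seteqP; split => // x _; exists (Num.truncn `|x|).+1 => //=.
  rewrite in_itv/= andbT ltrNl; apply: le_lt_trans (truncnS_gt _).
  by rewrite -normrN ler_norm.
- move=> _ [x ->]; rewrite -setCitvl/=.
  have m2y : (m2 setT < +oo)%E by rewrite -m12T.
  rewrite -!setTD !measureD//= ?setTI//.
  by rewrite m12T m12.
- by move=> n; apply: le_lt_trans m1y; apply: le_measure => //; rewrite inE.
Qed.

End rays.

Section measM.
Context (R : realType).
Local Notation meas := {measure set (measurableTypeR R) -> \bar R}.
Implicit Types (eta chi : meas) (f : R -> R).

Definition int1 eta f := eta.-integrable [set: measurableTypeR R] (EFin \o f).

Lemma int1_id eta : measM eta -> int1 eta id.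
Proof. by case. Qed.

Lemma int1D eta f g : int1 eta f -> int1 eta g -> int1 eta (fun x => f x + g x).
Proof.
by move=> intf intg; rewrite /int1 (_ : _ \o _ =
  (EFin \o f) \+ (EFin \o g))%E//; exact: integrableD.
Qed.

Lemma int1B eta f g : int1 eta f -> int1 eta g -> int1 eta (fun x => f x - g x).
Proof.
by move=> intf intg; rewrite /int1 (_ : _ \o _ =
  (EFin \o f) \- (EFin \o g))%E//; exact: integrableB.
Qed.

Lemma int1Z eta c f : int1 eta f -> int1 eta (fun x => c * f x).
Proof. by move=> intf; apply: (integrableZl measurableT c intf). Qed.

Lemma int1_le eta f g : measurable_fun [set: R] f ->
  (forall x, `|f x| <= `|g x|) -> int1 eta g -> int1 eta f.
Proof.
by move=> mf fg; apply: le_integrable => //=;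
  [exact/measurable_EFinP|move=> x _; rewrite lee_fin].
Qed.

Lemma int1_norm eta f : int1 eta f -> int1 eta (fun x => `|f x|).
Proof. exact: integrable_norm. Qed.

Lemma int1_cst eta c : measM eta -> int1 eta (fun=> c).
Proof.
move=> em; apply/integrableP; split; first exact: measurable_cst.
by rewrite integral_cst//= lte_mul_pinfty//; case: em.
Qed.

Lemma int1_affine eta a b : measM eta -> int1 eta (fun x => a + b * x).
Proof.
by move=> em; apply: int1D; [exact: int1_cst|apply: int1Z; exact: int1_id].
Qed.

Lemma measurable_max_affine a b : measurable_fun [set: R] (fun x : R =>
  Num.max (a + b * x) 0).
Proof.
apply: measurable_maxr; last exact: measurable_cst.
by apply: measurable_funD; [exact: measurable_cst|exact: measurable_funM].
Qed.

Lemma int1_max_affine eta a b : measM eta ->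
  int1 eta (fun x => Num.max (a + b * x) 0).
Proof.
move=> em; apply: int1_le (int1_affine a b em);
  first exact: measurable_max_affine.
by move=> x; have [h|h] := leP (a + b * x) 0; rewrite ?normr0 ?normr_ge0.
Qed.

Lemma int1_put eta k : measM eta -> int1 eta (fun x => Num.max (k - x) 0).
Proof.
move=> em; have := int1_max_affine k (-1) em.
by congr int1; apply/funext => x; rewrite mulN1r.
Qed.

Lemma int1_call eta k : measM eta -> int1 eta (fun x => Num.max (x - k) 0).
Proof.
move=> em; have := int1_max_affine (- k) 1 em.
by congr int1; apply/funext => x; rewrite mul1r addrC.
Qed.

Lemma measM_le eta chi : measure_le eta chi -> measM chi -> measM eta.
Proof.
move=> ec [fc ic]; split; first by apply: le_lt_trans fc; exact: ec.
case/integrableP : ic => mi ic; apply/integrableP; split => //.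
apply: le_lt_trans ic; apply: ge0_le_measure_integral => //.
exact: measurableT_comp.
Qed.

Lemma Rintegral_le_measure eta chi f : measure_le eta chi -> int1 chi f ->
  (forall x, 0 <= f x) -> \int[eta]_x f x <= \int[chi]_x f x.
Proof.
move=> ec ic f0; rewrite /Rintegral fine_le//.
- rewrite ge0_fin_numE; last by apply: integral_ge0 => x _; rewrite lee_fin.
  apply: le_lt_trans (integrable_lty measurableT ic).
  by apply: ge0_le_measure_integral => //=; exact: measurable_int ic.
- exact: (integrable_fin_num measurableT ic).
- by apply: ge0_le_measure_integral => //=; exact: measurable_int ic.
Qed.

Lemma le_int1 eta f g : int1 eta f -> int1 eta g -> (forall x, f x <= g x) ->
  \int[eta]_x f x <= \int[eta]_x g x.
Proof. by move=> intf intg fg; apply: le_Rintegral. Qed.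

Lemma put_fun_ge0 eta k : 0 <= put_fun eta k.
Proof. by apply: Rintegral_ge0 => x _; rewrite le_max lexx orbT. Qed.

Lemma call_fun_ge0 eta k : 0 <= call_fun eta k.
Proof. by apply: Rintegral_ge0 => x _; rewrite le_max lexx orbT. Qed.

Lemma put_fun_le_measure eta chi k : measM chi -> measure_le eta chi ->
  put_fun eta k <= put_fun chi k.
Proof.
move=> cM ec; apply: Rintegral_le_measure => //; first exact: int1_put.
by move=> x; rewrite le_max lexx orbT.
Qed.

Lemma call_fun_le_measure eta chi k : measM chi -> measure_le eta chi ->
  call_fun eta k <= call_fun chi k.
Proof.
move=> cM ec; apply: Rintegral_le_measure => //; first exact: int1_call.
by move=> x; rewrite le_max lexx orbT.
Qed.

Lemma Rint_affine eta a b : measM eta ->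
  \int[eta]_x (a + b * x) = a * fine (eta setT) + b * \int[eta]_x x.
Proof.
move=> em; rewrite RintegralD//; [|exact: int1_cst|exact/int1Z/int1_id].
by rewrite Rintegral_cst// RintegralZl//; exact: int1_id.
Qed.

(** Put-call parity: (x - k)^+ - (k - x)^+ = x - k. *)
Lemma call_put eta k : measM eta ->
  call_fun eta k = put_fun eta k + \int[eta]_x x - k * fine (eta setT).
Proof.
move=> em; have := Rint_affine (- k) 1 em; rewrite mul1r.
rewrite -addrA [_ - _]addrC -mulNr => <-.
rewrite /call_fun /put_fun -RintegralD//; [|exact: int1_put|exact: int1_affine].
apply: eq_Rintegral => x _; rewrite mul1r.
have [h|h] := leP (x - k) 0; have [h'|h'] := leP (k - x) 0; lra.
Qed.

Lemma cvx_pos x : cvx (fun k : R => Num.max (k - x) 0).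
Proof.
have := cvx_max (cvx_affine (- x) 1) (cvx_affine 0 0).
by move=> H a m b amb; have := H a m b amb;
  rewrite !mul1r !mul0r !addr0 ![- x + _]addrC.
Qed.

(* The convexity defect of (k - x)^+ in k is nonnegative, hence its integral
   is monotone in the measure. *)
Lemma cvx_put_funB eta chi : measM chi -> measure_le eta chi ->
  cvx (fun k => put_fun chi k - put_fun eta k).
Proof.
move=> cM ec a m b amb; have eM := measM_le ec cM.
pose q x : R := (b - m) * Num.max (a - x) 0 + (m - a) * Num.max (b - x) 0 -
  (b - a) * Num.max (m - x) 0.
have q0 x : 0 <= q x by rewrite /q subr_ge0; exact: cvx_pos.
have iq e : measM e -> int1 e q.
  move=> em; apply: int1B; last by apply: int1Z; exact: int1_put.
  by apply: int1D; apply: int1Z; exact: int1_put.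
have qE e : measM e -> \int[e]_x q x = (b - m) * put_fun e a + (m - a) *
  put_fun e b - (b - a) * put_fun e m.
  move=> em.
  have i1 := int1Z (b - m) (int1_put a em);
    have i2 := int1Z (m - a) (int1_put b em).
  have i3 := int1Z (b - a) (int1_put m em).
  rewrite RintegralB//; last exact: int1D.
  by rewrite RintegralD// !RintegralZl//; exact: int1_put.
have := Rintegral_le_measure ec (iq _ cM) q0; rewrite !qE//; lra.
Qed.

Lemma put_fun_lip eta a b : measM eta ->
  `|put_fun eta a - put_fun eta b| <= fine (eta setT) * `|a - b|.
Proof.
move=> em; rewrite /put_fun -RintegralB//; [|exact: int1_put|exact: int1_put].
have ii : int1 eta (fun x => Num.max (a - x) 0 - Num.max (b - x) 0).
  by apply: int1B; exact: int1_put.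
apply: (le_trans (le_normr_Rintegral _ ii)) => //.
have := Rintegral_cst eta measurableT `|a - b|; rewrite mulrC => <-.
apply: le_int1; [exact: int1_norm|exact: int1_cst|] => x.
have n1 := ler_norm (a - b); have n2 := ler_norm (- (a - b));
  rewrite normrN in n2.
have n3 := normr_ge0 (a - b).
rewrite ler_norml; have [h|h] := leP (a - x) 0; have [h'|h'] := leP (b - x) 0;
  lra.
Qed.

Lemma put_fun_nd eta a b : measM eta -> a <= b ->
  put_fun eta a <= put_fun eta b.
Proof.
move=> em ab; apply: le_int1; [exact: int1_put|exact: int1_put|] => x.
by have [h|h] := leP (a - x) 0; have [h'|h'] := leP (b - x) 0; lra.
Qed.

Lemma put_fun_ge eta k : measM eta ->
  k * fine (eta setT) - \int[eta]_x x <= put_fun eta k.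
Proof.
move=> em; have := Rint_affine k (-1) em; rewrite mulN1r => <-.
apply: le_int1; [exact: int1_affine|exact: int1_put|] => x.
by rewrite mulN1r le_max lexx.
Qed.

Lemma put_fun_le eta k : measM eta -> 0 <= k ->
  put_fun eta k <= k * fine (eta setT) + \int[eta]_x `|x|.
Proof.
move=> em k0; rewrite -[X in X * _]mulr1.
have -> : k * 1 * fine (eta setT) + \int[eta]_x `|x| = \int[eta]_x (k + `|x|).
  by rewrite RintegralD ?Rintegral_cst ?mulr1//;
    [exact: int1_cst|apply: int1_norm; exact: int1_id].
apply: le_int1; [exact: int1_put|apply: int1D;
  [exact: int1_cst|apply: int1_norm; exact: int1_id]|] => x.
have n2 := ler_norm (- x); rewrite normrN in n2; have n3 := normr_ge0 x.
by have [h|h] := leP (k - x) 0; lra.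
Qed.

(** One dominated convergence serves both tails: b = -1 gives the puts at -oo, b = 1 the calls at
    +oo. *)
Lemma max_affine_cvg0 eta b e : measM eta -> 0 < e ->
  exists n, \int[eta]_x Num.max (- n%:R + b * x) 0 < e.
Proof.
move=> em e0.
pose F n (x : measurableTypeR R) : \bar R := (Num.max (- n%:R + b * x) 0)%:E.
have [] := @dominated_convergence _ (measurableTypeR R) R eta setT measurableT F
  (cst 0%E)
  (fun x => `|(b * x)%:E|%E).
- by move=> n; apply/measurable_EFinP; exact: measurable_max_affine.
- exact: measurable_cst.
- apply: aeW => x _; apply: cvg_near_cst; near=> n; rewrite /F.
  have nx : b * x <= n%:R by near: n; exact: nbhs_infty_ger.
  congr EFin; apply/max_idPr; lra.
- by have := int1_norm (int1Z b (int1_id em)).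
- apply: aeW => x n _; rewrite /F lee_fin.
  have n2 := ler_norm (b * x); have n3 := ler0n R n.
  have [h|h] := leP (- n%:R + b * x) 0; first by rewrite normr0.
  by rewrite ger0_norm//; lra.
move=> _ _; rewrite integral0 => /fine_cvgP[_] /cvgrPdist_lt/(_ e e0)[N _ HN].
exists N; have := HN N (leqnn N); rewrite /= sub0r normrN.
by apply: le_lt_trans; exact: ler_norm.
Unshelve. all: by end_near. Qed.

Lemma put_fun_cvg0 eta e : measM eta -> 0 < e ->
  exists k0, forall k, k <= k0 -> put_fun eta k < e.
Proof.
move=> em /(max_affine_cvg0 (-1) em)[n ne]; exists (- n%:R) => k kn.
apply: le_lt_trans ne; under eq_Rintegral do rewrite mulN1r.
exact: put_fun_nd.
Qed.

Lemma call_fun_cvg0 eta e : measM eta -> 0 < e -> exists k, call_fun eta k < e.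
Proof.
move=> em /(max_affine_cvg0 1 em)[n ne]; exists n%:R.
by apply: le_lt_trans ne; under eq_Rintegral do rewrite mul1r addrC.
Qed.

(** The difference (x + d - y)^+ - (x - y)^+ lies between d times the indicators of y <= x and of y
    <= x + d. Thus difference quotients of the put function bracket the distribution function. *)
Lemma put_fun_ray_bounds (m : meas) (x d : R) : measM m -> 0 < d ->
  (m `]-oo, x]%classic * d%:E <= (put_fun m (x + d) - put_fun m x)%:E)%E /\
  ((put_fun m (x + d) - put_fun m x)%:E <= m `]-oo, (x + d)%R]%classic *
    d%:E)%E.
Proof.
move=> mM d0.
have mfin (A : set (measurableTypeR R)) : measurable A -> m A \is a fin_num.
  move=> mA; rewrite ge0_fin_numE//; apply: le_lt_trans (_ : (m setT < +oo)%E).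
    by apply: le_measure; rewrite ?inE.
  by case: mM.
have iind (A : set (measurableTypeR R)) : measurable A ->
  int1 m (fun x => d * \1_A x).
  move=> mA; apply: int1Z; apply: int1_le (int1_cst 1 mM).
    exact: measurable_indic.
  by move=> y; rewrite normr1 indicE; case: (_ \in _); rewrite ?normr1 ?normr0.
have Iind (A : set (measurableTypeR R)) : measurable A ->
    (m A * d%:E = (\int[m]_y (d * \1_A y))%:E)%E.
  move=> mA; rewrite /Rintegral fineK;
    last exact: (integrable_fin_num measurableT (iind _ mA)).
  under eq_integral do rewrite EFinM.
  rewrite integralZl//; first by rewrite integral_indic// setIT muleC.
  have := iind _ mA; move=> /(int1Z d^-1); congr integrable;
    apply/funext => y /=.
  by rewrite mulrA mulVf ?mul1r// gt_eqF.
rewrite !Iind// !lee_fin /put_fun -RintegralB//;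
  [|exact: int1_put|exact: int1_put].
have i2 : int1 m (fun y => Num.max (x + d - y) 0 - Num.max (x - y) 0).
  by apply: int1B; exact: int1_put.
split; apply: le_int1 => //; try exact: iind; move=> y; rewrite indicE.
  have [|] := boolP (y \in _); rewrite ?inE /= ?notin_setE /= in_itv/=.
    by move=> yx; have [h|h] := leP (x + d - y) 0;
      have [h'|h'] := leP (x - y) 0; lra.
  move=> _.
  by have [h|h] := leP (x + d - y) 0; have [h'|h'] := leP (x - y) 0; lra.
have [|] := boolP (y \in _); rewrite ?inE /= ?notin_setE /= in_itv/=.
  move=> yx.
  by have [h|h] := leP (x + d - y) 0; have [h'|h'] := leP (x - y) 0; lra.
move=> /negP; rewrite -ltNge => yx.
by have [h|h] := leP (x + d - y) 0; have [h'|h'] := leP (x - y) 0; lra.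
Qed.

Lemma ray_right_cvg (m2 : meas) (x : R) : measM m2 ->
  m2 `]-oo, (x + n.+1%:R^-1)%R]%classic @[n --> \oo] --> m2 `]-oo, x]%classic.
Proof.
move=> m2M.
have cap : \bigcap_n `]-oo, (x + n.+1%:R^-1)]%classic = (`]-oo, x]%classic :
  set (measurableTypeR R)).
  apply/seteqP; split => y /=; rewrite ?in_itv/=.
    move=> H; rewrite leNgt; apply/negP => xy.
    pose n := Num.truncn (y - x)^-1.
    have := H n I; rewrite /= in_itv/= => yx.
    have : (y - x)^-1 < n.+1%:R by exact: truncnS_gt.
    by rewrite invf_plt ?posrE ?subr_gt0 ?ltr0n// ltrBrDl ltNge yx.
  move=> yx n _ /=; rewrite in_itv/=; apply: le_trans yx _.
  by rewrite lerDl invr_ge0 ler0n.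
rewrite -cap; apply: nonincreasing_cvg_mu => //.
- apply: le_lt_trans (_ : (m2 setT < +oo)%E); first by apply: le_measure;
    rewrite ?inE.
  by case: m2M.
- by rewrite cap.
- move=> a b ab; apply/subsetPset => y /=; rewrite !in_itv/= => /le_trans;
    apply.
  by rewrite lerD2l lef_pV2 ?posrE ?ltr0n// ler_nat ltnS.
Qed.

(** The brackets at mesh 1 / (n + 1) compare one measure at x with the other at x + 1 / (n + 1);
    right continuity removes the shift. *)
Lemma put_fun_eq eta chi : measM eta -> measM chi -> eta setT = chi setT ->
  (forall k, put_fun eta k = put_fun chi k) ->
  forall A, measurable A -> eta A = chi A.
Proof.
move=> eM cM ecT ecP; apply: measure_eq_lee => //; first by case: eM.
suff H (m1 m2 : meas) (x : R) : measM m1 -> measM m2 ->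
  (forall k, put_fun m1 k = put_fun m2 k) ->
    (m1 `]-oo, x]%classic <= m2 `]-oo, x]%classic)%E.
  by move=> x; apply/eqP; rewrite eq_le !H.
move=> m1M m2M m12.
have le1 n : (m1 `]-oo, x]%classic <= m2 `]-oo, (x + n.+1%:R^-1)%R]%classic)%E.
  have [h1 _] := @put_fun_ray_bounds m1 x _ m1M
    (ltac:(by rewrite invr_gt0 ltr0n) : 0 < n.+1%:R^-1).
  have [_ h2] := @put_fun_ray_bounds m2 x _ m2M
    (ltac:(by rewrite invr_gt0 ltr0n) : 0 < n.+1%:R^-1).
  rewrite !m12 in h1; have := le_trans h1 h2.
  by rewrite lee_pmul2r// lte_fin invr_gt0 ltr0n.
have cv := @ray_right_cvg m2 x m2M.
rewrite -(cvg_lim _ cv)//; apply: lime_ge; [by apply/cvg_ex; eexists;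
  exact: cv|exact: nearW].
Qed.

End measM.

(** * Put functions and the convex decreasing order *)

Section cd_le_put.
Context (R : realType).
Local Notation meas := {measure set (measurableTypeR R) -> \bar R}.
Implicit Types (eta chi : meas) (f : R -> R).

Lemma cd_le_put_fun eta chi k : measM eta -> measM chi -> cd_le eta chi ->
  put_fun eta k <= put_fun chi k.
Proof.
move=> eM cM ec; apply: fine_le.
- exact: (integrable_fin_num measurableT (int1_put k eM)).
- exact: (integrable_fin_num measurableT (int1_put k cM)).
apply: (ec (fun x => Num.max (k - x) 0)).
  apply/cvxP; have := cvx_max (cvx_affine k (-1)) (cvx_affine 0 0).
  by move=> H a m b amb; have := H a m b amb; rewrite !mulN1r !mul0r !addr0.
move=> x y xy; rewrite ge_max !le_max lexx orbT andbT.
by apply/orP; left; rewrite lerD2l lerN2.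
Qed.

Lemma cd_le_mass eta chi : measM eta -> measM chi -> cd_le eta chi ->
  eta setT = chi setT.
Proof.
move=> eM cM ec.
have cc c : @convex_function R R^o setT (fun=> c).
  apply/cvxP; have := cvx_affine c 0.
  by move=> H a m b amb; have := H a m b amb; rewrite !mul0r !addr0.
apply/eqP; rewrite eq_le; apply/andP; split.
  have := ec _ (cc 1) (fun _ _ _ => lexx _).
  by rewrite !integral_cst//= !mul1e.
have := ec _ (cc (- 1)) (fun _ _ _ => lexx _).
by rewrite !integral_cst//= EFinN !mulN1e leeN2.
Qed.

Definition tangent f k x := f k + right_derivative f k * (x - k).

(* The maximum of the tangents at a, a + d, ..., a + N d, written as an affine
   function plus puts. *)
Fixpoint tangents f a d N x :=
  if N is N'.+1 then
    tangents f (a + d) d N' x + Num.max (tangent f a x - tangent f (a + d) x) 0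
  else tangent f a x.

Section tangents.
Variable f : R -> R.
Hypothesis cf : cvx f.
Hypothesis nf : nonincreasing_fun f.

Lemma tangent_le k x : tangent f k x <= f x.
Proof. exact: right_derivative_tangent. Qed.

Lemma right_derivative_le0 k : right_derivative f k <= 0.
Proof.
have := tangent_le k (k + 1); have := nf (_ : k <= k + 1).
by rewrite lerDl ler01 => /(_ isT); rewrite /tangent; lra.
Qed.

Lemma right_derivative_nd a b : a <= b ->
  right_derivative f a <= right_derivative f b.
Proof.
rewrite le_eqVlt => /predU1P[->//|ab].
have := tangent_le a b; have := tangent_le b a; rewrite /tangent => h1 h2.
have ba : 0 < b - a by lra.
rewrite -(ler_pM2r ba); lra.
Qed.

Lemma tangent_left a b x : a <= b -> x <= a -> tangent f b x <= tangent f a x.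
Proof.
move=> ab xa; have := tangent_le b a; rewrite /tangent.
have := ler_wpM2r (_ : 0 <= a - x) (right_derivative_nd ab).
by rewrite subr_ge0 => /(_ xa); lra.
Qed.

Lemma tangent_right a b x : a <= b -> b <= x -> tangent f a x <= tangent f b x.
Proof.
move=> ab xa; have := tangent_le a b; rewrite /tangent.
have := ler_wpM2r (_ : 0 <= x - b) (right_derivative_nd ab).
by rewrite subr_ge0 => /(_ xa); lra.
Qed.

(** Left of a the tangent at a is the highest one, so every maximum is attained by its first
    argument and the sum telescopes. *)
Lemma tangents_left d N a x : 0 <= d -> x <= a ->
  tangents f a d N x = tangent f a x.
Proof.
move=> d0; elim: N a => //= N IH a xa; rewrite IH; last lra.
rewrite (_ : Num.max _ 0 = tangent f a x - tangent f (a + d) x); first by ring.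
by apply/max_idPl; rewrite subr_ge0 tangent_left//; lra.
Qed.

Lemma tangents_le d N a x : 0 <= d -> tangents f a d N x <= f x.
Proof.
move=> d0; elim: N a => [|N IH] a /=; first exact: tangent_le.
have [xa|xa] := leP x (a + d).
  rewrite tangents_left//.
  have [h|h] := leP (tangent f a x - tangent f (a + d) x) 0.
    by rewrite addr0 tangent_le.
  by rewrite addrC subrK tangent_le.
rewrite (_ : Num.max _ 0 = 0) ?addr0//.
by apply/max_idPr; rewrite subr_le0 tangent_right//; lra.
Qed.

Lemma tangents_ge d N a j x : (j <= N)%N ->
  tangent f (a + j%:R * d) x <= tangents f a d N x.
Proof.
elim: N a j => [|N IH] a [|j] //=; rewrite ?mul0r ?addr0 // => jN.
  have := IH (a + d) 0%N (leq0n _); rewrite mul0r addr0 => h.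
  have : tangent f a x - tangent f (a + d) x <= Num.max (tangent f a x -
    tangent f (a + d) x) 0.
    by rewrite le_max lexx.
  lra.
have -> : a + j.+1%:R * d = a + d + j%:R * d by rewrite -natr1; ring.
apply: (le_trans (IH _ _ jN)).
by rewrite lerDl le_max lexx orbT.
Qed.

End tangents.

Section put_le_cd.
Variables (eta chi : meas).
Hypotheses (eM : measM eta) (cM : measM chi).
Hypothesis massE : eta setT = chi setT.
Hypothesis putE : forall k, put_fun eta k <= put_fun chi k.

(** By parity P_chi(k) is k times the mass, minus the mean, plus a call that is small for some k; a
    larger mean of chi would push it below P_eta(k) there. This gives the comparison for affine
    functions of nonpositive slope. *)
Let mean_le : \int[chi]_x x <= \int[eta]_x x.
Proof.
rewrite leNgt; apply/negP => h; have := h; rewrite -subr_gt0 => h0.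
have [k] := call_fun_cvg0 cM h0; rewrite call_put//.
have := put_fun_ge k eM; have := putE k; rewrite massE; lra.
Qed.

(** Test functions already compared. The class is closed under sums and contains nonincreasing
    affine functions and their positive parts, hence [tangents]. *)
Let cmp f := [/\ int1 eta f, int1 chi f & \int[eta]_x f x <= \int[chi]_x f x].

Let cmpD f g : cmp f -> cmp g -> cmp (fun x => f x + g x).
Proof.
move=> [f1 f2 f3] [g1 g2 g3]; split; [exact: int1D|exact: int1D|].
by rewrite !RintegralD//; lra.
Qed.

Let cmp_affine a b : b <= 0 -> cmp (fun x => a + b * x).
Proof.
move=> b0; split; [exact: int1_affine|exact: int1_affine|].
rewrite !Rint_affine// massE lerD2l.
by rewrite ler_wnM2l.
Qed.

Let cmp_max_affine a b : b <= 0 -> cmp (fun x => Num.max (a + b * x) 0).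
Proof.
move=> b0; split; [exact: int1_max_affine|exact: int1_max_affine|].
have [b00|bn0] := eqVneq b 0.
  rewrite b00; under eq_Rintegral do rewrite mul0r.
  under [leRHS]eq_Rintegral do rewrite mul0r.
  by rewrite !Rintegral_cst// massE.
have bE x : Num.max (a + b * x) 0 = - b * Num.max (a / - b - x) 0.
  rewrite maxr_pMr ?mulr0; last lra.
  by congr Num.max; field; lra.
under eq_Rintegral do rewrite bE.
under [leRHS]eq_Rintegral do rewrite bE.
rewrite !RintegralZl//; [|exact: int1_put|exact: int1_put].
rewrite ler_wpM2l//; [lra|exact: putE].
Qed.

Let cmp_tangent f a : cvx f -> nonincreasing_fun f -> cmp (tangent f a).
Proof.
move=> cf nf; have :=
  cmp_affine (f a - right_derivative f a * a) (right_derivative_le0 cf nf a).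
by congr cmp; apply/funext => x; rewrite /tangent; ring.
Qed.

Let cmp_tangents f a d N : cvx f -> nonincreasing_fun f -> 0 <= d ->
  cmp (tangents f a d N).
Proof.
move=> cf nf d0; elim: N a => [|N IH] a /=; first exact: cmp_tangent.
apply: cmpD; first exact: IH.
have := right_derivative_nd cf (_ : a <= a + d); rewrite lerDl => /(_ d0).
rewrite -subr_le0 => sd.
have := cmp_max_affine (f a - right_derivative f a * a - f (a + d) +
  right_derivative f (a + d) * (a + d)) sd.
by congr cmp; apply/funext => x; rewrite /tangent; congr Num.max; ring.
Qed.

(** Subtracting an integrable minorant leaves a nonnegative integrand even if f is not integrable;
    if f - l is not integrable, both sides are +oo. *)
Let integral_minorant (m : meas) f l : measurable_fun [set: R] f -> int1 m l ->
  (forall x, l x <= f x) ->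
  (\int[m]_x (f x)%:E = \int[m]_x (f x - l x)%:E + \int[m]_x (l x)%:E)%E.
Proof.
move=> mf il lf.
have ml : measurable_fun [set: measurableTypeR R]
  (EFin \o l) by exact: measurable_int il.
have mfl : measurable_fun [set: measurableTypeR R] (fun x => (f x - l x)%:E).
  apply/measurable_EFinP; apply: measurable_funB => //.
  by apply/measurable_EFinP; exact: ml.
have [ifl|nfl] := pselect (int1 m (fun x => f x - l x)).
  rewrite -integralD//; apply: eq_integral => x _.
  by rewrite -EFinD subrK.
have fl0 x : (0 <= (f x - l x)%:E)%E by rewrite lee_fin subr_ge0.
have flE : (\int[m]_x (f x - l x)%:E = +oo)%E.
  apply/eqP; rewrite -leye_eq leNgt; apply/negP => h; apply: nfl.
  apply/integrableP; split => //; apply: le_lt_trans h.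
  apply: ge0_le_integral => //; first exact: measurableT_comp.
  by move=> x _; rewrite [X in (X <= _)%E]gee0_abs //=.
have absl : (\int[m]_x `|(l x)%:E| < +oo)%E by case/integrableP : il.
have mf' : measurable_fun [set: measurableTypeR R]
  (EFin \o f) by exact/measurable_EFinP.
have mabs : measurable_fun [set: measurableTypeR R] (fun x =>
  `|(l x)%:E|%E) by exact: measurableT_comp.
rewrite flE addye; last by have := integrable_fin_num measurableT il;
  rewrite fin_numE => /andP[].
rewrite integralE.
have neg : (\int[m]_x (EFin \o f)^\- x < +oo)%E.
  apply: le_lt_trans absl; apply: ge0_le_integral => //.
    exact: measurable_funeneg.
  move=> x _; rewrite funenegE/= ge_max; apply/andP; split => //.
  by rewrite lee_fin; have := lf x; have := ler_norm (- l x); rewrite normrN;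
    lra.
have pos : (\int[m]_x (EFin \o f)^\+ x = +oo)%E.
  apply/eqP; rewrite -leye_eq leNgt; apply/negP => h.
  have : (\int[m]_x (f x - l x)%:E <= \int[m]_x ((EFin \o f)^\+ x +
    `|(l x)%:E|))%E.
    apply: ge0_le_integral => //.
      by apply: emeasurable_funD => //; exact: measurable_funepos.
    move=> x _; rewrite funeposE/= EFinB leeD// ?le_max ?lexx//.
    by rewrite lee_fin; have := ler_norm (- l x); rewrite normrN.
  rewrite ge0_integralD//; last exact: measurable_funepos.
  by rewrite flE leye_eq => /eqP E; move: (lte_add_pinfty h absl); rewrite E.
by rewrite pos addye// eqe_oppLR/= lt_eqF.
Qed.

Let tangents_cvg f x : cvx f -> nonincreasing_fun f ->
  tangents f (- n%:R) n.+1%:R^-1 (n * n.+1 * 2)%N x @[n --> \oo] --> f x.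
Proof.
move=> cf nf.
(* The grid point k just left of x lies in [x - 1, x], so its slope is between s and 0 and its
   tangent loses at most -s / (n + 1) at x. *)
pose s := right_derivative f (x - 1).
apply: (@squeeze_cvgr _ _ _ _ (fun n => f x + s * n.+1%:R^-1) (cst (f x))).
- near=> n; apply/andP; split; last by apply: tangents_le => //;
    rewrite invr_ge0.
  have nx : `|x| <= n%:R by near: n; exact: nbhs_infty_ger.
  have n0 : 0 < n.+1%:R :> R by rewrite ltr0n.
  have xn : 0 <= x + n%:R by have := ler_norm (- x); rewrite normrN; lra.
  pose j := Num.truncn ((x + n%:R) * n.+1%:R).
  have /andP[j1 j2] : j%:R <= (x + n%:R) * n.+1%:R < j.+1%:R.
    by apply: truncn_itv; rewrite mulr_ge0// ltW.
  have jN : (j <= n * n.+1 * 2)%N.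
    rewrite -(ler_nat R); apply: le_trans j1 _.
    rewrite mulnAC natrM ler_wpM2r// natrM.
    by have := ler_norm x; lra.
  apply: le_trans (tangents_ge f _ _ _ jN).
  set k := - n%:R + j%:R * n.+1%:R^-1.
  have kx : k <= x.
    by rewrite /k addrC lerBlDr ler_pdivrMr.
  have xk : x - k <= n.+1%:R^-1.
    have : x + n%:R <= j.+1%:R * n.+1%:R^-1 by rewrite ler_pdivlMr// ltW.
    by rewrite -[j.+1%:R]natr1 mulrDl mul1r /k opprD opprK addrA lerBlDr
      [leRHS]addrC.
  have n1 : n.+1%:R^-1 <= 1 :> R by rewrite invf_le1// ler1n.
  clearbody k; move: (n.+1%:R^-1) xk n1 => v xk n1.
  have sk : s <= right_derivative f k by apply: right_derivative_nd => //; lra.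
  rewrite /tangent; have := nf _ _ kx => fkx.
  have : s * v <= s * (x - k) by rewrite ler_wnM2l//;
    exact: right_derivative_le0.
  have : s * (x - k) <= right_derivative f k * (x - k) by rewrite ler_wpM2r//
    subr_ge0.
  lra.
- rewrite -[X in _ --> X]addr0; apply: cvgD; first exact: cvg_cst.
  rewrite -(mulr0 s); apply: cvgM; first exact: cvg_cst.
  exact: cvg_harmonic.
- exact: cvg_cst.
Unshelve. all: by end_near. Qed.

(** Subtracting the tangent l at 0 makes the integrands nonnegative. The grids are not nested, so
    Fatou's lemma stands in for monotone convergence on the side of eta; on the side of chi the
    bound g n <= f suffices. *)
Lemma put_le_cd_le : cd_le eta chi.
Proof.
move=> f /cvxP cf nf.
have mf : measurable_fun [set: R] f by apply: nonincreasing_measurable => // x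
  y; exact: nf.
pose g n := tangents f (- n%:R) n.+1%:R^-1 (n * n.+1 * 2)%N.
have cg n : cmp (g n) by apply: cmp_tangents; rewrite ?invr_ge0.
pose l := tangent f 0; have [le lc _] := cmp_tangent 0 cf nf.
have lf x : l x <= f x by exact: tangent_le.
have gf n x : g n x <= f x by apply: tangents_le; rewrite ?invr_ge0.
have lg n x : l x <= g n x.
  (* The point 0 belongs to every grid, with index n (n + 1). *)
  have := @tangents_ge f n.+1%:R^-1 (n * n.+1 * 2) (- n%:R) (n * n.+1) x.
  rewrite leq_pmulr// => /(_ isT); rewrite natrM mulfK ?pnatr_eq0// addNr.
  exact.
have gl0 n x : (0 <= (g n x - l x)%:E)%E by rewrite lee_fin subr_ge0.
have fl0 x : (0 <= (f x - l x)%:E)%E by rewrite lee_fin subr_ge0.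
have mg n : measurable_fun [set: measurableTypeR R] (fun x => (g n x - l x)%:E).
  by have [i1 _ _] := cg n; have := int1B i1 le; apply: measurable_int.
have mfl : measurable_fun [set: measurableTypeR R] (fun x => (f x - l x)%:E).
  apply/measurable_EFinP; apply: measurable_funB => //.
  by apply/measurable_EFinP; have := le; apply: measurable_int.
rewrite !(integral_minorant mf _ lf)//.
have lE m : int1 m l -> (\int[m]_x (l x)%:E = (\int[m]_x l x)%:E)%E.
  by move=> il; rewrite fineK//; exact: (integrable_fin_num measurableT il).
rewrite !lE// -leeBrDr//.
have bound n : (\int[eta]_x (g n x - l x)%:E <= \int[chi]_x (f x - l x)%:E +
  (\int[chi]_x l x)%:E - (\int[eta]_x l x)%:E)%E.
  rewrite leeBrDr//.
  have [i1 i2 i12] := cg n.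
  have -> : (\int[eta]_x (g n x - l x)%:E + (\int[eta]_x l x)%:E =
    (\int[eta]_x g n x)%:E)%E.
    rewrite -lE// -integral_minorant//; first by rewrite fineK//;
      exact: (integrable_fin_num measurableT i1).
    by apply/measurable_EFinP; have := i1; apply: measurable_int.
  apply: (@le_trans _ _ (\int[chi]_x g n x)%:E); first by rewrite lee_fin.
  have -> : ((\int[chi]_x g n x)%:E = \int[chi]_x (g n x - l x)%:E +
    (\int[chi]_x l x)%:E)%E.
    rewrite -lE// -integral_minorant//; first by rewrite fineK//;
      exact: (integrable_fin_num measurableT i2).
    by apply/measurable_EFinP; have := i1; apply: measurable_int.
  rewrite leeD2r//; apply: ge0_le_integral => //.
  by move=> x _; rewrite lee_fin lerD2r.
apply: (@le_trans _ _ (limn_einf (fun n => \int[eta]_x (g n x - l x)%:E)))%E.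
  apply: le_trans (fatou _ measurableT mg (fun n x _ => gl0 n x)).
  rewrite le_eqVlt; apply/orP; left; apply/eqP/eq_integral => x _.
  have gcv : (g n x - l x)%:E @[n --> \oo] --> (f x - l x)%:E.
    apply/fine_cvgP; split; first exact: nearW.
    by apply: cvgB; [exact: tangents_cvg|exact: cvg_cst].
  rewrite is_cvg_limn_einfE; first by rewrite (cvg_lim _ gcv).
  by apply/cvg_ex; eexists; exact: gcv.
rewrite limn_einf_lim; apply: lime_le; first exact: is_cvg_einfs.
apply: nearW => n; apply: le_trans (bound n).
by apply: ereal_inf_lbound; exists n => /=.
Qed.

End put_le_cd.
End cd_le_put.

(** * Integration of supergradients *)

Section ftc.
Context (R : realType).

Lemma measurable_nondecreasing_in (D : set R) (f : R -> R) : is_interval D ->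
  {in D &, nondecreasing_fun f} -> measurable_fun D f.
Proof.
move=> iD nf; apply: (measurability (@RGenCInfty.G R)) => [|/= _ [_] [r] -> <-].
  exact: RGenCInfty.measurableE.
apply: is_interval_measurable => x y [Dx rx] [Dy ry] z /andP[xz zy].
have Dz : D z by apply: (iD x y) => //; rewrite xz zy.
split => //; move: rx; rewrite /= !in_itv/= !andbT => /le_trans; apply.
by apply: nf; rewrite ?inE.
Qed.

(* Halving the interval n times divides the bound by 2 ^ n. *)
Lemma constant_of_increment (D j : R -> R) (b : R) :
  (forall s t, 0 <= s -> s <= t -> t < b -> `|D t - D s| <= (j t - j s) *
    (t - s)) ->
  forall t, 0 <= t < b -> D t = D 0.
Proof.
move=> H t /andP[t0 tb].
have Hn n : forall s t, 0 <= s -> s <= t -> t < b ->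
    `|D t - D s| * 2 ^+ n <= (j t - j s) * (t - s).
  elim: n => [|n IH] s u s0 su ub; first by rewrite expr0 mulr1 H.
  pose m := (s + u) / 2.
  have h1 : `|D m - D s| * 2 ^+ n <= (j m - j s) * (m - s) by apply: IH;
    rewrite /m; lra.
  have h2 : `|D u - D m| * 2 ^+ n <= (j u - j m) * (u - m) by apply: IH;
    rewrite /m; lra.
  have h3 : `|D u - D s| <= `|D u - D m| + `|D m - D s|.
    by apply: le_trans (ler_normD _ _); rewrite addrA subrK.
  rewrite exprS mulrA [_ * 2]mulrC -mulrA.
  have h4 : `|D u - D s| * 2 ^+ n <= (`|D u - D m| + `|D m - D s|) * 2 ^+ n.
    by rewrite ler_wpM2r// exprn_ge0.
  have h5 : (j m - j s) * (m - s) + (j u - j m) * (u - m) = (j u - j s) *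
    (u - s) / 2.
    by rewrite /m; field.
  lra.
apply/eqP; rewrite -subr_eq0 -normr_le0 leNgt; apply/negP => e0.
pose C := (j t - j 0) * (t - 0).
pose n := Num.truncn (C / `|D t - D 0|).
have h : C / `|D t - D 0| < n.+1%:R by exact: truncnS_gt.
have := Hn n.+1 0 t (lexx 0) t0 tb; rewrite -/C mulrC -ler_pdivlMr// => h2.
have : n.+1%:R <= 2 ^+ n.+1 :> R by rewrite -natrX ler_nat ltnW// ltn_expl.
by move=> h3; have := le_lt_trans (le_trans h3 h2) h; rewrite ltxx.
Qed.

Variables (F j : R -> R).
Hypothesis j0 : forall u, 0 <= j u.
Hypothesis Fj : forall u v : R, 0 <= u < 1 -> 0 <= v < 1 ->
  F v - F u <= - j u * (v - u).

Lemma supergradient_nd u v : 0 <= u -> u <= v -> v < 1 -> j u <= j v.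
Proof.
move=> u0; rewrite le_eqVlt => /predU1P[->//|uv] v1.
have := Fj (u := u) (v := v); have := Fj (u := v) (v := u).
have -> : 0 <= u < 1 by lra.
have -> : 0 <= v < 1 by lra.
move=> /(_ isT isT) h1 /(_ isT isT) h2.
have vu : 0 < v - u by lra.
rewrite -(ler_pM2r vu); lra.
Qed.

Let I (u : R) := (\int[lebesgue_measure]_(t in `[0%R, u]) (j t)%:E)%E.

Let mj : measurable_fun (`[0, 1[%classic : set R) j.
Proof.
apply: measurable_nondecreasing_in; first exact: interval_is_interval.
move=> x y; rewrite !inE/= !in_itv/= => /andP[x0 _] /andP[_ y1] xy.
exact: supergradient_nd.
Qed.

Let Iadd u v : 0 <= u -> u <= v -> v < 1 ->
  (I v = I u + \int[lebesgue_measure]_(t in `]u, v]) (j t)%:E)%E.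
Proof.
move=> u0 uv v1; rewrite /I.
have -> : `[0%R, v]%classic = `[0%R, u] `|` `]u, v] :> set R.
  by rewrite -itv_bndbnd_setU// bnd_simp.
rewrite ge0_integral_setU//=.
- apply/measurable_EFinP; apply: measurable_funS mj => //.
  by move=> x /=; rewrite !in_itv/= => -[]; lra.
- by move=> x _; rewrite lee_fin.
- apply/disj_setPS => x /=; rewrite !in_itv/= => -[]; lra.
Qed.

Let bounds u v : 0 <= u -> u <= v -> v < 1 ->
  ((j u * (v - u))%:E <= \int[lebesgue_measure]_(t in `]u, v]) (j t)%:E /\
   \int[lebesgue_measure]_(t in `]u, v]) (j t)%:E <= (j v * (v - u))%:E)%E.
Proof.
move=> u0 uv v1.
have cstE c : (\int[lebesgue_measure]_(t in `]u, v]) c%:E = (c * (v - u))%:E)%E.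
  rewrite integral_cst//= lebesgue_measure_itv/= lte_fin.
  move: uv; rewrite le_eqVlt => /predU1P[->|->//].
  by rewrite ltxx mule0 subrr mulr0.
have mjuv : measurable_fun (`]u, v]%classic : set R) (EFin \o j).
  apply/measurable_EFinP; apply: measurable_funS mj => //.
  by move=> x /=; rewrite !in_itv/=; lra.
rewrite -!cstE; split; apply: ge0_le_integral => //.
- by move=> x _; rewrite lee_fin.
- by move=> x /=; rewrite in_itv/= lee_fin => /andP[ux xv];
    apply: supergradient_nd; lra.
- by move=> x _; rewrite lee_fin.
- by move=> x /=; rewrite in_itv/= lee_fin => /andP[ux xv];
    apply: supergradient_nd; lra.
Qed.

Let I0 : I 0 = 0%E.
Proof. by rewrite /I set_itv1 integral_set1. Qed.

Let Ifin u : 0 <= u < 1 -> I u \is a fin_num.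
Proof.
move=> /andP[u0 u1]; rewrite (Iadd (lexx 0) u0 u1) I0 add0e.
have [_ h] := bounds (lexx 0) u0 u1.
rewrite ge0_fin_numE; first exact: le_lt_trans h (ltry _).
by apply: integral_ge0 => x _; rewrite lee_fin.
Qed.

(** Over [s, t] both the integral of j and F s - F t lie between j s (t - s) and j t (t - s). The
    increments of I + F are thus bounded as in [constant_of_increment]. *)
Lemma integral_supergradient u : 0 <= u < 1 -> I u = (F 0 - F u)%:E.
Proof.
move=> u01; pose D u := fine (I u) + F u.
have : D u = D 0.
  apply: (@constant_of_increment D j 1) => // s t s0 st t1.
  have st' : 0 <= s < 1 by lra. have tt' : 0 <= t < 1 by lra.
  have [b1 b2] := bounds s0 st t1.
  have It : fine (I t) = fine (I s) +
    fine (\int[lebesgue_measure]_(t in `]s, t]) (j t)%:E)%E.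
    rewrite (Iadd s0 st t1) fineD//; first exact: Ifin.
    rewrite ge0_fin_numE; first exact: le_lt_trans b2 (ltry _).
    by apply: integral_ge0 => x _; rewrite lee_fin.
  have Ifs : (\int[lebesgue_measure]_(t in `]s, t]) (j t)%:E)%E \is a fin_num.
    rewrite ge0_fin_numE; first exact: le_lt_trans b2 (ltry _).
    by apply: integral_ge0 => x _; rewrite lee_fin.
  rewrite -(fineK Ifs) !lee_fin in b1 b2.
  rewrite /D It; move: (fine (\int[_]_(_ in _) _)%E) b1 b2 => i b1 b2.
  have f1 := Fj st' tt'; have f2 := Fj tt' st'.
  rewrite ler_norml; lra.
rewrite /D I0/= add0r => E.
by rewrite -(fineK (Ifin u01)); congr EFin; lra.
Qed.

End ftc.

(** * Quantiles and right-most parts *)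

Lemma ge0_integral_mrestr d (T : measurableType d) (R : realType)
    (m : {measure set T -> \bar R}) (D : set T) (mD : measurable D) (f : T ->
      \bar R) :
  measurable_fun setT f -> (forall x, 0 <= f x)%E ->
  (\int[mrestr m mD]_x f x = \int[m]_(x in D) f x)%E.
Proof.
move=> mf f0.
have -> : (\int[mrestr m mD]_x f x =
    \int[mrestr m mD]_(x in D) f x + \int[mrestr m mD]_(x in ~` D) f x)%E.
  rewrite -[X in integral _ X _](setUv D) ge0_integral_setU//.
  - exact: measurableC.
  - by rewrite setUv.
  - by apply/disj_setPS; rewrite setICr.
rewrite [X in (_ + X)%E](@eq_measure_integral _ _ _ _ mzero); last first.
  move=> A mA AD /=; rewrite /mrestr (_ : A `&` D = set0)// ?measure0//.
  by apply/seteqP; split => x // [/AD].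
rewrite integral_measure_zero adde0.
by apply: eq_measure_integral => A mA AD /=; rewrite /mrestr (setIidl AD).
Qed.

Section quantile.
Context (R : realType) (mu : probability (measurableTypeR R) R).
Implicit Types (u v w x y : R).

Definition tail x : R := fine (mu `[x, +oo[%classic).
Definition otail x : R := fine (mu `]x, +oo[%classic).
Let G u := quantile mu (1 - u).

Let mufin (A : set (measurableTypeR R)) : measurable A -> mu A \is a fin_num.
Proof. exact: fin_num_measure. Qed.

Lemma tailE x : (tail x)%:E = mu `[x, +oo[%classic.
Proof. by rewrite /tail fineK// mufin. Qed.

Lemma otailE x : (otail x)%:E = mu `]x, +oo[%classic.
Proof. by rewrite /otail fineK// mufin. Qed.

Lemma tail_ge0 x : 0 <= tail x.
Proof. exact: fine_ge0. Qed.

Lemma otail_ge0 x : 0 <= otail x.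
Proof. exact: fine_ge0. Qed.

Lemma tail_le1 x : tail x <= 1.
Proof. by rewrite -lee_fin tailE probability_le1. Qed.

Lemma le_tail x y : x <= y -> tail y <= tail x.
Proof.
move=> xy; rewrite -lee_fin !tailE; apply: le_measure; rewrite ?inE//.
by move=> z /=; rewrite !in_itv/= !andbT; exact: le_trans.
Qed.

Lemma otail_le_tail x : otail x <= tail x.
Proof.
rewrite -lee_fin tailE otailE; apply: le_measure; rewrite ?inE//.
by move=> z /=; rewrite !in_itv/= !andbT; exact: ltW.
Qed.

Lemma tail_le_otail x y : x < y -> tail y <= otail x.
Proof.
move=> xy; rewrite -lee_fin tailE otailE; apply: le_measure; rewrite ?inE//.
by move=> z /=; rewrite !in_itv/= !andbT; exact: lt_le_trans.
Qed.

Lemma tail_cvg_pinfty w : 0 < w -> exists x, tail x < w.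
Proof.
move=> w0; apply: contrapT => /forallNP H.
have cv : mu `[n%:R, +oo[%classic @[n --> \oo] --> mu set0.
  have -> : set0 = \bigcap_n `[(n%:R :
    R), +oo[%classic :> set (measurableTypeR R).
    apply/seteqP; split => // x Hx; have := Hx (Num.truncn x).+1 I.
    by rewrite /= in_itv/= andbT leNgt truncnS_gt.
  apply: nonincreasing_cvg_mu => //.
  - by rewrite ltey_eq mufin.
  - exact: bigcapT_measurable.
  - move=> a b ab; apply/subsetPset => y /=; rewrite !in_itv/= !andbT.
    by apply: le_trans; rewrite ler_nat.
have : (w%:E <= mu set0)%E.
  rewrite -(cvg_lim _ cv)//; apply: lime_ge; first by apply/cvg_ex; eexists;
    exact: cv.
  by apply: nearW => n; rewrite -tailE lee_fin leNgt; apply/negP; exact: H.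
by rewrite measure0 lee_fin leNgt w0.
Qed.

Lemma tail_cvg_ninfty w : w < 1 -> exists x, w < tail x.
Proof.
move=> w0; apply: contrapT => /forallNP H.
have cv : mu `[- n%:R, +oo[%classic @[n --> \oo] --> mu setT.
  have -> : setT = \bigcup_n `[(- n%:R :
    R), +oo[%classic :> set (measurableTypeR R).
    apply/seteqP; split => // x _; exists (Num.truncn (- x)).+1 => //=.
    by rewrite in_itv/= andbT lerNl ltW// truncnS_gt.
  apply: nondecreasing_cvg_mu => //.
  - exact: bigcupT_measurable.
  - move=> a b ab; apply/subsetPset => y /=; rewrite !in_itv/= !andbT.
    by apply: le_trans; rewrite lerN2 ler_nat.
have : (mu setT <= w%:E)%E.
  rewrite -(cvg_lim _ cv)//; apply: lime_le; first by apply/cvg_ex; eexists;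
    exact: cv.
  by apply: nearW => n; rewrite -tailE lee_fin leNgt; apply/negP; exact: H.
by rewrite probability_setT lee_fin leNgt w0.
Qed.

Let cdf_otail k : (mu `]-oo, k]%classic = (1 - otail k)%:E)%E.
Proof.
rewrite -setCitvr/= -[X in mu X]setTD measureD//= ?setTI ?probability_setT.
  by rewrite -otailE.
by rewrite ltry.
Qed.

Lemma tail_left_cont x w : (forall y, y < x -> w <= otail y) -> w <= tail x.
Proof.
move=> H.
have cv : mu `](x - n.+1%:R^-1), +oo[%classic @[n --> \oo] -->
  mu `[x, +oo[%classic.
  have -> : `[x, +oo[%classic = \bigcap_n `](x - n.+1%:R^-1)%R, +oo[%classic :>
    set (measurableTypeR R).
    apply/seteqP; split => z /=; rewrite in_itv/= andbT.
      move=> xz n _ /=; rewrite in_itv/= andbT; apply: lt_le_trans xz.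
      by rewrite gtrBl invr_gt0.
    move=> Hz; rewrite leNgt; apply/negP => zx.
    have := Hz (Num.truncn (x - z)^-1) I; rewrite /= in_itv/= andbT.
    rewrite ltrBlDr -ltrBlDl => h.
    have := truncnS_gt (x - z)^-1.
    by rewrite invf_plt ?posrE ?subr_gt0 ?ltr0n// ltNge (ltW h).
  apply: nonincreasing_cvg_mu => //.
  - by rewrite ltey_eq mufin.
  - exact: bigcapT_measurable.
  - move=> a b ab; apply/subsetPset => y /=; rewrite !in_itv/= !andbT.
    by apply: le_lt_trans; rewrite lerB// lef_pV2 ?posrE ?ltr0n// ler_nat ltnS.
rewrite -lee_fin tailE -(cvg_lim _ cv)//; apply: lime_ge.
  by apply/cvg_ex; eexists; exact: cv.
by apply: nearW => n; rewrite -otailE lee_fin H// gtrBl invr_gt0.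
Qed.

(** Galois connection between u |-> G_u and the tail. The infimum runs over the k with [otail] k <
    u, so x <= G_u means u <= [otail] left of x, and the left limit of [otail] at x is [tail] x. *)
Lemma le_quantile u x : 0 < u < 1 -> (x <= G u) = (u <= tail x).
Proof.
move=> /andP[u0 u1]; rewrite /G /quantile; set S := [set k | _].
have SE k : S k <-> otail k < u.
  by rewrite /S/= cdf_otail lte_fin ltrD2l ltrN2.
have S0 : S !=set0.
  have [k ku] := tail_cvg_pinfty u0; exists k; apply/SE.
  exact: le_lt_trans (otail_le_tail _) ku.
have Slb : has_lbound S.
  have [k ku] := tail_cvg_ninfty u1; exists k => z /SE zu.
  rewrite leNgt; apply/negP => /tail_le_otail; lra.
apply/idP/idP => [xi|ub].
  apply: tail_left_cont => y yx; rewrite leNgt; apply/negP => /SE Sy.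
  by have := ge_inf Slb Sy; lra.
apply: lb_le_inf => // k /SE ku; rewrite leNgt; apply/negP => /tail_le_otail.
lra.
Qed.

Lemma quantile_antitone u v : 0 < u -> u <= v -> v < 1 -> G v <= G u.
Proof.
move=> u0 uv v1; have v01 : 0 < v < 1 by lra.
have u01 : 0 < u < 1 by lra.
by rewrite le_quantile//; apply: le_trans uv _; rewrite -le_quantile.
Qed.

Lemma lt_quantile u x : 0 < u < 1 -> x < G u -> u <= otail x.
Proof. by move=> u01 /tail_le_otail; apply: le_trans; rewrite -le_quantile. Qed.

Lemma right_part_integral u (f : R -> \bar R) : measurable_fun [set: R] f ->
  (forall x, 0 <= f x)%E ->
  (\int[right_part mu u]_x f x = \int[lebesgue_measure]_(t in `[0%R, u]) f
    (G t))%E.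
Proof.
move=> mf f0.
have E := @ge0_integral_pushforward _ _ _ _ R _ (measurable_dquantile mu)
  (mrestr lebesgue_measure (measurable_itv `[0%R, u])) setT f measurableT mf
    (fun y _ => f0 y).
rewrite [LHS]E.
rewrite preimage_setT ge0_integral_mrestr//.
  by apply: measurableT_comp => //; exact: measurable_dquantile.
by move=> x; exact: f0.
Qed.

Lemma right_part_itv u (A : set (measurableTypeR R)) : measurable A ->
  right_part mu u A = lebesgue_measure (G @^-1` A `&` `[0, u]).
Proof. by []. Qed.

(** By [le_quantile] the preimage of the ray is [0, min u (tail x)], up to the levels 0 and 1, where
    the quantile may be meaningless. *)
Lemma right_part_tail u x : 0 <= u <= 1 ->
  right_part mu u `[x, +oo[%classic = (Num.min u (tail x))%:E.
Proof.
move=> /andP[u0 u1].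
have mG : measurable (G @^-1` `[x, +oo[%classic).
  by rewrite -[X in measurable X]setTI; apply: measurable_dquantile.
have leb01 : lebesgue_measure [set (0 : R); 1] = 0%E.
  by apply: countable_lebesgue_measure0; apply: finite_set_countable;
    exact: finite_set2.
have m01 : measurable [set (0 : R); 1] by exact: measurableU.
have bx0 := tail_ge0 x. have bx1 := tail_le1 x.
have -> : (Num.min u (tail x))%:E =
  lebesgue_measure (`[0, Num.min u (tail x)]%classic : set R).
  rewrite lebesgue_measure_itv/= lte_fin; case: ifPn => [_|];
    first by rewrite oppr0 adde0.
  by rewrite -leNgt ge_min => /orP h; congr EFin; apply/eqP;
    rewrite eq_le ge_min le_min u0 bx0 /= andbT; apply/orP.
rewrite right_part_itv//; apply/eqP; rewrite eq_le; apply/andP; split.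
  apply: (@le_trans _ _ (lebesgue_measure (`[0, Num.min u (tail x)]%classic `|`
    [set 0; 1]))).
    apply: le_measure; rewrite ?inE; [exact: measurableI|exact: measurableU|].
    move=> t /=; rewrite !in_itv/= andbT => -[xG /andP[t0 tu]].
    have [t00|tn0] := eqVneq t 0; first by right; left.
    have [t11|tn1] := eqVneq t 1; first by right; right.
    left; rewrite t0 le_min tu/= -le_quantile//.
    by rewrite !lt_neqAle (eq_sym 0) tn0 t0 tn1/=; apply: le_trans u1.
  apply: le_trans (measureU2 _ _ _) _ => //.
  by rewrite -[leRHS]adde0 leeD2l// le_eqVlt; apply/orP; left; apply/eqP;
    exact: leb01.
apply: (@le_trans _ _ (lebesgue_measure
  ((G @^-1` `[x, +oo[%classic `&` `[0, u]) `|` [set 0; 1]))).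
  apply: le_measure; rewrite ?inE//; first by apply: measurableU => //;
    exact: measurableI.
  move=> t /=; rewrite !in_itv/= le_min => /andP[t0 /andP[tu tb]].
  have [t00|tn0] := eqVneq t 0; first by right; left.
  have [t11|tn1] := eqVneq t 1; first by right; right.
  left; rewrite andbT t0 tu le_quantile//.
  by rewrite !lt_neqAle (eq_sym 0) tn0 t0 tn1/=; apply: le_trans u1.
apply: le_trans (measureU2 _ _ _) _ => //; first exact: measurableI.
by rewrite -[leRHS]adde0 leeD2l// le_eqVlt; apply/orP; left; apply/eqP;
  exact: leb01.
Qed.

Lemma right_part_mass u : 0 <= u -> right_part mu u setT = u%:E.
Proof.
move=> u0; rewrite right_part_itv// preimage_setT setTI lebesgue_measure_itv/=
  lte_fin.
by move: u0; rewrite le_eqVlt => /predU1P[<-|->]; rewrite ?ltxx// oppr0 adde0.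
Qed.

Lemma right_part_fin u : 0 <= u -> (right_part mu u setT < +oo)%E.
Proof. by move=> u0; rewrite right_part_mass// ltry. Qed.

Lemma right_part1 A : measurable A -> right_part mu 1 A = mu A.
Proof.
apply: measure_eq_gee; first exact: right_part_fin.
move=> x; rewrite right_part_tail ?lexx ?ler01//.
by rewrite (_ : Num.min 1 _ = tail x) ?tailE//; apply/min_idPr; exact: tail_le1.
Qed.

Lemma right_part_le u v : u <= v ->
  measure_le (right_part mu u) (right_part mu v).
Proof.
move=> uv A mA; rewrite !right_part_itv//.
have mG : measurable (G @^-1` A).
  by rewrite -[X in measurable X]setTI; apply: measurable_dquantile.
apply: le_measure; rewrite ?inE; [exact: measurableI|exact: measurableI|].
by apply: setIS => x /=; rewrite !in_itv/= => /andP[->]/le_trans; apply.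
Qed.

Lemma right_part_le_mu u : u <= 1 -> measure_le (right_part mu u) mu.
Proof. by move=> u1 A mA; have := right_part_le u1 mA; rewrite right_part1. Qed.

(** Half-lines [x, oo) are right-most parts at the levels [tail] x; this transfers the shadows from
    levels to half-planes. *)
Lemma mrestr_right_part x A : measurable A ->
  mrestr mu (measurable_itv `[x, +oo[) A = right_part mu (tail x) A.
Proof.
apply: measure_eq_gee.
  by apply: le_lt_trans (_ : (mu setT < +oo)%E);
    [apply: le_measure; rewrite ?inE// setTI|rewrite probability_setT ltry].
move=> y; rewrite right_part_tail ?tail_ge0 ?tail_le1//= /mrestr.
have -> : `[y, +oo[%classic `&` `[x, +oo[%classic = `[Num.max x y,
  +oo[%classic :> set (measurableTypeR R).
  apply/seteqP; split => z /=; rewrite !in_itv/= !andbT ge_max.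
    by move=> [-> ->].
  by move=> /andP[].
rewrite -tailE; congr EFin.
have [xy|xy] := leP x y.
  by apply/esym/min_idPr; exact: le_tail.
by apply/esym/min_idPl; apply: le_tail; exact: ltW.
Qed.

End quantile.

(** * Dependence of the hull on the level *)

Section hull_flow.
Context (R : realType) (mu nu : probability (measurableTypeR R) R).
Hypotheses (mu1 : first_moment mu) (nu1 : first_moment nu) (munu : cd_le mu nu).
Implicit Types (u v k : R).
Let G u := quantile mu (1 - u).
Local Notation rp := (right_part mu).

Lemma probability_measM (P : probability (measurableTypeR R) R) :
  first_moment P -> measM P.
Proof.
move=> P1; split; last exact: P1.
by apply: le_lt_trans (probability_le1 P measurableT) _; rewrite ltry.
Qed.

Let muM : measM mu := probability_measM mu1.
Let nuM : measM nu := probability_measM nu1.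

Lemma right_part_measM u : u <= 1 -> measM (rp u).
Proof. by move=> u1; apply: measM_le muM; exact: right_part_le_mu. Qed.

Let rpM := right_part_measM.

Let fine1 (P : probability (measurableTypeR R) R) : fine (P setT) = 1.
Proof. by have /= -> := @probability_setT _ _ _ P. Qed.

Lemma put_mu_le_nu k : put_fun mu k <= put_fun nu k.
Proof. exact: cd_le_put_fun. Qed.

Lemma put_right_part_le u k : u <= 1 -> put_fun (rp u) k <= put_fun mu k.
Proof.
by move=> u1; apply: put_fun_le_measure => //; exact: right_part_le_mu.
Qed.

Let c0 u := \int[mu]_x x - \int[rp u]_x x.

(** By put-call parity the calls contribute only puts and an affine function, which is the asymptote
    at -oo because both remaining puts vanish there. *)
Lemma E_funE u k : 0 <= u <= 1 ->
  E_fun mu nu u k = put_fun nu k - put_fun (rp u) k + (c0 u - (1 - u) * k).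
Proof.
move=> /andP[u0 u1]; rewrite /E_fun !call_put//; last exact: rpM.
rewrite right_part_mass// fine1 /c0 /=; lra.
Qed.

Let put_rpE u k : u <= 1 ->
  ((put_fun (rp u) k)%:E = \int[lebesgue_measure]_(t in `[0%R, u]) (Num.max (k -
    G t) 0)%:E)%E.
Proof.
move=> u1; rewrite fineK;
  last exact: (integrable_fin_num measurableT (int1_put k (rpM u1))).
rewrite right_part_integral//.
  by have := int1_put k muM; apply: measurable_int.
by move=> x; rewrite lee_fin le_max lexx orbT.
Qed.

Let call_rpE u k : u <= 1 ->
  ((call_fun (rp u) k)%:E = \int[lebesgue_measure]_(t in `[0%R, u])
    (Num.max (G t - k) 0)%:E)%E.
Proof.
move=> u1; rewrite fineK;
  last exact: (integrable_fin_num measurableT (int1_call k (rpM u1))).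
rewrite right_part_integral//.
  by have := int1_call k muM; apply: measurable_int.
by move=> x; rewrite lee_fin le_max lexx orbT.
Qed.

Let mputG k (D : set R) : measurable_fun D (fun t => (Num.max (k - G t) 0)%:E).
Proof.
apply: measurable_funTS.
apply: (@measurableT_comp _ _ _ _ _ _ (fun y : R => (Num.max (k - y) 0)%:E)).
  by have := int1_put k muM; apply: measurable_int.
exact: measurable_dquantile.
Qed.

Let mcallG k (D : set R) : measurable_fun D (fun t => (Num.max (G t - k) 0)%:E).
Proof.
apply: measurable_funTS.
apply: (@measurableT_comp _ _ _ _ _ _ (fun y : R => (Num.max (y - k) 0)%:E)).
  by have := int1_call k muM; apply: measurable_int.
exact: measurable_dquantile.
Qed.

Let split_integral u v (f : R -> \bar R) : 0 <= u -> u <= v ->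
  (forall D : set R, measurable_fun D f) -> (forall x, 0 <= f x)%E ->
  (\int[lebesgue_measure]_(t in `[0%R, v]) f t =
   \int[lebesgue_measure]_(t in `[0%R, u]) f t +
     \int[lebesgue_measure]_(t in `]u, v]) f t)%E.
Proof.
move=> u0 uv mf f0.
have -> : `[0%R, v]%classic = `[0%R, u] `|` `]u, v] :> set R.
  by rewrite -itv_bndbnd_setU// bnd_simp.
rewrite ge0_integral_setU//=; first exact: mf.
by apply/disj_setPS => x /=; rewrite !in_itv/= => -[]; lra.
Qed.

Let integral_itv_cst u v c b1 b2 : u <= v ->
  (\int[lebesgue_measure]_(t in [set` Interval (BSide b1 u) (BSide b2 v)])
    c%:E = (c * (v - u))%:E)%E.
Proof.
move=> uv; rewrite integral_cst//= lebesgue_measure_itv/= lte_fin.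
move: uv; rewrite le_eqVlt => /predU1P[->|->//].
by rewrite ltxx mule0 subrr mulr0.
Qed.

(** The integrand (k - G_t)^+ is nondecreasing in t, so its value at u is a subgradient of u |->
    P_{mu_u}(k). *)
Lemma put_right_part_incr u v k : 0 < u < 1 -> 0 <= v <= 1 ->
  (v - u) * Num.max (k - G u) 0 <= put_fun (rp v) k - put_fun (rp u) k.
Proof.
move=> /andP[u0 u1] /andP[v0 v1].
set c := Num.max _ _.
have cge0 : 0 <= c by rewrite /c le_max lexx orbT.
have f0 t : (0 <= (Num.max (k - G t) 0)%:E)%E by rewrite lee_fin le_max lexx
  orbT.
have [uv|vu] := leP u v.
  rewrite lerBrDl -lee_fin EFinD put_rpE ?(ltW u1)// put_rpE//.
  rewrite (split_integral (ltW u0) uv)// ?leeD2l//.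
  rewrite mulrC -(@integral_itv_cst u v c false true uv).
  (* The right end is dropped because v may be 1, where the quantile is not controlled. *)
  apply: (@le_trans _ _ (\int[lebesgue_measure]_(t in `]u, v[) (Num.max (k -
    G t) 0)%:E)%E); last first.
    apply: ge0_subset_integral => //=; first exact: mputG.
    by move=> x /=; rewrite !in_itv/= => /andP[-> /ltW].
  apply: ge0_le_integral => //=; first exact: mputG.
  move=> x; rewrite in_itv/= => /andP[ux xv]; rewrite lee_fin /c.
  have := @quantile_antitone _ mu u x u0 (ltW ux) (lt_le_trans xv v1).
  rewrite -/(G u) -/(G x) => Gxu.
  by rewrite ge_max !le_max lexx orbT andbT; apply/orP; left; lra.
rewrite -lerN2 opprB lerBlDl -mulNr opprB -lee_fin EFinD.
rewrite put_rpE ?(ltW u1)// put_rpE//.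
rewrite (split_integral v0 (ltW vu))// ?leeD2l//.
rewrite mulrC -(@integral_itv_cst v u c false false (ltW vu)).
apply: ge0_le_integral => //=; first exact: mputG.
move=> x; rewrite in_itv/= => /andP[vx xu]; rewrite lee_fin /c.
have := @quantile_antitone _ mu x u (le_lt_trans v0 vx) xu u1.
rewrite -/(G u) -/(G x) => Gxu.
by rewrite ge_max !le_max lexx orbT andbT; apply/orP; left; lra.
Qed.

(** Levels t > u have G_t <= G_u and do not contribute to a call struck at G_u. *)
Lemma call_right_part_eq u : 0 < u < 1 ->
  call_fun mu (G u) = call_fun (rp u) (G u).
Proof.
move=> /andP[u0 u1].
have -> : call_fun mu (G u) = call_fun (rp 1) (G u).
  by rewrite /call_fun /Rintegral; congr fine;
    apply: eq_measure_integral => A mA _; rewrite right_part1.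
apply: EFin_inj; rewrite !call_rpE ?(ltW u1)//.
have f0 t : (0 <= (Num.max (G t - G u) 0)%:E)%E by rewrite lee_fin le_max lexx
  orbT.
rewrite (split_integral (ltW u0) (ltW u1))//.
rewrite -(integral_itv_bndo_bndc _ (a := BRight u)); last exact: mcallG.
rewrite [X in (_ + X)%E](eq_integral (cst 0%E)) ?integral0 ?adde0// => x.
rewrite inE/= in_itv/= => /andP[ux x1]; congr EFin; apply/max_idPr.
by rewrite subr_le0; apply: quantile_antitone => //; exact: ltW.
Qed.

Let M0 := \int[nu]_x `|x| + `|\int[mu]_x x|.

(** For k >= 0 both puts equal k up to a constant, as the masses agree; for k < 0 one has P_nu(k) <=
    P_nu(0). *)
Lemma putB_bounded k : put_fun nu k - put_fun mu k <= M0.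
Proof.
have mean0 : 0 <= `|\int[mu]_x x| by exact: normr_ge0.
have h2 := ler_norm (\int[mu]_x x).
have [k0|k0] := leP 0 k.
  have := put_fun_le nuM k0; have := put_fun_ge k muM; rewrite !fine1 /M0; lra.
have := put_fun_nd nuM (ltW k0); have := put_fun_le nuM (lexx 0).
have := put_fun_ge0 mu k; rewrite mul0r /M0; lra.
Qed.

Section level.
Variable u : R.
Hypothesis u01 : 0 < u < 1.
Let u01' : 0 <= u <= 1. Proof. by move: u01 => /andP[/ltW -> /ltW ->]. Qed.
Let u1 : u <= 1. Proof. by case/andP: u01'. Qed.
Let u0 : 0 <= u. Proof. by case/andP: u01'. Qed.
Let E := E_fun mu nu u.

(** The constant is 1 from P_nu, u from P_{mu_u} and 1 - u from the affine part. *)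
Let EK a b : `|E a - E b| <= 2 * `|a - b|.
Proof.
rewrite /E !E_funE//.
have := put_fun_lip a b nuM; have := put_fun_lip a b (rpM u1).
rewrite right_part_mass// fine1 /= mul1r => h1 h2.
have -> : put_fun nu a - put_fun (rp u) a + (c0 u - (1 - u) * a) -
   (put_fun nu b - put_fun (rp u) b + (c0 u - (1 - u) * b)) =
   (put_fun nu a - put_fun nu b) - (put_fun (rp u) a - put_fun (rp u) b) -
     (1 - u) * (a - b) by ring.
apply: le_trans (ler_normB _ _) _;
  apply: le_trans (lerD (ler_normB _ _) (lexx _)) _.
rewrite normrM (ger0_norm (_ : 0 <= 1 - u)) ?subr_ge0//; lra.
Qed.

Let E0 k : 0 <= E k.
Proof.
rewrite /E /E_fun; have := put_mu_le_nu k.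
by have := call_fun_le_measure k muM (right_part_le_mu mu u1); lra.
Qed.

Let EM k : G u <= k -> E k <= M0 + call_fun mu (G u).
Proof.
move=> Gk; rewrite /E /E_fun; have := putB_bounded k.
have := call_fun_ge0 (rp u) k.
have : call_fun mu k <= call_fun mu (G u).
  apply: le_int1; [exact: int1_call|exact: int1_call|] => x.
  by rewrite ge_max !le_max lexx orbT andbT; apply/orP; left; lra.
lra.
Qed.

Let w0 : 0 < 1 - u. Proof. by case/andP: u01; rewrite subr_gt0. Qed.

Let AE k : c0 u - (1 - u) * k <= E k.
Proof.
rewrite /E E_funE// lerDr subr_ge0.
exact: le_trans (put_right_part_le k u1) (put_mu_le_nu k).
Qed.

(** At G_u the calls of mu and mu_u cancel, so the affine part of E_u equals P_{mu_u} - P_mu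
    there. *)
Let Ax : c0 u - (1 - u) * G u <= 0.
Proof.
have := E_funE (G u) u01'; rewrite /E_fun -(call_right_part_eq u01).
have := put_right_part_le (G u) u1; lra.
Qed.

Let EA (e : R) : 0 < e -> exists k0, forall k, k <= k0 ->
  E k - (c0 u - (1 - u) * k) < e.
Proof.
move=> /(put_fun_cvg0 nuM)[k0 Hk0]; exists k0 => k /Hk0.
rewrite /E E_funE//; have := put_fun_ge0 (rp u) k; lra.
Qed.

Definition put_RS k := put_chi (G u) (R_fun mu nu u) (S_fun mu nu u) k.

Lemma RS_spec :
  [\/ exists r s, [/\ R_fun mu nu u = r%:E, S_fun mu nu u = s%:E & r <= G u <=
    s],
      R_fun mu nu u = -oo%E /\ S_fun mu nu u = (G u)%:E
    | exists r, [/\ R_fun mu nu u = r%:E, S_fun mu nu u = +oo%E & r <= G u]].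
Proof.
have [[r [s [h1 h2 h3 _ _]]]|[h1 h2 _]|[r [h1 h2 h3 _ _]]] :=
  endpoints_spec EK E0 w0 AE Ax EA.
- by apply: Or31; exists r, s.
- exact: Or32.
- by apply: Or33; exists r.
Qed.

(* The convex hull of P_nu - P_{mu_u}, which differs from E_u by an affine
   function. *)
Definition hull_at k := convex_hull E k - (c0 u - (1 - u) * k).

Let Emin : exists2 g0, cvx g0 & forall k, g0 k <= E k.
Proof.
by exists (fun k => 0 + 0 * k); [exact: cvx_affine|move=> k;
  rewrite mul0r addr0].
Qed.

Lemma hull_at_cvx : cvx hull_at.
Proof.
have := cvxD (cvx_convex_hull Emin) (cvx_affine (- c0 u) (1 - u)).
by move=> H a m b amb; have := H a m b amb; rewrite /hull_at; lra.
Qed.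

Lemma hull_at_le k : hull_at k <= put_fun nu k - put_fun (rp u) k.
Proof.
by rewrite /hull_at; have := convex_hull_le Emin k; rewrite {2}/E E_funE//; lra.
Qed.

(** [minorant_le_put_chi] with de = v - u, where [put_right_part_incr] replaces P_{mu_v} by P_{mu_u}
    + (v - u) (. - G_u)^+. Allowing v = 0 anchors the later integration. *)
Lemma hull_at_supergradient v g k : 0 <= v <= 1 -> cvx g ->
  (forall y, g y <= put_fun nu y - put_fun (rp v) y) ->
  g k <= hull_at k - (v - u) * put_RS k.
Proof.
move=> v01 cg gE; pose g' y := g y + (c0 u + (- (1 - u)) * y).
have cg' : cvx g' := cvxD cg (cvx_affine _ _).
have := @minorant_le_put_chi _ E (G u) 2 _ (1 - u) (c0 u) EK E0 EM w0 AE Ax EA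
  g' (v - u) cg' _ k.
rewrite /hull_at /put_RS /R_fun /S_fun /L_fun -/E -/(G u) /g' /= => H.
suff : g k + (c0 u + - (1 - u) * k) <= convex_hull E k - (v - u) * put_chi (G u)
     (R_fun mu nu u) (S_fun mu nu u) k by rewrite /R_fun /S_fun /L_fun; lra.
apply: H => y; rewrite /E E_funE//.
have := put_right_part_incr y u01 v01; have := gE y; lra.
Qed.

End level.
End hull_flow.

(** * Kernels and mixtures *)

Section kernels.
Local Open Scope ereal_scope.

Section kernel_of.
Context d d' (X : measurableType d) (Y : measurableType d') (R : realType).
Variable k : X -> {measure set Y -> \bar R}.

(** The proofs are phantom arguments, so that the structure instances below can be attached to the
    term. *)
Definition kernel_of
    (mk : forall U, measurable U -> measurable_fun [set: X] (k ^~ U))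
    (k1 : forall x, k x setT = 1) : X -> {measure set Y -> \bar R} := k.

Hypotheses (mk : forall U, measurable U -> measurable_fun [set: X] (k ^~ U))
  (k1 : forall x, k x setT = 1).

HB.instance Definition _ := isKernel.Build _ _ X Y R (kernel_of mk k1) mk.
HB.instance Definition _ :=
  Kernel_isProbability.Build _ _ X Y R (kernel_of mk k1) k1.

End kernel_of.

Section kcst.
Context d (X : measurableType d) (R : realType) (m : {measure set X -> \bar R}).

(** A finite measure seen as a kernel from [unit]: a mixture is then a composition of kernels and
    inherits its integral formula. *)
Definition kcst (my : m setT < +oo) (_ : unit) : {measure set X -> \bar R} := m.

Hypothesis my : m setT < +oo.

Let mkcst U : measurable U -> measurable_fun [set: unit] (kcst my ^~ U).
Proof. by move=> _; exact: measurable_cst. Qed.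

HB.instance Definition _ := isKernel.Build _ _ unit X R (kcst my) mkcst.

Let kcst_uub : measure_fam_uub (kcst my).
Proof.
exists (fine (m setT) + 1)%R => x; rewrite /kcst EFinD fineK ?ge0_fin_numE//.
by rewrite lteDl ?ge0_fin_numE// lte_fin ltr01.
Qed.

HB.instance Definition _ :=
  Kernel_isFinite.Build _ _ unit X R (kcst my) kcst_uub.

End kcst.

Section mixture.
Context d d' (X : measurableType d) (Y : measurableType d') (R : realType).
Variables (m : {measure set X -> \bar R}) (my : m setT < +oo) (k :
  R.-pker X ~> Y).

Let ksnd (z : unit * X) : {measure set Y -> \bar R} := k z.2.

Let mksnd U : measurable U -> measurable_fun [set: unit * X] (ksnd ^~ U).
Proof. by move=> mU; apply: (measurableT_comp (measurable_kernel k U mU)). Qed.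

Let ksnd1 z : ksnd z setT = 1. Proof. exact: prob_kernel. Qed.

Definition mixture : {measure set Y -> \bar R} :=
  kcomp (kcst my) (kernel_of mksnd ksnd1) tt.

Lemma mixtureE B : mixture B = \int[m]_x k x B.
Proof. by []. Qed.

Lemma ge0_integral_mixture (f : Y -> \bar R) : (forall y, 0 <= f y) ->
  measurable_fun [set: Y] f -> \int[mixture]_y f y = \int[m]_x \int[k x]_y f y.
Proof. by move=> f0 mf; rewrite integral_kcomp. Qed.

Lemma mixtureT : mixture setT = m setT.
Proof.
rewrite mixtureE; under eq_integral do rewrite prob_kernel.
by rewrite integral_cst// mul1e.
Qed.

End mixture.

Section semidirect.
Context d d' (X : measurableType d) (Y : measurableType d') (R : realType).
Variables (m : {measure set X -> \bar R}) (my : m setT < +oo) (k :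
  R.-pker X ~> Y).

Let mpair (x : X) : measurable_fun [set: Y] (fun y : Y => (x, y)).
Proof. exact: measurable_fun_pair. Qed.

Let kgraph (x : X) : {measure set (X * Y) -> \bar R} :=
  image_measure (k x) (mpair x).

Let kgraphE x A : kgraph x A = k x (xsection A x).
Proof. by rewrite xsectionE. Qed.

Let mkgraph U : measurable U -> measurable_fun [set: X] (kgraph ^~ U).
Proof.
move=> mU; rewrite (_ : (fun x => kgraph x U) = fun x => k x (xsection U x));
  last first.
  by apply/funext => x; exact: kgraphE.
by apply: measurable_fun_xsection_finite_kernel; rewrite inE.
Qed.

Let kgraph1 x : kgraph x setT = 1.
Proof. by rewrite kgraphE xsectionE preimage_setT prob_kernel. Qed.

Definition semidirect : {measure set (X * Y) -> \bar R} :=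
  mixture my (kernel_of mkgraph kgraph1).

Lemma semidirectE A : semidirect A = \int[m]_x k x (xsection A x).
Proof. by apply: eq_integral => x _; exact: kgraphE. Qed.

Lemma measurable_kernel_xsection A : measurable A ->
  measurable_fun [set: X] (fun x => k x (xsection A x)).
Proof.
by move=> mA; apply: measurable_fun_xsection_finite_kernel; rewrite inE.
Qed.

Lemma semidirectX A B : measurable A -> measurable B ->
  semidirect (A `*` B) = \int[m]_(x in A) k x B.
Proof.
move=> mA mB; rewrite semidirectE [RHS]integral_mkcond.
apply: eq_integral => x _; rewrite patchE.
case: ifPn => xA; first by rewrite in_xsectionX.
by rewrite notin_xsectionX ?measure0.
Qed.

End semidirect.

End kernels.

(** * Measurability of kernels from their put functions *)

Section kernel_of_puts.
Context d (X : measurableType d) (R : realType)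
  (k : X -> {measure set (measurableTypeR R) -> \bar R}).
Hypothesis kM : forall x, measM (k x).
Hypothesis k1 : forall x, k x setT = 1%E.
Hypothesis mput : forall y, measurable_fun [set: X] (fun x => put_fun (k x) y).

Lemma measurable_ray_of_put (y : R) :
  measurable_fun [set: X] (fun x => k x `]-oo, y]%classic).
Proof.
pose f (n : nat) x :=
  (n.+1%:R * (put_fun (k x) (y + n.+1%:R^-1) - put_fun (k x) y))%:E.
apply: (emeasurable_fun_cvg f).
  move=> n; apply/measurable_EFinP; apply: measurable_funM => //.
  exact: measurable_funB.
move=> x _; have cv := @ray_right_cvg _ (k x) y (kM x).
apply: (squeeze_cvge _ (@cvg_cst _ _ _ _ _) cv); apply: nearW => n.
have d0 : 0 < n.+1%:R^-1 :> R by rewrite invr_gt0.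
have [h1 h2] := put_fun_ray_bounds y (kM x) d0.
have e : (n.+1%:R^-1%:E * n.+1%:R%:E = 1 :> \bar R)%E.
  by rewrite -EFinM mulVf// pnatr_eq0.
rewrite /f EFinM muleC; apply/andP; split.
  have := lee_wpmul2r (_ : (0 <= n.+1%:R%:E :> \bar R)%E) h1.
  by rewrite -muleA e mule1; apply; rewrite lee_fin.
have := lee_wpmul2r (_ : (0 <= n.+1%:R%:E :> \bar R)%E) h2.
by rewrite -muleA e mule1; apply; rewrite lee_fin.
Qed.

Lemma measurable_of_put B : measurable B -> measurable_fun [set: X] (k ^~ B).
Proof.
have kfin x (A : set (measurableTypeR R)) : measurable A -> k x A \is a fin_num.
  move=> mA; rewrite ge0_fin_numE//;
    apply: le_lt_trans (_ : (k x setT < +oo)%E).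
    by apply: le_measure; rewrite ?inE.
  by rewrite k1 ltry.
have mC A : measurable A -> measurable_fun [set: X] (k ^~ A) ->
  measurable_fun [set: X] (k ^~ (~` A)).
  move=> mA mkA; rewrite (_ : (fun x => k x (~` A)) = fun x => (1 - k x A)%E);
    first exact: emeasurable_funB.
  apply/funext => x; rewrite -setTD measureD// ?setTI; first by congr (_ - _)%E;
    exact: k1.
  by apply: le_lt_trans (ltry 1); rewrite le_eqVlt; apply/orP; left; apply/eqP;
    exact: k1.
pose G := @RGenOInfty.G R.
have mE : @measurable _ (measurableTypeR R) =
  <<s G >> by exact: RGenOInfty.measurableE.
move=> mB; rewrite mE in mB; move: B mB.
apply: (@dynkin_induction _ (measurableTypeR R) G (fun B =>
  measurable_fun [set: X] (k ^~ B))).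
- exact: mE.
- move=> _ _ [x ->] [y ->]; exists (Num.max x y).
  apply/seteqP; split => z /=; rewrite !in_itv/= !andbT gt_max.
    by case=> -> ->.
  by move=> /andP[].
- by under eq_fun do rewrite k1; exact: measurable_cst.
- move=> _ [y ->]; rewrite -setCitvl/=; apply: mC => //.
  exact: measurable_ray_of_put.
- exact: mC.
- move=> F mF tF HF; rewrite (_ : (fun x => k x (\bigcup_n F n)) = fun x =>
    (\sum_(n <oo) k x (F n))%E).
    by apply: ge0_emeasurable_sum => // n x _ _.
  by apply/funext => x; apply/esym/cvg_lim => //;
    apply: measure_semi_sigma_additive => //; exact: bigcupT_measurable.
Qed.

End kernel_of_puts.

(** * Two-point measures and the kernel chi *)

Section two_point.
Context (R : realType).

Definition two_point (p q : {nonneg R}) (a b : R) :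
  {measure set (measurableTypeR R) -> \bar R} :=
  measure_add (mscale p (dirac (a : measurableTypeR R))) (mscale q (dirac (b :
    measurableTypeR R))).

Variables (p q : {nonneg R}) (a b : R).
Hypothesis pq : p%:num + q%:num = 1.
Let m := two_point p q a b.

Lemma two_pointE (B : set (measurableTypeR R)) :
  (m B = p%:num%:E * \d_(a : measurableTypeR R) B + q%:num%:E *
    \d_(b : measurableTypeR R) B)%E.
Proof. exact: measure_addE. Qed.

Lemma two_pointT : m setT = 1%E.
Proof. by rewrite two_pointE !diracT !mule1 -EFinD pq. Qed.

Lemma ge0_integral_two_point (f : R -> R) : measurable_fun [set: R] f ->
  (forall x, 0 <= f x) ->
  (\int[m]_y (f y)%:E = (p%:num * f a + q%:num * f b)%:E)%E.
Proof.
move=> mf f0; have mf' : measurable_fun [set: measurableTypeR R]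
  (EFin \o f) by exact/measurable_EFinP.
have f0' (x : measurableTypeR R) : [set: measurableTypeR R] x ->
  (0 <= (f x)%:E)%E.
  by move=> _; rewrite lee_fin.
rewrite ge0_integral_measure_add//=.
have D c : (\int[\d_(c : measurableTypeR R)]_x (f x)%:E = (f c)%:E)%E.
  by have := integral_dirac c measurableT mf'; rewrite diracT mul1e.
rewrite (ge0_integral_mscale _ measurableT p mf' f0') (ge0_integral_mscale _
  measurableT q mf' f0').
by rewrite !D -!EFinM -EFinD.
Qed.

Lemma two_point_int1 f : measurable_fun [set: R] f -> int1 m f.
Proof.
move=> mf; apply/integrableP; split; first exact/measurable_EFinP.
under eq_integral do rewrite /=.
rewrite (ge0_integral_two_point (f := fun x => `|f x|))//;
  first by rewrite ltry.
exact: measurableT_comp.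
Qed.

Lemma two_point_measM : measM m.
Proof. by split; [rewrite two_pointT ltry|exact: two_point_int1]. Qed.

Lemma integral_two_point (f : R -> R) : measurable_fun [set: R] f ->
  (\int[m]_y (f y)%:E = (p%:num * f a + q%:num * f b)%:E)%E.
Proof.
move=> mf.
have -> : (\int[m]_y (f y)%:E = \int[m]_y (`|f y|%:E - (`|f y| - f y)%:E))%E.
  by apply: eq_integral => y _; rewrite -EFinB; congr EFin; ring.
have mn : measurable_fun [set: R] (fun y => `|f y|) by exact: measurableT_comp.
have mb : measurable_fun [set: R] (fun y =>
  `|f y| - f y) by exact: measurable_funB.
rewrite integralB//; [|exact: (two_point_int1 mn)|exact: (two_point_int1 mb)].
rewrite (ge0_integral_two_point mn)// (ge0_integral_two_point mb)//.
  by rewrite -EFinB; congr EFin; ring.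
by move=> x; rewrite subr_ge0 ler_norm.
Qed.

Lemma put_fun_two_point k :
  put_fun m k = p%:num * Num.max (k - a) 0 + q%:num * Num.max (k - b) 0.
Proof.
rewrite /put_fun /Rintegral (integral_two_point (f :=
  fun x => Num.max (k - x) 0))//.
have := measurable_max_affine k (-1 : R); congr measurable_fun.
by apply/funext => x; rewrite mulN1r.
Qed.

End two_point.

(** All cases of [chi] in one form. The mean is x except for S = +oo, where it is r <= x. *)
Lemma chi_two_point (R : realType) (c d : \bar R) (x : R) :
  [\/ exists r s, [/\ c = r%:E, d = s%:E & r <= x <= s],
      c = -oo%E /\ d = x%:E
    | exists r, [/\ c = r%:E, d = +oo%E & r <= x]] ->
  exists p q : {nonneg R}, exists a b : R,
   [/\ p%:num + q%:num = 1, forall B, chi c x d B = two_point p q a b B,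
       p%:num * a + q%:num * b <= x &
       forall k, put_chi x c d k = p%:num * Num.max (k - a) 0 + q%:num *
         Num.max (k - b) 0].
Proof.
have single a (P : (set (measurableTypeR R) -> \bar R)) (Q : R -> R) : a <= x ->
    (forall B, P B = \d_(a : measurableTypeR R) B) ->
      (forall k, Q k = Num.max (k - a) 0) ->
    exists p q : {nonneg R}, exists a b : R,
   [/\ p%:num + q%:num = 1, forall B, P B = two_point p q a b B,
       p%:num * a + q%:num * b <= x &
       forall k, Q k = p%:num * Num.max (k - a) 0 + q%:num * Num.max (k - b) 0].
  move=> ax PE QE; exists 1%:nng, 0%:nng, a, a; split => /=;
    first by rewrite addr0.
  - by move=> B; rewrite two_pointE PE/= mul1e mul0e adde0.
  - by rewrite mul1r mul0r addr0.
  - by move=> k; rewrite QE mul1r mul0r addr0.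
case=> [[r [s [-> -> rxs]]]|[-> ->]|[r [-> -> rx]]]; last 2 first.
- exact: (single x _ _ (lexx x)).
- exact: (single r).
have [rs|rs] := eqVneq r s.
  by apply: (single x) => //= y; rewrite rs eqxx.
have rs0 : 0 < s - r by rewrite subr_gt0 lt_neqAle rs; lra.
have p0 : 0 <= (s - x) / (s - r) by rewrite divr_ge0//; lra.
have q0 : 0 <= (x - r) / (s - r) by rewrite divr_ge0//; lra.
exists (NngNum p0), (NngNum q0), r, s; split => /=.
- by field; lra.
- by move=> B; rewrite two_pointE/= (negbTE rs).
- by rewrite le_eqVlt; apply/orP; left; apply/eqP; field; lra.
- by move=> k; rewrite (negbTE rs).
Qed.

(** * Shadows of the right-most parts *)

Section levels.
Context (R : realType).

(** Levels increasing to 1; the shift by 2 makes even the first one interior. *)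
Definition level (n : nat) : R := 1 - n.+2%:R^-1.

Lemma level01 n : 0 < level n < 1.
Proof.
have n2 : 1 < n.+2%:R :> R by rewrite ltr1n.
by rewrite /level subr_gt0 invf_lt1 ?(lt_trans ltr01)// n2 gtrBl invr_gt0
  (lt_trans ltr01).
Qed.

Lemma integral_level_cvg (f : R -> \bar R) : measurable_fun [set: R] f ->
  (forall x, 0 <= f x)%E ->
  (\int[lebesgue_measure]_(t in `[0%R, level n]) f t)%E @[n --> \oo] -->
  (\int[lebesgue_measure]_(t in `[0%R, 1%R]) f t)%E.
Proof.
move=> mf f0.
rewrite -(@integral_itv_bndo_bndc _ (BLeft 0) 1 f);
  last exact: measurable_funTS.
have -> : `[0%R, 1%R[%classic = \bigcup_n `[0, level n]%classic :> set R.
  apply/seteqP; split => x /=; rewrite ?in_itv/=.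
    move=> /andP[x0 x1]; exists (Num.truncn (1 - x)^-1) => //=.
    rewrite in_itv/= x0 /level /= lerBrDr -lerBrDl -[leRHS]invrK.
    have x1' : 0 < 1 - x by rewrite subr_gt0.
    rewrite lef_pV2 ?posrE ?invr_gt0// ltW//.
    by apply: lt_trans (truncnS_gt _) _; rewrite ltr_nat.
  move=> [n _ /=]; rewrite in_itv/= => /andP[-> xn]; apply: le_lt_trans xn _.
  by case/andP: (level01 n).
apply: ge0_nondecreasing_set_cvg_integral => //.
- move=> a b ab; apply/subsetPset => x /=;
    rewrite !in_itv/= => /andP[-> /le_trans]; apply.
  by rewrite lerB// lef_pV2 ?posrE ?ltr0n// ler_nat.
- by move=> n; exact: measurable_funTS.
Qed.

End levels.

Section shadow.
Context (R : realType) (mu nu : probability (measurableTypeR R) R).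
Hypotheses (mu1 : first_moment mu) (nu1 : first_moment nu) (munu : cd_le mu nu).
Implicit Types (u v k : R).
Let G u := quantile mu (1 - u).
Local Notation rp := (right_part mu).
Let muM : measM mu := probability_measM mu1.
Let nuM : measM nu := probability_measM nu1.
Local Notation hull := (hull_at mu nu).
Local Notation pRS := (put_RS mu nu).

Let put_rp0 u y : 0 <= u <= 1 -> 0 <= put_fun nu y - put_fun (rp u) y.
Proof.
move=> /andP[u0 u1]; rewrite subr_ge0.
by apply: le_trans (put_mu_le_nu mu1 nu1 munu y); exact: put_right_part_le.
Qed.

(** The case v = u of the supergradient inequality. *)
Let hull_max u g k : 0 < u < 1 -> cvx g ->
  (forall y, g y <= put_fun nu y - put_fun (rp u) y) -> g k <= hull u k.
Proof.
move=> u01 cg gE; have u01' : 0 <= u <= 1 by lra.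
have := hull_at_supergradient mu1 nu1 munu u01 k u01' cg gE.
by rewrite subrr mul0r subr0.
Qed.

Let hull_ge0 u k : 0 < u < 1 -> 0 <= hull u k.
Proof.
move=> u01; have := @hull_max u (fun k => 0 + 0 * k) k u01 (cvx_affine _ _).
by rewrite mul0r addr0; apply => y; rewrite mul0r addr0 put_rp0//; lra.
Qed.

Let hull_incr u v k : 0 < u < 1 -> 0 < v < 1 ->
  hull v k - hull u k <= - pRS u k * (v - u).
Proof.
move=> u01 v01; have v01' : 0 <= v <= 1 by lra.
have := hull_at_supergradient mu1 nu1 munu u01 k v01' (hull_at_cvx mu1 nu1 munu
  v01)
  (hull_at_le mu1 nu1 munu v01).
lra.
Qed.

(** Adding the supergradient inequalities at u and at v gives the monotonicity from which the kernel
    is measurable. *)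
Let pRS_nd k : {in `]0, 1[%classic &, nondecreasing_fun (pRS^~ k)}.
Proof.
move=> u v; rewrite !inE/= !in_itv/= => u01 v01;
  rewrite le_eqVlt => /predU1P[->//|uv].
have := hull_incr k u01 v01; have := hull_incr k v01 u01 => h1 h2.
have vu : 0 < v - u by lra.
rewrite -(ler_pM2r vu); lra.
Qed.

(** The measures are chosen level by level; [measurable_of_put] then needs only that their puts are
    measurable in u. *)
Lemma RS_kernel : exists K : R.-pker (measurableTypeR R) ~> (measurableTypeR R),
  [/\ forall u : R, 0 < u < 1 -> forall B, measurable B ->
       K u B = chi (R_fun mu nu u) (G u) (S_fun mu nu u) B,
      forall u, measM (K u),
      forall u k, 0 < u < 1 -> put_fun (K u) k = pRS u k &
      forall u, 0 < u < 1 -> \int[K u]_y y <= G u].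
Proof.
have H (u : measurableTypeR R) : exists m : {measure set (measurableTypeR R) ->
  \bar R},
  [/\ measM m, m setT = 1%E,
   (0 < (u : R) < 1 -> [/\ forall B, measurable B ->
     m B = chi (R_fun mu nu u) (G u) (S_fun mu nu u) B,
     forall k, put_fun m k = pRS u k & \int[m]_y y <= G u]) &
   (~~ (0 < (u : R) < 1) -> forall k, put_fun m k = Num.max k 0)].
  have [u01|u01] := boolP (0 < (u : R) < 1).
    have [p [q [a [b [pq chiE mean put]]]]] :=
      chi_two_point (RS_spec mu1 nu1 munu u01).
    exists (two_point p q a b); split => //;
      [exact: two_point_measM|exact: two_pointT|].
    move=> _; split => [B _|k|]; first by rewrite -chiE.
      by rewrite put_fun_two_point// -put.
    by rewrite /Rintegral (@integral_two_point R p q a b id).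
  (* Outside ]0, 1[ the kernel is the point mass at 0, so its puts do not depend on u there. *)
  have pq : (1%:nng : {nonneg R})%:num + (0%:nng : {nonneg R})%:num =
    1 by rewrite /= addr0.
  exists (two_point 1%:nng 0%:nng 0 0); split => //;
    [exact: two_point_measM|exact: two_pointT|].
  by move=> _ k; rewrite put_fun_two_point//= subr0 mul1r mul0r addr0.
have [k Hk] := choice H.
have kM x : measM (k x) by case: (Hk x).
have k1 x : k x setT = 1%E by case: (Hk x).
have mput y : measurable_fun [set: measurableTypeR R] (fun x =>
  put_fun (k x) y).
  rewrite -(setUv (`]0, 1[%classic : set R)); apply/measurable_funU => //;
    first exact: measurableC.
  split.
    apply: (eq_measurable_fun (pRS^~ y)); last first.
      apply: measurable_nondecreasing_in;
        [exact: interval_is_interval|exact: pRS_nd].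
    by move=> u; rewrite inE/= in_itv/= => u01; have [_ _ /(_ u01)[_ ->]] :=
      Hk u.
  apply: (eq_measurable_fun (cst (Num.max y 0))); last exact: measurable_cst.
  by move=> u; rewrite inE/= in_itv/= => /negP u01; have [_ _ _ ->] := Hk u.
exists (kernel_of (measurable_of_put kM k1 mput) k1); split.
- by move=> u u01; have [_ _ /(_ u01)[]] := Hk u.
- exact: kM.
- by move=> u y u01; have [_ _ /(_ u01)[_ ->]] := Hk u.
- by move=> u u01; have [_ _ /(_ u01)[]] := Hk u.
Qed.

Section theta.
Variable K : R.-pker (measurableTypeR R) ~> (measurableTypeR R).
Hypothesis KM : forall u, measM (K u).
Hypothesis Kput : forall u k, 0 < u < 1 -> put_fun (K u) k = pRS u k.
Hypothesis Kmean : forall u, 0 < u < 1 -> \int[K u]_y y <= G u.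

Lemma leb_fin u : (mrestr lebesgue_measure (measurable_itv `[0%R, u]) setT <
  +oo)%E.
Proof.
rewrite /= /mrestr setTI lebesgue_measure_itv/=; case: ifPn => _;
  last by rewrite ltry.
by rewrite -EFinB ltry.
Qed.

Definition theta u : {measure set (measurableTypeR R) -> \bar R} :=
  mixture (leb_fin u) K.

Lemma thetaE u B : measurable B ->
  theta u B = (\int[lebesgue_measure]_(t in `[0%R, u]) K t B)%E.
Proof.
by move=> mB; rewrite /theta mixtureE ge0_integral_mrestr//;
  exact: measurable_kernel.
Qed.

Lemma theta_mass u : 0 <= u -> theta u setT = u%:E.
Proof.
move=> u0; rewrite thetaE//; under eq_integral do rewrite prob_kernel.
rewrite integral_cst//= mul1e lebesgue_measure_itv/= lte_fin.
by move: u0; rewrite le_eqVlt => /predU1P[<-|->]; rewrite ?ltxx// oppr0 adde0.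
Qed.

Lemma theta_le u v : u <= v -> measure_le (theta u) (theta v).
Proof.
move=> uv B mB; rewrite !thetaE//; apply: ge0_subset_integral => //=.
- by apply: measurable_funTS; exact: measurable_kernel.
- by move=> x /=; rewrite !in_itv/= => /andP[->]/le_trans; apply.
Qed.

Lemma ge0_integral_theta u (f : R -> \bar R) : measurable_fun [set: R] f ->
  (forall y, 0 <= f y)%E ->
  (\int[theta u]_y f y = \int[lebesgue_measure]_(t in `[0%R, u]) \int[K t]_y f
    y)%E.
Proof.
move=> mf f0; rewrite ge0_integral_mixture// ge0_integral_mrestr//.
- by apply: measurable_fun_integral_kernel => // U mU;
    exact: (measurable_kernel K U mU).
- by move=> x; exact: integral_ge0.
Qed.

Let mputk k : measurable_fun [set: R] (fun y : R => (Num.max (k - y) 0)%:E).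
Proof. by have := int1_put k muM; apply: measurable_int. Qed.

Let put_rp_zero y : put_fun (rp 0) y = 0.
Proof.
rewrite /put_fun /Rintegral right_part_integral.
- by rewrite set_itv1 integral_set1.
- exact: mputk.
- by move=> x; rewrite lee_fin le_max lexx orbT.
Qed.

Let cvx_put_nu : cvx (put_fun nu).
Proof.
have n0 : measure_le (rp 0) nu.
  move=> A mA; have -> : rp 0 A = 0%E; last by [].
  apply/eqP; rewrite eq_le measure_ge0 andbT.
  apply: (@le_trans _ _ (rp 0 setT)); first by apply: le_measure; rewrite ?inE.
  by rewrite le_eqVlt; apply/orP; left; apply/eqP;
    exact: (right_part_mass mu (lexx 0)).
have := cvx_put_funB nuM n0.
by move=> H a m b amb; have := H a m b amb; rewrite !put_rp_zero !subr0.
Qed.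

Let Kputk t k : (\int[K t]_y (Num.max (k - y) 0)%:E = (put_fun (K t) k)%:E)%E.
Proof.
by rewrite fineK//; exact: (integrable_fin_num measurableT (int1_put k (KM t))).
Qed.

Let mKput k : measurable_fun [set: R] (fun t => (put_fun (K t) k)%:E).
Proof.
under eq_fun do rewrite -Kputk; apply: measurable_fun_integral_kernel => //.
- by move=> U mU; exact: (measurable_kernel K U mU).
- by move=> y; rewrite lee_fin le_max lexx orbT.
- exact: mputk.
Qed.

(** Stated for the extended integral because a first moment of [theta] u is not known yet. *)
Let int_put_theta u k : 0 <= u < 1 ->
  (\int[theta u]_y (Num.max (k - y) 0)%:E =
   (put_fun nu k - (if u == 0 then put_fun nu k else hull u k))%:E)%E.
Proof.
move=> u01; rewrite ge0_integral_theta//; last by move=> y;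
  rewrite lee_fin le_max lexx orbT.
under eq_integral do rewrite Kputk.
(* The hull estimates hold on ]0, 1[. At level 0, where mu_0 vanishes, the value P_nu and the slope
   0 continue them. *)
pose F v := if v == 0 then put_fun nu k else hull v k.
pose j v := if v == 0 then 0 else put_fun (K v) k.
have j0 v : 0 <= j v by rewrite /j; case: ifPn => // _; exact: put_fun_ge0.
have Fj v w : 0 <= v < 1 -> 0 <= w < 1 -> F w - F v <= - j v * (w - v).
  move=> v01 w01; rewrite /F /j.
  have [v0|v0] := eqVneq v 0; have [w0|w0] := eqVneq w 0;
    rewrite ?subrr ?oppr0 ?mul0r//.
  - have {}w01 : 0 < w < 1 by rewrite lt_neqAle eq_sym w0; lra.
    have := hull_at_le mu1 nu1 munu w01 k; have := put_fun_ge0 (rp w) k; lra.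
  - have {}v01 : 0 < v < 1 by rewrite lt_neqAle eq_sym v0; lra.
    have p0 : 0 <= (0 : R) <= 1 by rewrite lexx ler01.
    rewrite Kput// w0.
    suff : put_fun nu k <= hull v k - (0 - v) * pRS v k by lra.
    apply: (hull_at_supergradient mu1 nu1 munu v01 k p0).
      exact: cvx_put_nu.
    by move=> y; rewrite put_rp_zero subr0.
  - rewrite Kput; last by rewrite lt_neqAle eq_sym v0; lra.
    by apply: hull_incr; rewrite lt_neqAle eq_sym ?v0 ?w0; lra.
rewrite -/(F u); have -> : put_fun nu k = F 0 by rewrite /F eqxx.
rewrite -(integral_supergradient j0 Fj u01).
rewrite -integral_itv_obnd_cbnd; last exact: (measurable_funTS (mKput k)).
rewrite -[RHS]integral_itv_obnd_cbnd; last first.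
  apply: (eq_measurable_fun (fun t => (put_fun (K t) k)%:E));
    last exact: (measurable_funTS (mKput k)).
  by move=> t; rewrite inE/= in_itv/= => /andP[t0 _]; rewrite /j gt_eqF.
by apply: eq_integral => t; rewrite inE/= in_itv/= => /andP[t0 _];
  rewrite /j gt_eqF.
Qed.

Let put_ge0e k y : (0 <= (Num.max (k - y) 0)%:E :> \bar R)%E.
Proof. by rewrite lee_fin le_max lexx orbT. Qed.

Let int_theta_level (f : R -> \bar R) : measurable_fun [set: R] f ->
  (forall y, 0 <= f y)%E ->
  (\int[theta (level R n)]_y f y)%E @[n --> \oo] --> (\int[theta 1]_y f y)%E.
Proof.
move=> mf f0; rewrite ge0_integral_theta//.
under eq_fun do rewrite ge0_integral_theta//.
apply: integral_level_cvg; last by move=> x; exact: integral_ge0.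
by apply: measurable_fun_integral_kernel => // U mU;
  exact: (measurable_kernel K U mU).
Qed.

Let int_put_theta1_le k : (\int[theta 1]_y (Num.max (k - y) 0)%:E <=
  (put_fun nu k)%:E)%E.
Proof.
have cv := int_theta_level (mputk k) (put_ge0e k).
rewrite -(cvg_lim _ cv)//; apply: lime_le; first by apply/cvg_ex; eexists;
  exact: cv.
apply: nearW => n; have n01 := level01 R n; rewrite int_put_theta; last lra.
rewrite lee_fin gt_eqF; last by case/andP: n01.
by have := hull_ge0 k n01; lra.
Qed.

(** Since |y| = y + 2 (- y)^+, the absolute moment of K t is at most |G_t| + 2 P_{K t}(0). The first
    term is integrable by the moment of mu, and the puts integrate to at most P_nu(0). *)
Let theta1M : measM (theta 1).
Proof.
split; first by rewrite theta_mass// ltry.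
apply/integrableP; split; first by apply/measurable_EFinP; exact: measurable_id.
have mabs : measurable_fun [set: R] (fun y : R =>
  `|y%:E|%E) by exact: measurableT_comp.
rewrite ge0_integral_theta//.
have mKabs : measurable_fun [set: R] (fun t => \int[K t]_y `|y%:E|)%E.
  by apply: measurable_fun_integral_kernel => // U mU;
    exact: (measurable_kernel K U mU).
rewrite -integral_itv_bndo_bndc; last exact: (measurable_funTS mKabs).
rewrite -integral_itv_obnd_cbnd; last exact: (measurable_funTS mKabs).
have mG : measurable_fun [set: R] (fun t => `|(G t)%:E|)%E.
  by apply: measurableT_comp => //; apply/measurable_EFinP;
    exact: measurable_dquantile.
have mP : measurable_fun [set: R] (fun t => 2%:E * (put_fun (K t) 0)%:E)%E.
  by apply: measurable_funeM; exact: mKput.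
apply: (@le_lt_trans _ _ (\int[lebesgue_measure]_(t in `]0%R, 1%R[)
    (`|(G t)%:E| + 2%:E * (put_fun (K t) 0)%:E))%E).
  apply: ge0_le_integral => //=.
  - by move=> t _; apply: integral_ge0 => y _; rewrite lee_fin.
  - exact: (measurable_funTS mKabs).
  - exact: (measurable_funTS (emeasurable_funD mG mP)).
  - move=> t; rewrite in_itv/= => t01.
    have i1 := int1_id (KM t); have i2 := int1Z 2 (int1_put 0 (KM t)).
    have -> : (\int[K t]_y `|y%:E| =
      (\int[K t]_y (y + 2 * Num.max (0 - y) 0))%:E)%E.
      rewrite fineK; last exact: (integrable_fin_num measurableT (int1D i1 i2)).
      apply: eq_integral => y _; congr EFin; rewrite sub0r.
      have [h|h] := leP (- y) 0; first by rewrite ger0_norm; lra.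
      by rewrite ltr0_norm; lra.
    rewrite RintegralD// RintegralZl//; last exact: int1_put.
    rewrite -!EFinM -EFinD lee_fin lerD2r.
    by apply: le_trans (Kmean t01) _; exact: ler_norm.
rewrite ge0_integralD//=; [|exact: (measurable_funTS mG)|by move=> t _;
  rewrite -EFinM lee_fin mulr_ge0// put_fun_ge0|exact: (measurable_funTS mP)].
apply: lte_add_pinfty.
  apply: (@le_lt_trans _ _ (\int[lebesgue_measure]_(t in `[0%R, 1%R])
    `|(G t)%:E|)%E).
    apply: ge0_subset_integral => //=; first exact: (measurable_funTS mG).
    by move=> t /=; rewrite !in_itv/= => /andP[/ltW -> /ltW ->].
  rewrite -(@right_part_integral _ mu 1 (fun y => `|y%:E|%E))//.
  by have [_ /integrableP[]] := right_part_measM mu1 (lexx 1).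
rewrite ge0_integralZl//=; [|exact: (measurable_funTS (mKput 0))|by move=> t _;
  rewrite lee_fin put_fun_ge0].
apply: lte_mul_pinfty => //.
apply: (@le_lt_trans _ _ (\int[lebesgue_measure]_(t in `[0%R, 1%R])
  (put_fun (K t) 0)%:E)%E).
  apply: ge0_subset_integral => //=; first exact: (measurable_funTS (mKput 0)).
  - by move=> t _; rewrite lee_fin put_fun_ge0.
  - by move=> t /=; rewrite !in_itv/= => /andP[/ltW -> /ltW ->].
under eq_integral do rewrite -Kputk.
rewrite -(ge0_integral_theta 1 (mputk 0) (put_ge0e 0)).
exact: le_lt_trans (int_put_theta1_le 0) (ltry _).
Qed.

Let thetaM u : u <= 1 -> measM (theta u).
Proof. by move=> u1; apply: measM_le theta1M; exact: theta_le. Qed.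

Let put_thetaE u k : u <= 1 ->
  ((put_fun (theta u) k)%:E = \int[theta u]_y (Num.max (k - y) 0)%:E)%E.
Proof.
by move=> u1; rewrite fineK//;
  exact: (integrable_fin_num measurableT (int1_put k (thetaM u1))).
Qed.

Lemma put_theta u k : 0 < u < 1 -> put_fun (theta u) k = put_fun nu k -
  hull u k.
Proof.
move=> /andP[u0 u1]; apply: EFin_inj;
  rewrite put_thetaE ?(ltW u1)// int_put_theta; last lra.
by rewrite gt_eqF.
Qed.

Lemma put_theta0 k : put_fun (theta 0) k = 0.
Proof.
apply: EFin_inj; rewrite put_thetaE// int_put_theta ?lexx ?ltr01//.
by rewrite eqxx subrr.
Qed.

(* Bounded above convex functions are constant. *)
Let gap0 g k : cvx g -> (forall y, 0 <= g y) ->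
  (forall y, g y <= put_fun nu y - put_fun mu y) -> g k = 0.
Proof.
move=> cg g0 gle; apply/eqP; rewrite eq_le g0 andbT leNgt; apply/negP => gk.
have [k0 Hk0] := put_fun_cvg0 nuM gk.
pose y := Num.min k k0.
have yk : y <= k by rewrite /y ge_min lexx.
have yk0 : y <= k0 by rewrite /y ge_min lexx orbT.
have := @cvx_bounded_above_nonincreasing _ g 0 _ cg
  (fun z _ => le_trans (gle z) (putB_bounded mu1 nu1 z)) y k yk.
have := Hk0 _ yk0; have := gle y; have := put_fun_ge0 mu y; lra.
Qed.

(** The limit of the hulls is read off from the monotone limit of [theta]; no hull at level 1 is
    involved. *)
Let hull_cvg k : hull (level R n) k @[n --> \oo] -->
  put_fun nu k - put_fun (theta 1) k.
Proof.
rewrite (_ : (fun n => _) = fun n => put_fun nu k - put_fun (theta (level R n))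
  k); last first.
  by apply/funext => n; rewrite put_theta ?level01//; ring.
apply: cvgB; first exact: cvg_cst.
have := int_theta_level (mputk k) (put_ge0e k); rewrite -put_thetaE//.
by move=> /fine_cvgP[].
Qed.

Let put_rp_cvg k : put_fun (rp (level R n)) k @[n --> \oo] --> put_fun mu k.
Proof.
have -> : put_fun mu k = put_fun (rp 1) k.
  by rewrite /put_fun /Rintegral; congr fine;
    apply: eq_measure_integral => A mA _; rewrite right_part1.
have mpG : measurable_fun [set: R] (fun t => (Num.max (k - G t) 0)%:E).
  by apply: (measurableT_comp (mputk k)); exact: measurable_dquantile.
have := integral_level_cvg mpG (fun t => put_ge0e k (G t)).
rewrite -(right_part_integral mu 1 (mputk k) (put_ge0e k)).
have rpE u : u <= 1 ->
  (\int[rp u]_x (Num.max (k - x) 0)%:E = (put_fun (rp u) k)%:E)%E.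
  by move=> u1; rewrite fineK//;
    exact: (integrable_fin_num measurableT
    (int1_put k (right_part_measM mu1 u1))).
rewrite rpE// (_ : (fun n => _) = fun n => (put_fun (rp (level R n)) k)%:E).
  by move=> /fine_cvgP[].
apply/funext => n; rewrite -rpE;
  first by rewrite (right_part_integral _ _ (mputk k) (put_ge0e k)).
by have /andP[_ /ltW] := level01 R n.
Qed.

Lemma put_theta1 k : put_fun (theta 1) k = put_fun nu k.
Proof.
apply/esym/eqP; rewrite -subr_eq0; apply/eqP.
apply: (gap0 (g := fun k => put_fun nu k - put_fun (theta 1) k)).
- move=> a m b amb.
  have H c z : c * hull (level R n) z @[n --> \oo] -->
    c * (put_fun nu z - put_fun (theta 1) z).
    by apply: cvgMl_tmp; exact: hull_cvg.
  apply: ler_cvg_to (H (b - a) m) (cvgD (H (b - m) a) (H (m - a) b)) _.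
  by apply: nearW => n; apply: (hull_at_cvx mu1 nu1 munu (level01 R n)).
- move=> y /=; apply: (@ler_cvg_to _ _ _ _ (fun=> 0) _ 0 _ (cvg_cst _)
    (@hull_cvg y)).
  by apply: nearW => n; exact: hull_ge0 (level01 R n).
- move=> y /=; apply: ler_cvg_to (@hull_cvg y) (cvgB (cvg_cst (put_fun nu y))
    (@put_rp_cvg y)) _.
  by apply: nearW => n; apply: (hull_at_le mu1 nu1 munu (level01 R n)).
Qed.

Lemma theta1E A : measurable A -> theta 1 A = nu A.
Proof.
apply: put_fun_eq => //; last exact: put_theta1.
by apply: (etrans (theta_mass ler01)); apply/esym; exact: probability_setT.
Qed.

Lemma theta_le_nu u : u <= 1 -> measure_le (theta u) nu.
Proof. by move=> u1 A mA; have := theta_le u1 mA; rewrite theta1E. Qed.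

Lemma theta_shadow u : 0 <= u <= 1 -> is_shadow nu (rp u) (theta u).
Proof.
move=> /andP[u0 u1]; split; [exact: thetaM| |exact: theta_le_nu|].
  apply: put_le_cd_le; [exact: right_part_measM|exact: thetaM| |].
    by apply: (etrans (right_part_mass mu u0)); apply/esym; exact: theta_mass.
  move=> k; have [u00|un0] := eqVneq u 0;
    first by rewrite u00 put_rp_zero put_theta0.
  have [u11|un1] := eqVneq u 1.
    rewrite u11 put_theta1; apply: le_trans (put_mu_le_nu mu1 nu1 munu k).
    exact: put_right_part_le.
  have u01 : 0 < u < 1 by rewrite !lt_neqAle eq_sym un0 u0 un1 u1.
  by rewrite put_theta//; have := hull_at_le mu1 nu1 munu u01 k; lra.
move=> theta' M' cd' le'; apply: put_le_cd_le => //; first exact: thetaM.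
  rewrite -(cd_le_mass _ _ cd')//; last exact: right_part_measM.
  by apply: (etrans (theta_mass u0)); apply/esym; exact: right_part_mass.
have put' y : put_fun (rp u) y <= put_fun theta' y.
  by apply: cd_le_put_fun => //; exact: right_part_measM.
have cg := cvx_put_funB nuM le'.
move=> k; have [u00|un0] := eqVneq u 0;
  first by rewrite u00 put_theta0 put_fun_ge0.
(* At level 1 [gap0] takes the place of the hull: P_nu - P_theta' is convex, nonnegative and below
   P_nu - P_mu, hence zero. *)
have [u11|un1] := eqVneq u 1.
  rewrite u11 put_theta1.
  have := gap0 k cg; rewrite -subr_le0 => -> //.
    by move=> y; rewrite subr_ge0; exact: put_fun_le_measure.
  move=> y; have := put' y; rewrite u11.
  have -> : put_fun (rp 1) y = put_fun mu y.
    by rewrite /put_fun /Rintegral; congr fine;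
      apply: eq_measure_integral => A mA _; rewrite right_part1.
  lra.
have u01 : 0 < u < 1 by rewrite !lt_neqAle eq_sym un0 u0 un1 u1.
rewrite put_theta//; have := @hull_max u _ k u01 cg.
by move=> H; have := H (fun y => lerB (lexx _) (put' y)); lra.
Qed.

End theta.
End shadow.

(** * The lifted coupling *)

Lemma shadow_unique (R : realType)
    (nu eta th th' : {measure set (measurableTypeR R) -> \bar R}) :
  is_shadow nu eta th -> is_shadow nu eta th' ->
  forall A, measurable A -> th A = th' A.
Proof.
move=> [M cd le mi] [M' cd' le' mi'].
have h := mi _ M' cd' le'; have h' := mi' _ M cd le.
apply: put_fun_eq => //; first exact: cd_le_mass.
by move=> k; apply/eqP; rewrite eq_le !cd_le_put_fun.
Qed.

Lemma measure_eq_rect d d' (X : measurableType d) (Y : measurableType d')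
    (R : realType) (m1 m2 : {measure set (X * Y) -> \bar R}) :
  (m1 setT < +oo)%E ->
  (forall A B, measurable A -> measurable B -> m1 (A `*` B) = m2 (A `*` B)) ->
  forall C, measurable C -> m1 C = m2 C.
Proof.
move=> m1y m12 C.
apply: (measure_unique [set A `*` B | A in measurable & B in measurable] (fun=>
  setT)).
- exact: measurable_prod_measurableType.
- move=> _ _ [A mA [B mB <-]] [A' mA' [B' mB' <-]].
  by rewrite -setXI; exists (A `&` A');
    [exact: measurableI|exists (B `&` B') => //; exact: measurableI].
- by move=> n; exists setT => //; exists setT => //; rewrite setXTT.
- by rewrite bigcup_const//; exists 0%N.
- by move=> _ [A mA [B mB <-]]; exact: m12.
- by [].
Qed.

Lemma measure_eq_mod_null d (T : measurableType d) (R : realType)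
    (m : {measure set T -> \bar R}) (A B N : set T) :
  measurable A -> measurable B -> measurable N -> m N = 0%E ->
  A `<=` B `|` N -> B `<=` A `|` N -> m A = m B.
Proof.
move=> mA mB mN N0 AB BA; have le0 : (m N <= 0)%E by rewrite N0.
apply/eqP; rewrite eq_le; apply/andP; split.
  apply: (@le_trans _ _ (m (B `|` N))).
    by apply: le_measure; rewrite ?inE//; exact: measurableU.
  by apply: le_trans (measureU2 _ _ _) _ => //;
    apply: le_trans (leeD2l _ le0) _; rewrite adde0.
apply: (@le_trans _ _ (m (A `|` N))).
  by apply: le_measure; rewrite ?inE//; exact: measurableU.
by apply: le_trans (measureU2 _ _ _) _ => //; apply: le_trans (leeD2l _ le0) _;
  rewrite adde0.
Qed.

Section lift.
Context (R : realType) (mu : probability (measurableTypeR R) R).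
Let G u := quantile mu (1 - u).
Let lift := decreasing_lift mu.
Let phi (t : R) : measurableTypeR R * measurableTypeR R := (t, G t).

Let mphi : measurable_fun [set: measurableTypeR R] phi.
Proof. exact: measurable_dlift. Qed.

Lemma decreasing_liftE D : measurable D ->
  lift D = lebesgue_measure (phi @^-1` D `&` `[0, 1]).
Proof. by []. Qed.

Lemma decreasing_lift_fin : (lift setT < +oo)%E.
Proof.
rewrite decreasing_liftE// preimage_setT setTI lebesgue_measure_itv/= lte_fin
  ltr01.
by rewrite -EFinB ltry.
Qed.

Lemma decreasing_lift_integral D (f : measurableTypeR R * measurableTypeR R ->
  \bar R) :
  measurable D -> measurable_fun setT f -> (forall z, 0 <= f z)%E ->
  (\int[lift]_(z in D) f z =
   \int[lebesgue_measure]_(t in `[0%R, 1%R] `&` phi @^-1` D) f (t, G t))%E.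
Proof.
move=> mD mf f0; rewrite integral_mkcond integral_mkcondr.
have mf' : measurable_fun setT (f \_ D) by apply/(measurable_restrictT _ mD);
  exact: measurable_funTS.
have f0' z : (0 <= (f \_ D) z)%E by rewrite patchE; case: ifPn.
have E := @ge0_integral_pushforward _ _ _ _ R _ (measurable_dlift mu)
  (mrestr lebesgue_measure (measurable_itv `[0%R, 1%R])) setT (f \_ D)
    measurableT mf' (fun y _ => f0' y).
rewrite [LHS]E preimage_setT ge0_integral_mrestr//.
- exact: (measurableT_comp mf' mphi).
- by move=> x; exact: f0'.
Qed.

Let Gz (z : measurableTypeR R * measurableTypeR R) := z.2 - G z.1 : R.

Let mGz : measurable_fun setT Gz.
Proof.
apply: measurable_funB; first exact: measurable_snd.
exact: (measurableT_comp (measurable_dquantile mu) measurable_fst).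
Qed.

(** It also contains all points whose level is not in ]0, 1[, so that the results on interior levels
    apply everywhere off this null set. *)
Definition off_graph : set (measurableTypeR R * measurableTypeR R) :=
  ~` ((fst @^-1` `]0, 1[%classic) `&` (Gz @^-1` [set 0])).

Lemma measurable_off_graph : measurable off_graph.
Proof.
apply: measurableC; apply: measurableI.
  by rewrite -[X in measurable X]setTI; apply: measurable_fst.
by rewrite -[X in measurable X]setTI; apply: mGz.
Qed.

Lemma off_graphP z : ~ off_graph z <-> 0 < z.1 < 1 /\ z.2 = G z.1.
Proof.
rewrite /off_graph /= notK /Gz/= in_itv/=.
by split => -[-> /eqP]; rewrite ?subr_eq0 => /eqP //; split => //; apply/eqP;
  rewrite subr_eq0; apply/eqP.
Qed.

Lemma decreasing_lift_off_graph : lift off_graph = 0%E.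
Proof.
rewrite decreasing_liftE; last exact: measurable_off_graph.
apply/eqP; rewrite eq_le measure_ge0 andbT.
have leb01 : lebesgue_measure [set (0 : R); 1] = 0%E.
  by apply: countable_lebesgue_measure0; apply: finite_set_countable;
    exact: finite_set2.
apply: (@le_trans _ _ (lebesgue_measure [set (0 : R); 1])); last first.
  by rewrite le_eqVlt; apply/orP; left; apply/eqP; exact: leb01.
apply: le_measure; rewrite ?inE.
- apply: measurableI => //; rewrite -[X in measurable X]setTI;
    apply: mphi => //.
  exact: measurable_off_graph.
- exact: measurableU.
- move=> t [/= ot]; rewrite in_itv/= => /andP[t0 t1].
  apply: contrapT => /not_orP[/eqP tn0 /eqP tn1]; apply: ot; split => /=.
    by rewrite in_itv/= !lt_neqAle (eq_sym 0) tn0 tn1 t0 t1.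
  by rewrite /Gz/= subrr.
Qed.

End lift.

Section lifted.
Context (R : realType) (mu nu : probability (measurableTypeR R) R).
Let G u := quantile mu (1 - u).
Local Notation TR := (measurableTypeR R).
Local Notation lift := (decreasing_lift mu).
Local Notation rp := (right_part mu).

Lemma lifted_unique (pi pi' : {measure set (TR * TR * TR) -> \bar R}) :
  is_lifted_shadow_coupling mu nu pi -> is_lifted_shadow_coupling mu nu pi' ->
  forall A, measurable A -> pi A = pi' A.
Proof.
move=> [[[p1 p2] _] psh] [[[p1' p2'] _] psh'].
apply: measure_eq_rect.
  by rewrite -setXTT p1// decreasing_lift_fin.
move=> D B mD mB.
pose A1 : set TR := (fun t => (t, G t)) @^-1` D.
have mA1 : measurable A1.
  by rewrite -[A1]setTI; apply: (measurable_dlift mu).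
(* On the graph the position is a function of the level, so membership in D becomes a condition on
   the level alone. *)
have red (q : {measure set (TR * TR * TR) -> \bar R}) :
    (forall A, measurable A -> q (A `*` setT) = lift A) ->
    q (D `*` B) = q (A1 `*` setT `*` B).
  move=> q1; apply: (@measure_eq_mod_null _ _ _ q _ _ (off_graph mu `*` setT)).
  - exact: measurableX.
  - by apply: measurableX => //; exact: measurableX.
  - by apply: measurableX => //; exact: measurable_off_graph.
  - by rewrite q1; [exact: decreasing_lift_off_graph|exact:
      measurable_off_graph].
  - move=> [z y] [/= Dz By]; have [oz|/off_graphP[z1 z2]] :=
      pselect (off_graph mu z).
      by right; split.
    left; split => //; split => //=; move: Dz z2; rewrite /A1/= /G.
    by case: z {z1} => a b /= Dz <-.
  - move=> [z y] [[/= Az _] By]; have [oz|/off_graphP[z1 z2]] :=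
      pselect (off_graph mu z).
      by right; split.
    left; split => //=; move: Az z2; rewrite /A1/=.
    by case: z {z1} => a b /= Dz ->.
rewrite (red pi)// (red pi')//.
pose first : TR * TR * TR -> TR := fun w => w.1.1.
have mfirst : measurable_fun setT first by exact: measurableT_comp
  measurable_fst measurable_fst.
have mTB : measurable ([set: TR * TR] `*` B) by exact: measurableX.
pose al (q : {measure set (TR * TR * TR) -> \bar R}) :=
  image_measure (mrestr q mTB) mfirst.
have alE (q : {measure set (TR * TR * TR) -> \bar R}) A : al q A =
  q (A `*` setT `*` B).
  congr (q _); apply/seteqP; split => -[[a b] c] /=; rewrite /first/=.
    by move=> [? [_ ?]].
  by move=> [[? _] ?].
rewrite -!alE.
(* Shadows are prescribed for levels in [0, 1] only; cutting to this strip turns a ray ]-oo, x] of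
   levels into an interval [0, min x 1]. *)
have strip (q : {measure set (TR * TR * TR) -> \bar R}) A : measurable A ->
    (forall A, measurable A -> q (A `*` setT) = lift A) ->
    al q A = q ((A `&` `[0, 1]%classic) `*` setT `*` B).
  move=> mA q1; rewrite alE.
  apply: (@measure_eq_mod_null _ _ _ q _ _ (((~` `[0, 1]%classic) `*` setT) `*`
    setT)).
  - by apply: measurableX => //; exact: measurableX.
  - by apply: measurableX => //; apply: measurableX => //; exact: measurableI.
  - by apply: measurableX => //; apply: measurableX => //; exact: measurableC.
  - have mN : measurable ((~` `[0, 1]%classic) `*` setT : set (TR * TR)).
      by apply: measurableX => //; exact: measurableC.
    rewrite q1// decreasing_liftE// (_ : _ `&` _ = set0) ?measure0//.
    by apply/seteqP; split => t //= [[]].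
  - move=> [[a b] c] [[/= Aa _] Bc];
      have [oz|oz] := pselect ((`[0, 1]%classic : set R) a).
      by left.
    by right.
  - by move=> [[a b] c] [[/= [Aa _] _] Bc]; left.
have alfin : (al pi setT < +oo)%E.
  rewrite alE setXTT p2//; apply: le_lt_trans (_ : (1 < +oo)%E) => //;
    last by rewrite ltry.
  exact: probability_le1.
apply: measure_eq_lee => //; first by rewrite !alE setXTT p2// p2'.
move=> x; rewrite !strip//.
have [x0|x0] := ltP x 0.
  have -> : `]-oo, x]%classic `&` `[0, 1]%classic = set0 :> set R.
    by apply/seteqP; split => t //=; rewrite !in_itv/=; lra.
  by rewrite !set0X !measure0.
have -> : `]-oo, x]%classic `&` `[0, 1]%classic = `[0, Num.min x 1]%classic :>
  set R.
  apply/seteqP; split => t /=; rewrite !in_itv/= le_min;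
    first by move=> [-> /andP[-> ->]].
  by move=> /andP[-> /andP[-> ->]].
have m01 : 0 <= Num.min x 1 <= 1 by rewrite le_min x0 ler01 ge_min lexx orbT.
have [th [sh _ thE]] := psh _ m01; have [th' [sh' _ thE']] := psh' _ m01.
by rewrite thE// thE'//; exact: shadow_unique sh sh' _ _.
Qed.

Variable K : R.-pker TR ~> TR.

Let K1 (z : TR * TR) : {measure set TR -> \bar R} := K z.1.

Let mK1 U : measurable U -> measurable_fun [set: TR * TR] (K1 ^~ U).
Proof. by move=> mU; apply: (measurableT_comp (measurable_kernel K U mU)). Qed.

Let K1T z : K1 z setT = 1%E. Proof. exact: prob_kernel. Qed.

(** It ignores the position, which on the graph is determined by the level. *)
Definition lift_kernel : R.-pker (TR * TR) ~> TR := kernel_of mK1 K1T.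

Definition lifted_coupling : {measure set (TR * TR * TR) -> \bar R} :=
  semidirect (decreasing_lift_fin mu) lift_kernel.

Lemma lifted_couplingE A : measurable A ->
  lifted_coupling A = (\int[lebesgue_measure]_(u in `[0%R, 1%R])
     K u (xsection A (u, G u)))%E.
Proof.
move=> mA; rewrite /lifted_coupling semidirectE decreasing_lift_integral//.
- by rewrite preimage_setT setIT.
- exact: measurable_kernel_xsection.
Qed.

Lemma lifted_couplingX D B : measurable D -> measurable B ->
  lifted_coupling (D `*` B) =
  (\int[lebesgue_measure]_(t in `[0%R, 1%R] `&` (fun t => (t, G t)) @^-1` D) K t
    B)%E.
Proof.
move=> mD mB; rewrite /lifted_coupling semidirectX// decreasing_lift_integral//.
exact: mK1.
Qed.

Hypotheses (mu1 : first_moment mu) (nu1 : first_moment nu) (munu : cd_le mu nu).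
Hypothesis KM : forall u, measM (K u).
Hypothesis Kput : forall u k, 0 < u < 1 -> put_fun (K u) k = put_RS mu nu u k.
Hypothesis Kmean : forall u, 0 < u < 1 -> \int[K u]_y y <= G u.

Lemma lifted_couplingP : is_lifted_shadow_coupling mu nu lifted_coupling.
Proof.
have c1 A : measurable A -> lifted_coupling (A `*` setT) = lift A.
  move=> mA; rewrite /lifted_coupling semidirectX//.
  under eq_integral do rewrite prob_kernel.
  by rewrite integral_cst// mul1e.
split; first split.
- split => // B mB; rewrite lifted_couplingX// preimage_setT setIT.
  by rewrite -thetaE// (theta1E mu1 nu1 munu).
- exists lift_kernel; split; first by move=> A B mA mB; exact: semidirectX.
  exists (off_graph mu); split;
    [exact: measurable_off_graph|exact: decreasing_lift_off_graph|].
  move=> z /= nz; apply: contrapT => /off_graphP[z1 z2]; apply: nz.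
  rewrite z2 -[X in (X <= _)%E]fineK;
    last exact: (integrable_fin_num measurableT (int1_id (KM z.1))).
  by rewrite lee_fin; exact: Kmean.
- move=> u u01; exists (theta K u); split; first exact: theta_shadow.
  + move=> A mA; rewrite c1; last exact: measurableX.
    rewrite decreasing_liftE; last exact: measurableX.
    rewrite right_part_itv//; congr (lebesgue_measure _).
    apply/seteqP; split => t /=; rewrite !in_itv/=.
      by move=> [[-> ?] _].
    by move=> [? /andP[-> tu]]; rewrite tu; split => //; case/andP: u01 => _;
      exact: le_trans.
  + move=> B mB; rewrite lifted_couplingX//; last exact: measurableX.
    rewrite thetaE//; congr (integral _ _ _).
    apply/seteqP; split => t /=; rewrite !in_itv/=.
      by move=> [_ [? _]].
    by move=> /andP[-> tu]; rewrite tu; split => //; case/andP: u01 => _;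
      exact: le_trans.
Qed.

End lifted.

(** * The decreasing coupling *)

Section transform.
Context (R : realType) (mu : probability (measurableTypeR R) R).
Local Notation TR := (measurableTypeR R).
Let G u := quantile mu (1 - u).
Local Notation tl := (tail mu).
Local Notation ot := (otail mu).

(** Right continuity of x |-> mu ]x, oo[. *)
Lemma otail_le x w : (forall y, x < y -> tl y <= w) -> ot x <= w.
Proof.
move=> H.
have cv : mu `[(x + n.+1%:R^-1), +oo[%classic @[n --> \oo] -->
  mu `]x, +oo[%classic.
  have -> : `]x, +oo[%classic =
    \bigcup_n `[(x + n.+1%:R^-1)%R, +oo[%classic :> set TR.
    apply/seteqP; split => z /=; rewrite in_itv/= andbT.
      move=> xz; exists (Num.truncn (z - x)^-1) => //=;
        rewrite in_itv/= andbT -lerBrDl.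
      have zx : 0 < z - x by rewrite subr_gt0.
      by rewrite invf_ple ?posrE ?ltr0n// ltW// truncnS_gt.
    move=> [n _ /=]; rewrite in_itv/= andbT; apply: lt_le_trans.
    by rewrite ltrDl invr_gt0.
  apply: nondecreasing_cvg_mu => //; first exact: bigcupT_measurable.
  move=> a b ab; apply/subsetPset => y /=; rewrite !in_itv/= !andbT.
  by apply: le_trans; rewrite lerD2l lef_pV2 ?posrE ?ltr0n// ler_nat ltnS.
rewrite -lee_fin otailE -(cvg_lim _ cv)//; apply: lime_le.
  by apply/cvg_ex; eexists; exact: cv.
by apply: nearW => n; rewrite -tailE lee_fin H// ltrDl invr_gt0.
Qed.

Lemma otail_quantile w : 0 < w < 1 -> ot (G w) <= w.
Proof.
move=> w01; apply: otail_le => y Gy; rewrite leNgt; apply/negP => wy.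
by move: Gy; rewrite ltNge le_quantile// (ltW wy).
Qed.

Lemma tail_quantile w : 0 < w < 1 -> w <= tl (G w).
Proof. by move=> w01; rewrite -le_quantile. Qed.

(* x |-> [otail x, tail x] splits ]0, 1[ into the level sets of G. *)
Definition level_of x s : R := ot x + s * (tl x - ot x).

(** At an atom, all levels strictly between [otail] and [tail] have the same quantile, and 0 < s < 1
    keeps the level strictly inside; without an atom the interval shrinks to the single level t. *)
Lemma quantile_level t s : 0 < t < 1 -> 0 < s < 1 ->
  0 < level_of (G t) s < 1 /\ G (level_of (G t) s) = G t.
Proof.
move=> t01 /andP[s0 s1]; rewrite /level_of.
have t1 := otail_quantile t01; have t2 := tail_quantile t01.
have [ab|ab] := eqVneq (ot (G t)) (tl (G t)).
  rewrite ab subrr mulr0 addr0.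
  have -> : tl (G t) = t by apply/eqP; rewrite eq_le t2 andbT -ab.
  by [].
have {}ab : ot (G t) < tl (G t) by rewrite lt_neqAle ab otail_le_tail.
set v := _ + _; have av : ot (G t) < v by rewrite /v; nra.
have vb : v < tl (G t) by rewrite /v; nra.
have v01 : 0 < v < 1.
  by have := otail_ge0 mu (G t); have := tail_le1 mu (G t); lra.
split => //; apply/eqP; rewrite eq_le; apply/andP; split;
  last by rewrite le_quantile// ltW.
rewrite leNgt; apply/negP => /(lt_quantile v01); lra.
Qed.

Let U01 : {measure set TR -> \bar R} :=
  mrestr lebesgue_measure (measurable_itv `[0%R, 1%R]).

Let U01T : U01 setT = 1%E.
Proof.
by rewrite /U01/= /mrestr setTI lebesgue_measure_itv/= lte_fin ltr01 oppr0
  adde0.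
Qed.

Let mU01 B : measurable B -> measurable_fun [set: TR] (fun _ : TR => U01 B).
Proof. by move=> _; exact: measurable_cst. Qed.

(** A constant kernel, through which the measurability of sections yields that of [unif]. *)
Let kU : R.-pker TR ~> TR := kernel_of mU01 (fun=> U01T).

Let mtl : measurable_fun [set: TR] tl.
Proof. by apply: nonincreasing_measurable => // x y; exact: le_tail. Qed.

Let mot : measurable_fun [set: TR] ot.
Proof.
apply: nonincreasing_measurable => // x y;
  rewrite le_eqVlt => /predU1P[->//|xy].
exact: le_trans (otail_le_tail mu y) (tail_le_otail mu xy).
Qed.

Let mlevel : measurable_fun [set: TR * TR] (fun z => level_of z.1 z.2 : TR).
Proof.
apply: measurable_funD; first exact: (measurableT_comp mot measurable_fst).
apply: measurable_funM; first exact: measurable_snd.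
apply: measurable_funB; first exact: (measurableT_comp mtl measurable_fst).
exact: (measurableT_comp mot measurable_fst).
Qed.

Let mlevel1 x : measurable_fun [set: TR] (fun s : TR => level_of x s : TR).
Proof.
apply: measurable_funD; first exact: measurable_cst.
by apply: measurable_funM; [exact: measurable_id|exact: measurable_cst].
Qed.

Let unif x : {measure set TR -> \bar R} := image_measure U01 (mlevel1 x).

Let munif B : measurable B -> measurable_fun [set: TR] (unif ^~ B).
Proof.
move=> mB.
have mC : measurable ((fun z : TR * TR => level_of z.1 z.2 : TR) @^-1` B).
  by rewrite -[X in measurable X]setTI; exact: mlevel.
have := measurable_kernel_xsection kU mC; congr measurable_fun.
by apply/funext => x; rewrite xsectionE.
Qed.

Let unifT x : unif x setT = 1%E. Proof. exact: U01T. Qed.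

(** The conditional law of the level given the position x: uniform on [otail x, tail x], a point
    mass when x is not an atom. *)
Definition level_kernel : R.-pker TR ~> TR := kernel_of munif unifT.

Let level_kernelE x B : level_kernel x B = U01 (level_of x @^-1` B).
Proof. by []. Qed.

Lemma level_kernel_integral x (f : R -> \bar R) : measurable_fun [set: R] f ->
  (forall y, 0 <= f y)%E ->
  (\int[level_kernel x]_v f v = \int[lebesgue_measure]_(s in `]0%R, 1%R[) f
    (level_of x s))%E.
Proof.
move=> mf f0.
have E := @ge0_integral_pushforward _ _ _ _ R _ (mlevel1 x) U01 setT f
  measurableT mf (fun y _ => f0 y).
have mfl : measurable_fun [set: R] (fun s => f (level_of x s)).
  exact: (measurableT_comp mf (mlevel1 x)).
rewrite [LHS]E preimage_setT ge0_integral_mrestr//; last by move=> y; exact: f0.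
rewrite -integral_itv_bndo_bndc; last exact: (measurable_funTS mfl).
by rewrite -integral_itv_obnd_cbnd//; exact: (measurable_funTS mfl).
Qed.

Let fin_mu : (mu setT < +oo)%E.
Proof.
by apply: le_lt_trans (probability_le1 mu measurableT) _; rewrite ltry.
Qed.

Let mu_integral (f : R -> \bar R) : measurable_fun [set: R] f ->
  (forall y, 0 <= f y)%E ->
  (\int[mu]_x f x = \int[lebesgue_measure]_(t in `]0%R, 1%R[) f (G t))%E.
Proof.
move=> mf f0.
have mfG : measurable_fun [set: R] (fun t => f (G t)).
  exact: (measurableT_comp mf (measurable_dquantile mu)).
rewrite (@eq_measure_integral _ _ _ _ (right_part mu 1)); last first.
  by move=> A mA _; rewrite right_part1.
rewrite right_part_integral//.
rewrite -integral_itv_bndo_bndc; last exact: (measurable_funTS mfG).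
by rewrite -integral_itv_obnd_cbnd//; exact: (measurable_funTS mfG).
Qed.

Let leb_set1 (r : R) : lebesgue_measure [set r] = 0%E.
Proof. exact: lebesgue_measure_set1. Qed.

Let ray_full x w : tl x <= w -> level_kernel x `]-oo, w]%classic = 1%E.
Proof.
move=> bw; rewrite level_kernelE /= /mrestr (_ : _ `&` _ = `[0, 1]%classic).
  by rewrite lebesgue_measure_itv/= lte_fin ltr01 oppr0 adde0.
apply/seteqP; split => [s []//|s]; rewrite /= !in_itv/= => /andP[s0 s1].
split; last by rewrite s0.
rewrite /level_of; have := otail_le_tail mu x; nra.
Qed.

(** The second condition excludes w = [otail] x = [tail] x, where the kernel is the point mass at w
    and the ray has full mass. *)
Let ray_empty x w : w <= ot x -> (w < ot x) || (ot x < tl x) ->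
  level_kernel x `]-oo, w]%classic = 0%E.
Proof.
move=> wa h; rewrite level_kernelE /= /mrestr; apply/eqP;
  rewrite eq_le measure_ge0 andbT.
apply: (@le_trans _ _ (lebesgue_measure [set (0 : R)]));
  last by rewrite leb_set1.
apply: le_measure; rewrite ?inE//.
  apply: measurableI => //; rewrite -[X in measurable X]setTI; exact: mlevel1.
move=> s [] /=; rewrite !in_itv/= /level_of => h1 /andP[s0 s1].
have ab := otail_le_tail mu x.
apply/eqP; rewrite eq_le s0 andbT leNgt; apply/negP => s00.
by case/orP: h => h; nra.
Qed.

Let ray_mid x w : ot x < tl x -> ot x <= w <= tl x ->
  level_kernel x `]-oo, w]%classic = ((w - ot x) / (tl x - ot x))%:E.
Proof.
move=> ab /andP[aw wb]; rewrite level_kernelE /= /mrestr.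
have d0 : 0 < tl x - ot x by rewrite subr_gt0.
rewrite (_ : _ `&` _ = `[0, (w - ot x) / (tl x - ot x)]%classic).
  rewrite lebesgue_measure_itv/= lte_fin; case: ifPn;
    first by rewrite oppr0 adde0.
  rewrite -leNgt => h; congr EFin; apply/eqP; rewrite eq_le h andbT.
  by rewrite divr_ge0// ?subr_ge0// ltW.
apply/seteqP; split => s /=; rewrite !in_itv/= /level_of.
  by move=> [h /andP[s0 s1]]; rewrite s0 ler_pdivlMr//= lerBrDl.
move=> /andP[s0]; rewrite ler_pdivlMr// lerBrDl => h; split => //;
  rewrite s0 /=.
by rewrite -(ler_pM2r d0) mul1r; lra.
Qed.

Let ray_lt t w : 0 < t < 1 -> w < t -> w <= ot (G t) ->
  level_kernel (G t) `]-oo, w]%classic = 0%E.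
Proof.
move=> t01 wt wa; apply: ray_empty => //.
have [//|] := ltP w (ot (G t)) => aw.
by apply: (le_lt_trans aw); apply: lt_le_trans wt _; exact: tail_quantile.
Qed.

Let mray w : measurable_fun [set: R] (fun x =>
  level_kernel x `]-oo, w]%classic).
Proof. exact: (measurable_kernel level_kernel _ (measurable_itv _)). Qed.

(* The distributional transform. *)
Lemma mixture_level_kernel B : measurable B ->
  mixture fin_mu level_kernel B = U01 B.
Proof.
apply: measure_eq_lee.
- by rewrite mixtureT.
- by rewrite mixtureT U01T; exact: probability_setT.
move=> w; rewrite mixtureE mu_integral; [|exact: mray|by move=> y;
  exact: measure_ge0].
have [w0|w0] := leP w 0.
  rewrite (eq_integral (cst 0%E)) ?integral0; last first.
    move=> t; rewrite inE/= in_itv/= => t01.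
    apply: ray_lt => //; first by case/andP: t01 => + _; exact: le_lt_trans.
    exact: le_trans w0 (otail_ge0 _ _).
  apply/esym/eqP; rewrite /U01/= /mrestr eq_le measure_ge0 andbT.
  apply: (@le_trans _ _ (lebesgue_measure [set (0 : R)]));
    last by rewrite leb_set1.
  apply: le_measure; rewrite ?inE//; first exact: measurableI.
  move=> s [] /=; rewrite !in_itv/= => sw /andP[s0 _].
  by apply/eqP; rewrite eq_le s0 andbT; exact: le_trans sw w0.
have [w1|w1] := leP 1 w.
  rewrite (eq_integral (cst 1%E)); last first.
    by move=> t _; apply: ray_full; exact: le_trans (tail_le1 _ _) w1.
  rewrite integral_cst//= mul1e /U01/= /mrestr.
  rewrite (_ : `]-oo, w]%classic `&` _ = `[0, 1]%classic).
    by rewrite !lebesgue_measure_itv.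
  apply/seteqP; split => s /=; rewrite !in_itv/=; first by case.
  by move=> /andP[-> s1]; split => //; exact: le_trans w1.
have w01 : 0 < w < 1 by rewrite w0.
have a1 := otail_quantile w01; have b1 := tail_quantile w01.
(* Positions above x0 have all their levels below w, those below x0 have almost all above w, and
   only x0 can be split. The mass of levels up to w is thus mu ]x0, oo[ + c mu {x0}. *)
pose x0 := G w.
pose c := level_kernel x0 `]-oo, w]%classic.
pose f x := ((\1_(`]x0, +oo[%classic : set TR) x)%:E + c *
  (\1_([set x0] : set TR) x)%:E)%E.
have mi (A : set TR) : measurable A ->
  measurable_fun [set: TR] (fun x => (\1_A x : R)%:E).
  by move=> mA; apply/measurable_EFinP; exact: measurable_indic.
have i0 (A : set TR) x : (0 <= (\1_A x : R)%:E)%E by rewrite lee_fin indicE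
  ler0n.
have mf : measurable_fun [set: R] f.
  by apply: emeasurable_funD; [exact: mi|apply: measurable_funeM; exact: mi].
have c0 : (0 <= c)%E by exact: measure_ge0.
have f0 x : (0 <= f x)%E by apply: adde_ge0; [exact: i0|apply: mule_ge0;
  [exact: c0|exact: i0]].
have mux0 : (mu [set x0] = (tl x0 - ot x0)%:E)%E.
  have : (mu `[x0, +oo[%classic = mu [set x0] + mu `]x0, +oo[%classic)%E.
    rewrite -measureU//; last first.
      by apply/seteqP; split => x //= [->]; rewrite in_itv/= ltxx.
    congr (mu _); apply/seteqP; split => x /=; rewrite !in_itv/= !andbT.
      by rewrite le_eqVlt => /predU1P[->|]; [left|right].
    by move=> [->//|/ltW].
  rewrite -tailE -otailE => h; rewrite EFinB h addeK//.
transitivity (\int[lebesgue_measure]_(t in `]0%R, 1%R[) f (G t))%E.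
  apply: eq_integral => t; rewrite inE/= in_itv/= => t01; rewrite /f !indicE.
  have [tx|tx|tx] := ltgtP (G t) x0.
  - rewrite !memNset/=;
      [|by apply/eqP; rewrite lt_eqF|by rewrite in_itv/= andbT ltNge ltW].
    rewrite mule0 adde0; apply: ray_lt => //.
      rewrite ltNge; apply/negP => tw; move: tx; rewrite ltNge /x0 /G.
      by rewrite quantile_antitone//; case/andP: t01.
    by apply: le_trans b1 _; exact: tail_le_otail.
  - rewrite mem_set/=; last by rewrite in_itv/= andbT.
    rewrite memNset/=; last by apply/eqP; rewrite gt_eqF.
    rewrite mule0 adde0; apply: ray_full.
    by apply: le_trans a1; exact: tail_le_otail.
  - rewrite tx memNset/=; last by rewrite in_itv/= ltxx.
    by rewrite mem_set//= mule1 add0e.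
rewrite -(mu_integral mf f0) /f ge0_integralD//; last 3 first.
- exact: mi.
- by move=> x _; apply: mule_ge0; [exact: c0|exact: i0].
- by apply: measurable_funeM; exact: mi.
rewrite ge0_integralZl//; last exact: mi.
rewrite !integral_indic// !setIT.
transitivity ((ot x0)%:E + c * (tl x0 - ot x0)%:E)%E.
  by congr (_ + c * _)%E; [rewrite otailE|exact: mux0].
have -> : U01 `]-oo, w]%classic = w%:E.
  rewrite /U01/= /mrestr (_ : _ `&` _ = `[0, w]%classic).
    by rewrite lebesgue_measure_itv/= lte_fin w0 oppr0 adde0.
  apply/seteqP; split => s /=; rewrite !in_itv/=;
    first by move=> [-> /andP[->]].
  by move=> /andP[-> sw]; split => //=; exact: le_trans sw (ltW w1).
have [ab|ab] := eqVneq (ot x0) (tl x0).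
  rewrite ab subrr mule0 adde0; congr EFin; apply/eqP; rewrite eq_le b1 andbT.
  by rewrite -/x0 -ab.
have {}ab : ot x0 < tl x0 by rewrite lt_neqAle ab otail_le_tail.
rewrite /c ray_mid//; last by apply/andP; split; [exact: a1|exact: b1].
rewrite -EFinM -EFinD divfK; first by rewrite addrC subrK.
by rewrite gt_eqF// subr_gt0.
Qed.

Lemma mu_integral_quantile (f : R -> \bar R) : measurable_fun [set: R] f ->
  (forall y, 0 <= f y)%E ->
  (\int[mu]_x f x = \int[lebesgue_measure]_(t in `]0%R, 1%R[) f (G t))%E.
Proof. exact: mu_integral. Qed.

(** Integration over levels, carried out first over the levels attached to one position and then
    over positions. *)
Lemma uniform_integral_level (f : R -> \bar R) : measurable_fun [set: R] f ->
  (forall y, 0 <= f y)%E ->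
  (\int[lebesgue_measure]_(t in `[0%R, 1%R]) f t =
   \int[mu]_x \int[level_kernel x]_v f v)%E.
Proof.
move=> mf f0; rewrite -(ge0_integral_mixture fin_mu level_kernel f0 mf).
transitivity (\int[U01]_t f t)%E; first by rewrite ge0_integral_mrestr.
by apply: eq_measure_integral => A mA _; apply/esym;
  exact: mixture_level_kernel.
Qed.

End transform.

(** * Averaging over levels and the decreasing coupling *)

Section decreasing.
Context (R : realType) (mu nu : probability (measurableTypeR R) R).
Local Notation TR := (measurableTypeR R).
Let G u := quantile mu (1 - u).
Local Notation LK := (level_kernel mu).

Let is_shadow_eq (eta eta' th : {measure set TR -> \bar R}) :
  (forall A, measurable A -> eta A = eta' A) ->
  is_shadow nu eta th -> is_shadow nu eta' th.
Proof.
move=> E [M cd le mi].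
have I f : (\int[eta]_x f x = \int[eta']_x f x)%E.
  by apply: eq_measure_integral => A mA _; exact: E.
split => //.
  by move=> f cf nf; rewrite -I; exact: cd.
by move=> th' M' cd' le'; apply: mi => // f cf nf; rewrite I; exact: cd'.
Qed.

Lemma decreasing_unique (pi pi' : {measure set (TR * TR) -> \bar R}) :
  is_decreasing_coupling mu nu pi -> is_decreasing_coupling mu nu pi' ->
  forall A, measurable A -> pi A = pi' A.
Proof.
move=> [[[p1 p2] _] psh] [[[p1' p2'] _] psh'].
have fin : (pi setT < +oo)%E.
  rewrite -setXTT p1//; apply: le_lt_trans (probability_le1 mu measurableT) _.
  by rewrite ltry.
apply: measure_eq_rect => // A B mA mB.
have mTB : measurable ([set: TR] `*` B) by exact: measurableX.
pose al (q : {measure set (TR * TR) -> \bar R}) :=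
  image_measure (mrestr q mTB) measurable_fst.
have alE (q : {measure set (TR * TR) -> \bar R}) C : al q C = q (C `*` B).
  by congr (q _); apply/seteqP; split => -[a b] /=;
    [move=> [? [_ ?]]|move=> [? ?]].
rewrite -!alE; apply: measure_eq_gee => //.
  by rewrite alE; apply: le_lt_trans fin; apply: le_measure; rewrite ?inE.
move=> x; rewrite !alE.
have [th [sh thE]] := psh x; have [th' [sh' thE']] := psh' x.
by rewrite thE// thE'//; exact: shadow_unique sh sh' _ _.
Qed.

Variable K : R.-pker TR ~> TR.

Let lk_fin x : (LK x setT < +oo)%E.
Proof. by rewrite prob_kernel ltry. Qed.

Let avg x : {measure set TR -> \bar R} := mixture (lk_fin x) K.

Let mavg B : measurable B -> measurable_fun [set: TR] (avg ^~ B).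
Proof.
move=> mB; exact: (measurable_fun_integral_kernel (measurable_kernel LK)
  (fun v => measure_ge0 (K v) B) (measurable_kernel K B mB)).
Qed.

Let avg1 x : avg x setT = 1%E.
Proof. by rewrite /avg mixtureT prob_kernel. Qed.

Definition averaged_kernel : R.-pker TR ~> TR := kernel_of mavg avg1.

Let avgE x B : averaged_kernel x B = (\int[LK x]_v K v B)%E.
Proof. by []. Qed.

Let pi := marginal23 (lifted_coupling mu K).

Let piE A B : pi (A `*` B) = lifted_coupling mu K ([set: TR] `*` A `*` B).
Proof.
by congr (lifted_coupling mu K _); apply/seteqP; split => -[[a b] c] /=;
  [move=> [? ?]|move=> [[_ ?] ?]].
Qed.

(** The condition that G_v lies in A is constant over the levels v attached to one position, so it
    leaves the inner integral. *)
Lemma averaged_kernel_disintegration A B : measurable A -> measurable B ->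
  pi (A `*` B) = (\int[mu]_(x in A) averaged_kernel x B)%E.
Proof.
move=> mA mB; rewrite piE lifted_couplingX//; last exact: measurableX.
pose h v : \bar R := ((fun v => K v B) \_ (G @^-1` A)) v.
have mGA : measurable (G @^-1` A : set TR).
  by rewrite -[X in measurable X]setTI; exact: measurable_dquantile.
have mh : measurable_fun [set: R] h.
  by apply/(measurable_restrictT _ mGA); apply: measurable_funTS;
    exact: (measurable_kernel K B mB).
have h0 v : (0 <= h v)%E by rewrite /h patchE; case: ifPn.
have -> : (fun t => (t, quantile mu (1 - t))) @^-1` ([set: TR] `*` A) =
  G @^-1` A.
  by apply/seteqP; split => t /=; [move=> []|].
rewrite integral_mkcondr (uniform_integral_level mu mh h0) mu_integral_quantile;
  last 2 first.
- by apply: measurable_fun_integral_kernel => // U mU;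
    exact: (measurable_kernel LK U mU).
- by move=> y; exact: integral_ge0.
rewrite [RHS]integral_mkcond mu_integral_quantile; last 2 first.
- by apply/(measurable_restrictT _ mA); apply: measurable_funTS;
    exact: (measurable_kernel averaged_kernel B mB).
- by move=> y; rewrite patchE; case: ifPn.
apply: eq_integral => t; rewrite inE/= in_itv/= => t01.
rewrite level_kernel_integral// patchE avgE.
case: ifPn => GA.
  rewrite level_kernel_integral//; last exact: (measurable_kernel K B mB).
  apply: eq_integral => s; rewrite inE/= in_itv/= => s01; rewrite /h patchE.
  have [_ Gs] := quantile_level mu t01 s01.
  by rewrite ifT// inE/= /G Gs; rewrite inE in GA.
rewrite (eq_integral (cst 0%E)) ?integral0// => s;
  rewrite inE/= in_itv/= => s01; rewrite /h patchE.
have [_ Gs] := quantile_level mu t01 s01.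
rewrite ifF//; apply/negbTE; rewrite notin_setE/= /G Gs.
by rewrite notin_setE in GA.
Qed.

Hypotheses (mu1 : first_moment mu) (nu1 : first_moment nu) (munu : cd_le mu nu).
Hypothesis KM : forall u, measM (K u).
Hypothesis Kput : forall u k, 0 < u < 1 -> put_fun (K u) k = put_RS mu nu u k.
Hypothesis Kmean : forall u, 0 < u < 1 -> \int[K u]_y y <= G u.

Let mpart b : measurable_fun [set: R] (fun y : R => (Num.max (b * y) 0)%:E).
Proof.
apply/measurable_EFinP; have := @measurable_max_affine R 0 b.
by congr measurable_fun; apply/funext => x; rewrite add0r.
Qed.

Let part_ge0 b y : (0 <= (Num.max (b * y) 0)%:E :> \bar R)%E.
Proof. by rewrite lee_fin le_max lexx orbT. Qed.

(** Positive and negative parts are averaged separately, since y need not be integrable for the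
    averaged kernel at a given position. *)
Lemma averaged_kernel_mean t : 0 < t < 1 ->
  (\int[averaged_kernel (G t)]_y y%:E <= (G t)%:E)%E.
Proof.
move=> t01; set x := G t.
pose p b v := \int[K v]_y Num.max (b * y) 0.
have ip b v : int1 (K v) (fun y => Num.max (b * y) 0).
  have := int1_max_affine 0 b (KM v); congr int1.
  by apply/funext => y; rewrite add0r.
have pE b v : (\int[K v]_y (Num.max (b * y) 0)%:E = (p b v)%:E)%E.
  by rewrite fineK//; exact: (integrable_fin_num measurableT (ip b v)).
have mp b : measurable_fun [set: R] (fun v => (p b v)%:E).
  under eq_fun do rewrite -pE; apply: measurable_fun_integral_kernel => //.
    by move=> U mU; exact: (measurable_kernel K U mU).
  exact: mpart.
have p0 b v : (0 <= (p b v)%:E)%E by rewrite -pE; apply: integral_ge0 => y _;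
  exact: part_ge0.
pose I b := (\int[lebesgue_measure]_(s in `]0%R, 1%R[)
  (p b (level_of mu x s))%:E)%E.
have IE b : (\int[averaged_kernel x]_y (Num.max (b * y) 0)%:E = I b)%E.
  rewrite (ge0_integral_mixture (lk_fin x) K (part_ge0 b) (mpart b)).
  under eq_integral do rewrite pE.
  by rewrite level_kernel_integral.
rewrite integralE.
have -> : (\int[averaged_kernel x]_y (fun y : R => y%:E)^\+%E y = I 1%R)%E.
  by rewrite -IE; apply: eq_integral => y _; rewrite funeposE mul1r EFin_max.
have -> : (\int[averaged_kernel x]_y (fun y : R => y%:E)^\-%E y = I (-1)%R)%E.
  by rewrite -IE; apply: eq_integral => y _;
    rewrite funenegE mulN1r EFin_max EFinN.
have I0 b : (0 <= I b)%E by apply: integral_ge0 => s _.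
(* With an infinite negative part the integral is -oo, even for an infinite positive part, by the
   convention on sums. *)
have [->|Iy] := eqVneq (I (-1)) +oo%E; first by rewrite addeNy leNye.
have Ifin : I (-1) \is a fin_num by rewrite ge0_fin_numE// ltey.
rewrite leeBlDr//.
have mpl b : measurable_fun (`]0, 1[%classic : set R) (fun s =>
  (p b (level_of mu x s))%:E).
  apply: measurable_funTS; apply: (measurableT_comp (mp b)).
  apply: measurable_funD; first exact: measurable_cst.
  by apply: measurable_funM; [exact: measurable_id|exact: measurable_cst].
pose xp := Num.max x 0; pose xm := Num.max (- x) 0.
have xpm : xp - xm = x.
  by rewrite /xp /xm; have [h|h] := leP x 0; have [h'|h'] := leP (- x) 0; lra.
have xp0 : 0 <= xp by rewrite /xp le_max lexx orbT.
have xm0 : 0 <= xm by rewrite /xm le_max lexx orbT.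
have cE (c : R) : (\int[lebesgue_measure]_(s in `]0%R, 1%R[) c%:E = c%:E)%E.
  by rewrite integral_cst//= lebesgue_measure_itv/= lte_fin ltr01 oppr0 adde0
    mule1.
(* The mean inequality at each level, freed of subtraction so that both sides are nonnegative and
   can be integrated. *)
have : (I 1%R + xm%:E <= I (-1)%R + xp%:E)%E.
  rewrite -(cE xm) -(cE xp) /I -!ge0_integralD//; [|exact: mpl|exact: mpl].
  have mcst (c : R) : measurable_fun (`]0, 1[%classic : set R) (fun=> c%:E :
    \bar R).
    exact: measurable_cst.
  apply: ge0_le_integral => //.
  - by move=> s _; apply: adde_ge0 => //; rewrite lee_fin.
  - exact: (emeasurable_funD (mpl _) (mcst _)).
  - exact: (emeasurable_funD (mpl _) (mcst _)).
  - move=> s; rewrite /= in_itv/= => s01.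
    have [v01 Gv] : 0 < level_of mu x s < 1 /\ G (level_of mu x s) = x.
      exact: quantile_level.
    have := Kmean v01; rewrite Gv => mean.
    have E : \int[K (level_of mu x s)]_y y = p 1 (level_of mu x s) -
      p (-1) (level_of mu x s).
      rewrite /p -RintegralB//; [|exact: ip|exact: ip].
      apply: eq_Rintegral => y _; rewrite mul1r mulN1r.
      by have [h|h] := leP y 0; have [h'|h'] := leP (- y) 0; lra.
    by rewrite -!EFinD lee_fin; move: mean; rewrite E; lra.
move: Ifin; case: (I (-1)) => // i _; case: (I 1) => [j| |] //.
  by rewrite -!EFinD !lee_fin; lra.
by move=> _; exact: leNye.
Qed.

Lemma decreasing_couplingP : is_decreasing_coupling mu nu pi.
Proof.
have lc := lifted_couplingP mu1 nu1 munu KM Kput Kmean.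
have [[[c1 c2] _] csh] := lc.
split; first split.
- split.
    move=> A mA; rewrite piE c1; last exact: measurableX.
    apply: etrans (right_part1 mu mA);
      rewrite right_part_itv// decreasing_liftE; last exact: measurableX.
    congr (lebesgue_measure (_ `&` _)); apply/seteqP; split => t /=;
      first by case.
    by [].
  by move=> B mB; rewrite piE setXTT c2.
- exists averaged_kernel; split; first exact: averaged_kernel_disintegration.
  pose N := [set x : TR | (x%:E < \int[averaged_kernel x]_y y%:E)%E].
  have mN : measurable N.
    rewrite -[N]setTI; apply: measurable_lte;
      [exact: measurableT|exact: EFin_measurable|].
    have mint b : measurable_fun [set: TR] (fun x =>
      \int[averaged_kernel x]_y (Num.max (b * y) 0)%:E)%E.
      apply: measurable_fun_integral_kernel => //; last exact: mpart.
    apply: eq_measurable_fun (emeasurable_funB (mint 1) (mint (- 1))) => x _.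
    rewrite [RHS]integralE; congr (_ - _)%E; apply: eq_integral => y _.
      by rewrite funeposE mul1r EFin_max.
    by rewrite funenegE mulN1r EFin_max EFinN.
  exists N; split => //; last by move=> x /= /negP; rewrite -ltNge.
  (* The mean inequality is known at the points G_t; pulling mu back to the levels shows that it
     holds almost everywhere. *)
  have muN : (\int[mu]_x (\1_N x)%:E)%E = mu N by rewrite integral_indic//
    setIT.
  apply: etrans (esym muN) _.
  rewrite mu_integral_quantile; last 2 first.
  + by apply/measurable_EFinP; exact: measurable_indic.
  + by move=> y; rewrite lee_fin indicE ler0n.
  rewrite (eq_integral (cst 0%E)) ?integral0// => t;
    rewrite inE/= in_itv/= => t01.
  by rewrite indicE memNset//= /N/=; apply/negP; rewrite -leNgt;
    exact: averaged_kernel_mean.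
(* On the graph, a position in [x, oo) means a level in [0, [tail] x], by [le_quantile]; the shadow
   prescribed at that level is the one required. *)
- move=> x; have t01 : 0 <= tail mu x <= 1 by rewrite tail_ge0 tail_le1.
  have [th [sh _ thE]] := csh _ t01; exists th; split.
    by apply: is_shadow_eq sh => A mA; exact: esym (mrestr_right_part mu x mA).
  move=> B mB; rewrite -thE// piE.
  apply: (@measure_eq_mod_null _ _ _ _ _ _ (off_graph mu `*` setT)).
  + by apply: measurableX => //; exact: measurableX.
  + by apply: measurableX => //; exact: measurableX.
  + by apply: measurableX => //; exact: measurable_off_graph.
  + by rewrite c1; [exact: decreasing_lift_off_graph|exact:
      measurable_off_graph].
  + move=> [z y] [[_ Az] By]; have [oz|/off_graphP[z1 z2]] :=
      pselect (off_graph mu z).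
      by right.
    left; split => //; split => //; move: Az;
      rewrite /= !in_itv/= andbT z2 le_quantile// => ->.
    by case/andP: z1 => /ltW ->.
  + move=> [z y] [[Az _] By]; have [oz|/off_graphP[z1 z2]] :=
      pselect (off_graph mu z).
      by right.
    left; split => //; split => //; move: Az;
      rewrite /= !in_itv/= andbT z2 le_quantile//.
    by case/andP.
Qed.

End decreasing.

Theorem theorem6p1 (R : realType)
    (mu nu : probability (measurableTypeR R) R)
    (mu1 : first_moment mu) (nu1 : first_moment nu) (munu : cd_le mu nu) :
  exists pihat : {measure set (measurableTypeR R * measurableTypeR R *
                               measurableTypeR R) -> \bar R},
    [/\ is_RS_lift mu nu pihat,
        is_the_measure (is_lifted_shadow_coupling mu nu) pihat &
        is_the_measure (is_decreasing_coupling mu nu) (marginal23 pihat)].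
Proof.
have [K [Kchi KM Kput Kmean]] := RS_kernel mu1 nu1 munu.
have lc := lifted_couplingP mu1 nu1 munu KM Kput Kmean.
have dc := decreasing_couplingP mu1 nu1 munu KM Kput Kmean.
exists (lifted_coupling mu K); split.
- by exists K; split => // A mA; exact: lifted_couplingE.
- split => [|pi pil A mA]; first exact: lc.
  exact: (lifted_unique pil lc mA).
- split => [|pi pid A mA]; first exact: dc.
  exact: (decreasing_unique pid dc mA).
Qed.
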